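(* Given an $\mathsf{ATL}^*$ state formula $\Phi$ over $AP$, with $B_\Phi$ its set of basic subformulas, one can construct in time doubly exponential in $|\Phi|$ a parity ACG $\mathcal{A}_\Phi$ over $2^{AP\cup B_\Phi}$ accepting exactly the set of CGTs over $AP\cup B_\Phi$ which are well-formed with respect to $\Phi$. Moreover, $\mathcal{A}_\Phi$ has size $O\big(2^{2^{O(|\Phi|\cdot\log|\Phi|)}}\big)$ and index $2^{O(|\Phi|)}$.
   Context: Fix finite sets $AP$, $Ag$, $Ac$; $A$-decisions are elements of $Ac^A$, $Dc=Ac^{Ag}$. A CGS is $\langle S,s_0,Lab,\tau\rangle$ with $Lab:S\to2^{AP}$, $\tau:S\times Dc\to S\cup\{\top\}$, each state having a defined transition. $d_A$ available at $s$: $\tau(s,d_A\cup d')\in S$ for some $d'$; $Dc_A(s)$ the available ones. Strategies $f_A$ map tracks (finite nonempty prefixes of plays) to available $A$-decisions; counter strategies $f^c_A$ map each track $\nu$ to a function assigning to each $d_A\in Dc_A(last(\nu))$ an $(Ag\setminus A)$-decision $d'$ with $\tau(last(\nu),d_A\cup d')\in S$; the consistent plays are defined in the obvious way (for a strategy: each step $\tau(s_i,f_A(\text{track})\cup d)$ for some $d$; for a counter strategy: each step $\tau(s_i,d\cup[f^c_A(\text{track})](d))$ for some $d\in Dc_A(s_i)$). A CGT is a CGS whose states form a tree with root $\varepsilon$ and successors = children. $\mathsf{ATL}^*$ syntax $\varphi::=\mathtt{true}\mid p\mid\neg\varphi\mid\varphi\vee\varphi\mid\mathsf{X}\varphi\mid\varphi\mathsf{U}\varphi\mid\langle\!\langle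 A\rangle\!\rangle\varphi$ with standard semantics ($\langle\!\langle A\rangle\!\rangle\varphi$: some strategy of $A$ enforces $\varphi$ on all consistent plays). State formula: all temporal modalities under strategic quantifiers; basic formula: a state formula $\langle\!\langle A\rangle\!\rangle\psi$. $[\varphi]_{LTL}$ is $\varphi$ read as an LTL formula over $AP$ plus its first-level basic subformulas (those with an occurrence not under any strategic quantifier) as atoms. A CGT $\mathcal{T}=\langle T,\varepsilon,Lab_\Phi,\tau\rangle$ over $AP\cup B_\Phi$ is well-formed w.r.t. $\Phi$ if (i) for every $\langle\!\langle A\rangle\!\rangle\psi\in B_\Phi$ and node $\nu$: if $\langle\!\langle A\rangle\!\rangle\psi\in Lab_\Phi(\nu)$ there is a strategy $f_A$ in $\mathcal{T}$ such that all plays from $\nu$ consistent with it have label sequence satisfying $[\psi]_{LTL}$, and if $\langle\!\langle A\rangle\!\rangle\psi\notin Lab_\Phi(\nu)$ there is a counter strategy $f^c_A$ such that all plays from $\nu$ consistent with it have label sequence satisfying $[\neg\psi]_{LTL}$; and (ii) $Lab_\Phi(\varepsilon)$ satisfies the propositional formula $[\Phi]_{LTL}$. A parity ACG over $2^{P}$ and $Ag$ is $\langle Q,q_0,\delta,\alpha\rangle$, $\delta:Q\times2^{P}\to\mathbb{B}^+(Q\times\{\Box,\Diamond\}\times2^{Ag})$, $\alpha:Q\to\mathbb{N}$; index $=|\alpha(Q)|$, size $=|Q|$ + number of atoms occurring in $\delta$. A run on a CGT is a $(Q\times T)$-labeled tree rooted at $(q_0,\varepsilon)$ where for a node labeled $(q,\nu)$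 some set $H$ of atoms satisfies $\delta(q,Lab(\nu))$ and the children's labels minimally satisfy: for each $(q',\Box,A)\in H$ some available $A$-decision $d_A$ at $\nu$ has $(q',\nu')$ for all children $\nu'$ consistent with $d_A$; for each $(q',\Diamond,A)\in H$ and every available $A$-decision $d_A$ some child $\nu'$ consistent with $d_A$ has $(q',\nu')$. Accepting: on every infinite path the maximal color seen infinitely often is even. *)

(* Defs.v *)
From HB Require Import structures.
From mathcomp Require Import all_boot.
Set Implicit Arguments.
Unset Strict Implicit.
Unset Printing Implicit Defensive.

Inductive form (AP Ag : finType) :=
| FTrue
| FProp (p : AP)
| FNeg (f : form AP Ag)
| FOr (f g : form AP Ag)
| FNext (f : form AP Ag)
| FUntil (f g : form AP Ag)
| FStrat (A : {set Ag}) (f : form AP Ag).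
Arguments FTrue {AP Ag}.
Arguments FProp {AP Ag}.

Section FormCountable.
Context (AP Ag : finType).

Fixpoint form_tree (f : form AP Ag) : GenTree.tree (AP + {set Ag}) :=
  match f with
  | FTrue => GenTree.Node 0 [::]
  | FProp p => GenTree.Leaf (inl p)
  | FNeg g => GenTree.Node 1 [:: form_tree g]
  | FOr g h => GenTree.Node 2 [:: form_tree g; form_tree h]
  | FNext g => GenTree.Node 3 [:: form_tree g]
  | FUntil g h => GenTree.Node 4 [:: form_tree g; form_tree h]
  | FStrat A g => GenTree.Node 5 [:: GenTree.Leaf (inr A); form_tree g]
  end.

Fixpoint tree_form (t : GenTree.tree (AP + {set Ag})) : option (form AP Ag) :=
  match t with
  | GenTree.Node 0 [::] => Some FTrue
  | GenTree.Leaf (inl p) => Some (FProp p)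
  | GenTree.Node 1 [:: t1] => omap (@FNeg AP Ag) (tree_form t1)
  | GenTree.Node 2 [:: t1; t2] =>
      if (tree_form t1, tree_form t2) is (Some g, Some h) then Some (FOr g h)
      else None
  | GenTree.Node 3 [:: t1] => omap (@FNext AP Ag) (tree_form t1)
  | GenTree.Node 4 [:: t1; t2] =>
      if (tree_form t1, tree_form t2) is (Some g, Some h) then Some (FUntil g h)
      else None
  | GenTree.Node 5 [:: GenTree.Leaf (inr A); t1] =>
      omap (FStrat A) (tree_form t1)
  | _ => None
  end.

Lemma form_treeK : pcancel form_tree tree_form.
Proof.
by elim=> //= [f ->|f -> g ->|f ->|f -> g ->|A f ->].
Qed.

HB.instance Definition _ :=
  Countable.copy (form AP Ag) (pcan_type form_treeK).

End FormCountable.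

Section Syntax.
Context (AP Ag : finType).
Implicit Type f : form AP Ag.

Fixpoint is_state f : bool :=
  match f with
  | FTrue | FProp _ | FStrat _ _ => true
  | FNeg g => is_state g
  | FOr g h => is_state g && is_state h
  | FNext _ | FUntil _ _ => false
  end.

(* |f|: number of nodes of the syntax tree. *)
Fixpoint fsize f : nat :=
  match f with
  | FTrue | FProp _ => 1
  | FNeg g | FNext g | FStrat _ g => (fsize g).+1
  | FOr g h | FUntil g h => (fsize g + fsize h).+1
  end.

Fixpoint basics f : seq (form AP Ag) :=
  match f with
  | FTrue | FProp _ => [::]
  | FNeg g | FNext g => basics g
  | FOr g h | FUntil g h => basics g ++ basics h
  | FStrat _ g => f :: basics g
  end.

(* The finite type of the basic subformulas of f, without repetitions. *)
Definition basic f : finType := seq_sub (basics f).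

Definition props f : finType := (AP + basic f)%type.

End Syntax.

Inductive ltl (X : Type) :=
| LTrue
| LAtom (x : X)
| LNeg (f : ltl X)
| LOr (f g : ltl X)
| LNext (f : ltl X)
| LUntil (f g : ltl X).
Arguments LTrue {X}.

Fixpoint ltl_sat (X : Type) (w : nat -> X -> bool) (i : nat) (f : ltl X) : Prop :=
  match f with
  | LTrue => True
  | LAtom x => w i x
  | LNeg g => ~ ltl_sat w i g
  | LOr g h => ltl_sat w i g \/ ltl_sat w i h
  | LNext g => ltl_sat w i.+1 g
  | LUntil g h => exists j, [/\ i <= j, ltl_sat w j h &
                    forall k, i <= k < j -> ltl_sat w k g]
  end.

(* Truth of a propositional formula under a valuation; it is only applied to
   formulas without temporal modalities, and the last two cases are junk. *)
Fixpoint prop_sat (X : Type) (v : X -> bool) (f : ltl X) : bool :=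
  match f with
  | LTrue => true
  | LAtom x => v x
  | LNeg g => ~~ prop_sat v g
  | LOr g h => prop_sat v g || prop_sat v h
  | LNext _ | LUntil _ _ => false
  end.

(* [f]_LTL: the first-level basic subformulas become atoms. *)
Fixpoint ltl_of (AP Ag : finType) (f : form AP Ag) : ltl (AP + form AP Ag) :=
  match f with
  | FTrue => LTrue
  | FProp p => LAtom (inl p)
  | FNeg g => LNeg (ltl_of g)
  | FOr g h => LOr (ltl_of g) (ltl_of h)
  | FNext g => LNext (ltl_of g)
  | FUntil g h => LUntil (ltl_of g) (ltl_of h)
  | FStrat A g => LAtom (inr (FStrat A g))
  end.

(* The valuation of the atoms of [g]_LTL given by a label over props f.  When
   g is a subformula of f, the atoms of [g]_LTL all belong to props f, so that
   insub succeeds on them. *)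
Definition valuation (AP Ag : finType) (f : form AP Ag)
    (sigma : {set props f}) (x : AP + form AP Ag) : bool :=
  match x with
  | inl p => inl p \in sigma
  | inr g => if (insub g : option (basic f)) is Some b then inr b \in sigma
             else false
  end.

Definition adec (Ag Ac : finType) (A : {set Ag}) : finType :=
  {ffun {a : Ag | a \in A} -> Ac}.

Definition decision (Ag Ac : finType) : finType := {ffun Ag -> Ac}.

Lemma notin_setC (Ag : finType) (A : {set Ag}) (a : Ag) :
  a \notin A -> a \in ~: A.
Proof. by rewrite inE. Qed.

Definition djoin (Ag Ac : finType) (A : {set Ag})
    (dA : adec Ac A) (d : adec Ac (~: A)) : decision Ag Ac :=
  [ffun a => match boolP (a \in A) with
             | AltTrue aA => dA (exist _ a aA)
             | AltFalse aNA => d (exist _ a (notin_setC aNA))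
             end].

Lemma djoin_in (Ag Ac : finType) (A : {set Ag})
    (dA : adec Ac A) (d : adec Ac (~: A)) (a : Ag) (h : a \in A) :
  djoin dA d a = dA (exist _ a h).
Proof.
rewrite ffunE; case: {-}_ / boolP => h'; last by case/negP: (h').
by congr (dA _); apply: val_inj. Qed.

Lemma djoin_out (Ag Ac : finType) (A : {set Ag})
    (dA : adec Ac A) (d : adec Ac (~: A)) (a : Ag) (h : a \in ~: A) :
  djoin dA d a = d (exist _ a h).
Proof.
rewrite ffunE; case: {-}_ / boolP => h'; first by exfalso; move: h; rewrite inE h'.
by congr (d _); apply: val_inj. Qed.

(* None plays the role of the undefined value of the transition function. *)
Record cgs (Ag Ac P : finType) := CGS {
  state :> Type;
  init : state;
  lab : state -> {set P};
  trans : state -> decision Ag Ac -> option state;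
  trans_total : forall s, exists d, trans s d <> None
}.

(* A concurrent game tree: the states are the nodes of a tree, i.e. of a
   prefix-closed set of finite words over nat.  There is no loss in this
   choice of directions, since game structures are finitely branching. *)
Record cgt (Ag Ac P : finType) := CGT {
  nodes : pred (seq nat);
  nodes_root : nodes [::];
  nodes_prefix : forall x n, nodes (rcons x n) -> nodes x;
  tlab : {x | nodes x} -> {set P};
  ttrans : {x | nodes x} -> decision Ag Ac -> option {x | nodes x};
  ttrans_total : forall x, exists d, ttrans x d <> None;
  succ_child : forall x y, (exists d, ttrans x d = Some y) <->
                           (exists n, val y = rcons (val x) n)
}.

Definition cgs_of_cgt (Ag Ac P : finType) (T : cgt Ag Ac P) : cgs Ag Ac P :=
  @CGS Ag Ac P {x | nodes T x} (exist _ [::] (nodes_root T))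
    (@tlab _ _ _ T) (@ttrans _ _ _ T) (@ttrans_total _ _ _ T).

Coercion cgs_of_cgt : cgt >-> cgs.

Section Strategies.
Context (Ag Ac P : finType) (G : cgs Ag Ac P).
Implicit Types (s : G) (A : {set Ag}) (pi : nat -> G).

Definition succ_by A s (dA : adec Ac A) s' : Prop :=
  exists d : adec Ac (~: A), trans s (djoin dA d) = Some s'.

Definition available A s (dA : adec Ac A) : Prop :=
  exists d : adec Ac (~: A), trans s (djoin dA d) <> None.

Definition is_play pi : Prop :=
  forall i, exists d, trans (pi i) d = Some (pi i.+1).

Definition track pi i : seq G := mkseq pi i.+1.

(* Tracks are exactly the track pi i with pi a play; the values of a strategy
   or of a counter strategy outside tracks are irrelevant. *)
Definition is_strategy A (f : seq G -> adec Ac A) : Prop :=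
  forall pi i, is_play pi -> available (pi i) (f (track pi i)).

Definition is_counter A (fc : seq G -> adec Ac A -> adec Ac (~: A)) : Prop :=
  forall pi i, is_play pi -> forall dA, available (pi i) dA ->
    trans (pi i) (djoin dA (fc (track pi i) dA)) <> None.

Definition out A (f : seq G -> adec Ac A) pi : Prop :=
  forall i, exists d, trans (pi i) (djoin (f (track pi i)) d) = Some (pi i.+1).

Definition out_counter A (fc : seq G -> adec Ac A -> adec Ac (~: A)) pi : Prop :=
  forall i, exists2 dA, available (pi i) dA &
    trans (pi i) (djoin dA (fc (track pi i) dA)) = Some (pi i.+1).

End Strategies.

Definition well_formed (AP Ag Ac : finType) (Phi : form AP Ag)
    (T : cgt Ag Ac (props Phi)) : Prop :=
  (forall (b : basic Phi) (A : {set Ag}) (psi : form AP Ag),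
     val b = FStrat A psi ->
   forall nu : T,
     (inr b \in lab nu ->
        exists2 f : seq T -> adec Ac A, is_strategy f &
          forall pi : nat -> T, pi 0 = nu -> out f pi ->
            ltl_sat (fun i => valuation (lab (pi i))) 0 (ltl_of psi)) /\
     (inr b \notin lab nu ->
        exists2 fc : seq T -> adec Ac A -> adec Ac (~: A), is_counter fc &
          forall pi : nat -> T, pi 0 = nu -> out_counter fc pi ->
            ltl_sat (fun i => valuation (lab (pi i))) 0 (ltl_of (FNeg psi))))
  /\ prop_sat (valuation (lab (init T))) (ltl_of Phi).

Inductive modality := Box | Diamond.

Definition modality_bool m := if m is Box then true else false.
Definition bool_modality (b : bool) := if b then Box else Diamond.
Lemma modality_boolK : cancel modality_bool bool_modality.
Proof. by case. Qed.

HB.instance Definition _ := Finite.copy modality (can_type modality_boolK).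

Inductive pbf (X : Type) :=
| PTrue
| PFalse
| PAtom (x : X)
| PAnd (f g : pbf X)
| POr (f g : pbf X).
Arguments PTrue {X}.
Arguments PFalse {X}.

Fixpoint pbf_sat (X : Type) (H : X -> bool) (f : pbf X) : bool :=
  match f with
  | PTrue => true
  | PFalse => false
  | PAtom x => H x
  | PAnd g h => pbf_sat H g && pbf_sat H h
  | POr g h => pbf_sat H g || pbf_sat H h
  end.

Fixpoint pbf_atoms (X : Type) (f : pbf X) : seq X :=
  match f with
  | PTrue | PFalse => [::]
  | PAtom x => [:: x]
  | PAnd g h | POr g h => pbf_atoms g ++ pbf_atoms h
  end.

Definition move (Ag Q : finType) : finType := (Q * modality * {set Ag})%type.

Record acg (P Ag : finType) := ACG {
  acg_state :> finType;
  q0 : acg_state;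
  delta : acg_state -> {set P} -> pbf (move Ag acg_state);
  color : acg_state -> nat
}.

Definition acg_moves (P Ag : finType) (A : acg P Ag) : {set move Ag A} :=
  [set m | [exists q : A, exists sigma : {set P},
              m \in pbf_atoms (delta q sigma)]].

Definition acg_size (P Ag : finType) (A : acg P Ag) : nat :=
  #|A| + #|acg_moves A|.

Definition acg_index (P Ag : finType) (A : acg P Ag) : nat :=
  size (undup (codom (@color _ _ A))).

Section Runs.
Context (Ag Ac P : finType) (A : acg P Ag) (T : cgt Ag Ac P).

(* L (q, nu') means that some child of the run node carries (q, nu'). *)
Definition moves_ok (H : {set move Ag A}) (nu : T) (L : A * T -> Prop) : Prop :=
  (forall q B, (q, Box, B) \in H ->
     exists2 dB : adec Ac B, available nu dB &
       forall nu' : T, succ_by nu dB nu' -> L (q, nu')) /\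
  (forall q B, (q, Diamond, B) \in H ->
     forall dB : adec Ac B, available nu dB ->
       exists2 nu' : T, succ_by nu dB nu' & L (q, nu')).

Definition moves_min (H : {set move Ag A}) (nu : T) (L : A * T -> Prop) : Prop :=
  moves_ok H nu L /\
  forall L' : A * T -> Prop, (forall x, L' x -> L x) -> moves_ok H nu L' ->
    forall x, L x -> L' x.

(* A run: a prefix-closed set D of finite words, labeled by r. *)
Definition is_run (D : pred (seq nat)) (r : seq nat -> A * T) : Prop :=
  [/\ D [::],
      forall y n, D (rcons y n) -> D y,
      r [::] = (q0 A, init T) &
      forall y, D y -> exists2 H : {set move Ag A},
        pbf_sat (fun m => m \in H) (delta (r y).1 (lab (r y).2)) &
        moves_min H (r y).2 (fun x => exists2 n, D (rcons y n) &
                                        r (rcons y n) = x)].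

Definition parity_ok (u : nat -> nat) : Prop :=
  exists m, [/\ ~~ odd m,
                forall i, exists2 j, i <= j & u j = m &
                exists i, forall j, i <= j -> u j <= m].

(* An infinite path of D from the root is a sequence c of directions, all the
   finite prefixes mkseq c i of which are in D. *)
Definition accepting (D : pred (seq nat)) (r : seq nat -> A * T) : Prop :=
  forall c : nat -> nat, (forall i, D (mkseq c i)) ->
    parity_ok (fun i => color (r (mkseq c i)).1).

Definition accepts : Prop := exists D r, is_run D r /\ accepting D r.

End Runs.

(* Model of computation: first-order recursive programs over binary trees (pure
   Lisp), as in N. D. Jones, "Computability and Complexity: From a Programming
   Perspective".  Each evaluation step is charged the size of the tree that it
   returns.  Hence no sharing of subtrees is presupposed, the size of a result
   never exceeds the time needed to compute it, and this time is polynomially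
   related to that of Turing machines. *)
Inductive data := Nil | Node (a b : data).

Fixpoint dsize (a : data) : nat :=
  if a is Node b c then (dsize b + dsize c).+1 else 1.

Definition dhd (a : data) : data := if a is Node b _ then b else Nil.
Definition dtl (a : data) : data := if a is Node _ c then c else Nil.

(* EVar i is the i-th variable (de Bruijn), ELet e1 e2 binds the value of e1 in
   e2, and ECall n e applies the n-th function of the program.  A function has
   a single variable, its argument. *)
Inductive expr :=
| EVar (i : nat)
| ENil
| ENode (e1 e2 : expr)
| EHd (e : expr)
| ETl (e : expr)
| EIf (e1 e2 e3 : expr)
| ELet (e1 e2 : expr)
| ECall (n : nat) (e : expr).

Definition program := seq expr.

Inductive eval (p : program) : seq data -> expr -> data -> nat -> Prop :=
| eval_var env i :
    eval p env (EVar i) (nth Nil env i) (dsize (nth Nil env i))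
| eval_nil env : eval p env ENil Nil (dsize Nil)
| eval_node env e1 e2 a1 a2 t1 t2 :
    eval p env e1 a1 t1 -> eval p env e2 a2 t2 ->
    eval p env (ENode e1 e2) (Node a1 a2) (t1 + t2 + dsize (Node a1 a2))
| eval_hd env e a t :
    eval p env e a t -> eval p env (EHd e) (dhd a) (t + dsize (dhd a))
| eval_tl env e a t :
    eval p env e a t -> eval p env (ETl e) (dtl a) (t + dsize (dtl a))
| eval_if_true env e1 e2 e3 b c a t1 t2 :
    eval p env e1 (Node b c) t1 -> eval p env e2 a t2 ->
    eval p env (EIf e1 e2 e3) a (t1 + t2 + dsize a)
| eval_if_false env e1 e2 e3 a t1 t3 :
    eval p env e1 Nil t1 -> eval p env e3 a t3 ->
    eval p env (EIf e1 e2 e3) a (t1 + t3 + dsize a)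
| eval_let env e1 e2 b a t1 t2 :
    eval p env e1 b t1 -> eval p (b :: env) e2 a t2 ->
    eval p env (ELet e1 e2) a (t1 + t2 + dsize a)
| eval_call env n e b a t1 t2 :
    eval p env e b t1 -> eval p [:: b] (nth ENil p n) a t2 ->
    eval p env (ECall n e) a (t1 + t2 + dsize a).

(* On the input a, the program p (whose main function is function 0) outputs b
   in time t. *)
Definition computes (p : program) (a b : data) (t : nat) : Prop :=
  eval p [:: a] (nth ENil p 0) b t.

Definition dnat (n : nat) : data := iter n (Node Nil) Nil.
Definition dlist (s : seq data) : data := foldr Node Nil s.

Definition enc_fin (X : finType) (x : X) : data := dnat (enum_rank x).
Definition enc_set (X : finType) (A : {set X}) : data :=
  dlist [seq enc_fin x | x <- enum A].

Fixpoint enc_form (AP Ag : finType) (f : form AP Ag) : data :=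
  match f with
  | FTrue => Node (dnat 0) Nil
  | FProp p => Node (dnat 1) (enc_fin p)
  | FNeg g => Node (dnat 2) (enc_form g)
  | FOr g h => Node (dnat 3) (Node (enc_form g) (enc_form h))
  | FNext g => Node (dnat 4) (enc_form g)
  | FUntil g h => Node (dnat 5) (Node (enc_form g) (enc_form h))
  | FStrat A g => Node (dnat 6) (Node (enc_set A) (enc_form g))
  end.

Definition enc_prop (AP Ag : finType) (f : form AP Ag) (x : props f) : data :=
  match x with
  | inl p => Node (dnat 0) (enc_fin p)
  | inr b => Node (dnat 1) (enc_form (val b))
  end.

Fixpoint enc_pbf (X : Type) (enc : X -> data) (f : pbf X) : data :=
  match f with
  | PTrue => Node (dnat 0) Nil
  | PFalse => Node (dnat 1) Nil
  | PAtom x => Node (dnat 2) (enc x)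
  | PAnd g h => Node (dnat 3) (Node (enc_pbf enc g) (enc_pbf enc h))
  | POr g h => Node (dnat 4) (Node (enc_pbf enc g) (enc_pbf enc h))
  end.

Definition enc_move (Ag Q : finType) (name : Q -> data) (m : move Ag Q) : data :=
  let: (q, k, B) := m in
  Node (name q) (Node (dnat (if k is Box then 0 else 1)) (enc_set B)).

(* The tree a is an explicit description of the automaton A: its initial state,
   the list of its states with their colors, and its full transition table.
   The names of the states and the order in which the states, the input letters
   and the elements of each letter are listed are free. *)
Definition describes (AP Ag : finType) (Phi : form AP Ag)
    (a : data) (A : acg (props Phi) Ag) : Prop :=
  exists (name : A -> data) (states : seq A) (letters : seq {set props Phi})
         (order : {set props Phi} -> seq (props Phi)),
  [/\ injective name,
      perm_eq states (enum A),
      perm_eq letters (enum {set props Phi}),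
      forall sigma, perm_eq (order sigma) (enum sigma) &
      a = Node (name (q0 A)) (Node
            (dlist [seq Node (name q) (dnat (color q)) | q <- states])
            (dlist [seq Node (name q) (Node
                          (dlist [seq enc_prop x | x <- order sigma])
                          (enc_pbf (enc_move name) (delta q sigma)))
                   | q <- states, sigma <- letters]))].

(* Main.v *)
From HB Require Import structures.
Require Import Defs.
From mathcomp Require Import all_boot.
From mathcomp Require Import zify boolp.
Import Defs.
Set Implicit Arguments.
Unset Strict Implicit.
Unset Printing Implicit Defensive.

(** The truth assignments to the subformulas of [Phi], linked by the local
    expansion laws, form a generalized Büchi automaton for every LTL formula
    [psi] below [Phi], and its transitions are backward deterministic: the
    letter and the next assignment determine the current one.  Hence the
    histories of the current assignments form a forest with boundedly many
    leaves, and only finitely many infinite branches, one of them being the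
    truth.  The deterministic parity automaton keeps, ordered by age, the
    distinct sets of current descendants of past states, and signals the death
    of a node and the moments when all the descendants of a node have fulfilled
    every eventuality since its last signal; the truth starts in [psi] iff
    some node signals infinitely often and never dies.  The sets are laminar,
    so that their number is quadratic in the number of assignments.

    The game automaton visits all the nodes of the tree and starts, for each
    basic formula in (resp. not in) the label, the deterministic automaton of
    its body (resp. of the negation) along box moves (resp. diamond moves):
    since it is deterministic, a run amounts to a strategy (resp. a counter
    strategy).

    For the complexity, the states are listed by taking twice the powerset of
    a list (and then all short sequences over a list); everything else is a
    polynomial time function of these lists, and polynomial time programs are
    closed under composition and under folds with small accumulators. *)


(** * Programs *)

(** Correctness and complexity concern the same objects. An assignment is a subsequence of the list
    [cl] of encoded subformulas, so that sets have unique representatives, and [lstep], [lful] and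
    [next] act on such lists: the transition function that is verified is the one that the program
    tabulates, up to a repackaging of the states as a finite type. The program must list the states
    before it computes transitions; it enumerates all short sequences of nodes, reachable or not,
    and a default value completes the table.

    The bounds come from counting. With n the size of [Phi], there are at most 2^n assignments. A
    node consists of a set of assignments and a set of pending pairs, which makes 2^(2^O(n)) nodes.
    Laminarity limits a state to 2^(2n) nodes, so that the number of states is still 2^(2^O(n)),
    while the colors, which name positions, number 2^O(n). Recording the pending pairs in the nodes
    treats all the eventualities at once.

    The constant 16 of the size and of the index does not depend on [AP] and [Ag]; the exponent of
    the time does, since the encodings of propositions and coalitions and the number of letters
    depend on them. *)

Fixpoint reloc (d s : nat) (e : expr) : expr :=
  match e with
  | EVar i => EVar i
  | ENil => ENil
  | ENode e1 e2 => ENode (reloc d s e1) (reloc d s e2)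
  | EHd e => EHd (reloc d s e)
  | ETl e => ETl (reloc d s e)
  | EIf e1 e2 e3 => EIf (reloc d s e1) (reloc d s e2) (reloc d s e3)
  | ELet e1 e2 => ELet (reloc d s e1) (reloc d s e2)
  (* A call beyond the end of the program runs the default body [ENil]. After relocation another
     function may stand there, so the call becomes a [let] with the same value and the same cost. *)
  | ECall n e => if n < s then ECall (d + n) (reloc d s e)
                 else ELet (reloc d s e) ENil
  end.

Definition reloc_program d (p : program) : program := map (reloc d (size p)) p.

Definition embedded (p' : program) d (p : program) : Prop :=
  forall i, i < size p -> nth ENil p' (d + i) = reloc d (size p) (nth ENil p i).

Lemma eval_reloc p' d p env e a t :
  embedded p' d p -> eval p env e a t -> eval p' env (reloc d (size p) e) a t.
Proof.
move=> emb; elim=> /=; try by move=> *; econstructor; eauto.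
move=> env' n e' b a' t1 t2 _ IH1 ev2 IH2; case: ltnP => n_p.
  by econstructor; [exact: IH1 | rewrite emb].
econstructor; first exact: IH1.
move: ev2; rewrite nth_default // => ev2; inversion ev2; subst.
exact: eval_nil.
Qed.

Lemma embedded_cat (p1 p p2 : program) :
  embedded (p1 ++ reloc_program (size p1) p ++ p2) (size p1) p.
Proof.
move=> i i_p; rewrite nth_cat ltnNge leq_addr /= addKn nth_cat size_map i_p.
by rewrite (nth_map ENil).
Qed.

Lemma eval_embedded p' d p env e a b t1 t2 :
  embedded p' d p -> 0 < size p -> eval p' env e a t1 -> computes p a b t2 ->
  eval p' env (ECall d e) b (t1 + t2 + dsize b).
Proof.
move=> emb p_gt0 ev1 ev2; econstructor; first exact: ev1.
by rewrite -[d]addn0 emb //; exact: eval_reloc.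
Qed.

Lemma dsize_gt0 a : 0 < dsize a.
Proof. by case: a. Qed.

Lemma eval_dsize p env e a t : eval p env e a t -> dsize a <= t.
Proof. by case=> *; rewrite ?leq_addl. Qed.

Lemma dhd_dsize a : dsize (dhd a) <= dsize a.
Proof. by case: a => //= a b; rewrite ltnW // ltnS leq_addr. Qed.

Lemma dtl_dsize a : dsize (dtl a) <= dsize a.
Proof. by case: a => //= a b; rewrite ltnW // ltnS leq_addl. Qed.

Lemma eval_hdN p env e a b t :
  eval p env e (Node a b) t -> eval p env (EHd e) a (t + dsize a).
Proof. exact: eval_hd. Qed.

Lemma eval_tlN p env e a b t :
  eval p env e (Node a b) t -> eval p env (ETl e) b (t + dsize b).
Proof. exact: eval_tl. Qed.

Lemma eval_varE p env i a : nth Nil env i = a -> eval p env (EVar i) a (dsize a).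
Proof. by move=> <-; constructor. Qed.

(** * Encodings *)

Class code (X : Type) := enc : X -> data.
Arguments enc : simpl never.
(** Injectivity is kept apart from the encoding: it serves for equality tests, for what is built on
    them, and for the names of the states. *)
Class codeI (X : Type) (cX : code X) := enc_inj : injective enc.
Arguments codeI X {cX}.

Instance code_data : code data := id.
Instance code_bool : code bool := fun b => dnat b.
Instance code_nat : code nat := dnat.
Instance code_prod X Y {cX : code X} {cY : code Y} : code (X * Y) :=
  fun x => Node (enc x.1) (enc x.2).
Instance code_seq X {cX : code X} : code (seq X) := fun s => dlist (map enc s).

Lemma dnat_inj : injective dnat.
Proof. by elim=> [|m IH] [|n] //= [/IH->]. Qed.

Lemma dlist_inj : injective dlist.
Proof. by elim=> [|x s IH] [|y s'] //= [-> /IH->]. Qed.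

Instance codeI_data : codeI data. Proof. by move=> a b. Qed.
Instance codeI_bool : codeI bool. Proof. by move=> [] []. Qed.
Instance codeI_nat : codeI nat. Proof. exact: dnat_inj. Qed.
Instance codeI_prod X Y {cX : code X} {cY : code Y} {iX : codeI X} {iY : codeI Y} :
  codeI (X * Y).
Proof.
by move=> [x y] [x' y'] [e1 e2]; rewrite (@enc_inj X cX iX _ _ e1) (@enc_inj Y cY iY _ _ e2).
Qed.
Instance codeI_seq X {cX : code X} {iX : codeI X} : codeI (seq X).
Proof. by move=> s s' /dlist_inj; exact: (inj_map (@enc_inj X cX iX)). Qed.

Lemma enc_pair X Y {cX : code X} {cY : code Y} (x : X) (y : Y) :
  enc (x, y) = Node (enc x) (enc y).
Proof. by []. Qed.

Lemma enc_cons X {cX : code X} (x : X) (s : seq X) :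
  enc (x :: s) = Node (enc x) (enc s).
Proof. by []. Qed.

Lemma enc_nil X {cX : code X} : enc (@nil X) = Nil.
Proof. by []. Qed.

Lemma enc_bool (b : bool) : enc b = if b then Node Nil Nil else Nil.
Proof. by case: b. Qed.

Lemma enc_nat (n : nat) : enc n = dnat n.
Proof. by []. Qed.

Lemma enc_data (a : data) : enc a = a.
Proof. by []. Qed.

Lemma enc_seq X {cX : code X} (s : seq X) : enc s = dlist (map enc s).
Proof. by []. Qed.

(* Otherwise unification would confuse encodings of different types. *)
Global Opaque enc.

Notation esize x := (dsize (enc x)).

Lemma esize_prod X Y {cX : code X} {cY : code Y} (x : X) (y : Y) :
  esize (x, y) = (esize x + esize y).+1.
Proof. by rewrite enc_pair. Qed.

Lemma esize_cons X {cX : code X} (x : X) (s : seq X) :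
  esize (x :: s) = (esize x + esize s).+1.
Proof. by rewrite enc_cons. Qed.

Lemma esize_nil X {cX : code X} : esize (@nil X) = 1.
Proof. by rewrite enc_nil. Qed.

Lemma esize_cat X {cX : code X} (s1 s2 : seq X) :
  (esize (s1 ++ s2)).+1 = esize s1 + esize s2.
Proof. by elim: s1 => [|x s IH] //; rewrite cat_cons !esize_cons -addnS IH; lia. Qed.

Lemma esize_gt0 X {cX : code X} (x : X) : 0 < esize x.
Proof. exact: dsize_gt0. Qed.

Lemma size_esize X {cX : code X} (s : seq X) : size s < esize s.
Proof. by elim: s => // x s IH; rewrite esize_cons /=; pose proof (esize_gt0 x); lia. Qed.

Lemma esize_mem X {cX : code X} (x : X) (s1 s2 : seq X) :
  esize x <= esize (s1 ++ x :: s2).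
Proof.
pose proof (esize_cat s1 (x :: s2)) as h; pose proof (esize_gt0 s1) as h'.
by rewrite esize_cons in h; lia.
Qed.

(** Membership is expressed by a splitting of the list, as [X] need not have decidable equality. *)
Lemma esize_seq_le X {cX : code X} (s : seq X) n B :
  size s <= n -> (forall x s1 s2, s = s1 ++ x :: s2 -> esize x <= B) ->
  esize s <= n * B.+1 + 1.
Proof.
elim: s n => [|x s IH] n sn h; first by rewrite esize_nil addn1.
case: n sn => // n sn.
rewrite esize_cons mulSn.
have := IH n sn (fun y s1 s2 e => h y (x :: s1) s2 (congr1 (cons x) e)).
by have := h x [::] s erefl; lia.
Qed.

(** * Polynomially bounded functions *)

Section PolyBounds.
Context (X : Type) (b : X -> nat).
Hypothesis b_ge2 : forall x, 1 < b x.

(** Powers without coefficients are enough because [b] is at least 2: constants and sums are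
    absorbed by the exponent. *)
Definition pb (f : X -> nat) := exists k, forall x, f x <= b x ^ k.

Lemma pb_le f g : (forall x, f x <= g x) -> pb g -> pb f.
Proof. by move=> fg [k h]; exists k => x; apply: leq_trans (h x). Qed.

Lemma pb_const c : pb (fun _ => c).
Proof.
exists c => x; apply: leq_trans (ltnW (ltn_expl c (ltnSn 1))) _.
by case: c => // c; rewrite leq_exp2r.
Qed.

Lemma pb_id : pb b.
Proof. by exists 1 => x; rewrite expn1. Qed.

Lemma pb_mul f g : pb f -> pb g -> pb (fun x => f x * g x).
Proof.
by move=> [k hk] [l hl]; exists (k + l) => x; rewrite expnD leq_mul.
Qed.

Lemma pb_add f g : pb f -> pb g -> pb (fun x => f x + g x).
Proof.
move=> [k hk] [l hl]; exists (k + l).+1 => x.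
have b0 : 0 < b x by have := b_ge2 x; lia.
have h1 : f x <= b x ^ (k + l).
  by apply: leq_trans (hk x) _; rewrite leq_pexp2l // leq_addr.
have h2 : g x <= b x ^ (k + l).
  by apply: leq_trans (hl x) _; rewrite leq_pexp2l // leq_addl.
rewrite expnS; apply: leq_trans (leq_mul (b_ge2 x) (leqnn _)); lia.
Qed.

Lemma pb_succ f : pb f -> pb (fun x => (f x).+1).
Proof.
move=> hf; apply: (@pb_le _ (fun x => f x + 1)) => [x|]; first by rewrite addn1.
exact: pb_add hf (pb_const 1).
Qed.

Lemma pb_exp f k : pb f -> pb (fun x => f x ^ k).
Proof.
move=> [l hl]; exists (l * k) => x; rewrite expnM.
by case: k => // k; rewrite leq_exp2r.
Qed.

End PolyBounds.

Lemma pb_comp X Y (b : X -> nat) (b' : Y -> nat) (f : X -> Y) (T : Y -> nat) :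
  (forall x, 1 < b x) -> pb b' T -> pb b (fun x => b' (f x)) ->
  pb b (fun x => T (f x)).
Proof.
move=> b2 [k hk] hb; apply: (@pb_le _ _ _ (fun x => b' (f x) ^ k)) => //.
exact: pb_exp.
Qed.

(** * Computability within a polynomial of a given bound *)

Definition sz X {cX : code X} (x : X) := (esize x).+1.

Lemma sz_ge2 X {cX : code X} (x : X) : 1 < sz x.
Proof. by rewrite /sz ltnS esize_gt0. Qed.
#[export] Hint Resolve sz_ge2 : core.

(** The time is polynomial in [b x] rather than in the size of [x]. With a doubly exponential [b],
    the closure lemmas also apply to functions that enumerate the states; with [sz] for [b], this is
    polynomial time. *)
Definition ctime X Y {cX : code X} {cY : code Y} (b : X -> nat) (f : X -> Y) :=
  exists p : program, 0 < size p /\ exists T : X -> nat, pb b T /\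
    forall x, exists2 t, computes p (enc x) (enc (f x)) t & t <= T x.


Notation ptime f := (ctime (@sz _ _) f).

Section CTime.
Context (X : Type) {cX : code X} (b : X -> nat).
Hypothesis b_ge : forall x, sz x <= b x.

Let b_ge2 x : 1 < b x := leq_trans (sz_ge2 x) (b_ge x).

Lemma ctime_size Y {cY : code Y} (f : X -> Y) :
  ctime b f -> pb b (fun x => esize (f x)).
Proof.
move=> [p [_ [T [hT h]]]]; apply: pb_le hT => x.
by have [t /eval_dsize ev le_t] := h x; apply: leq_trans ev le_t.
Qed.

Lemma pb_esize : pb b (fun x => esize x).
Proof. by apply: pb_le (pb_id b) => x; exact: ltnW (b_ge x). Qed.

Lemma pb_of_sz T : pb (@sz _ _) T -> pb b T.
Proof.
move=> [k hk]; exists k => x; apply: leq_trans (hk x) _.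
by case: k {hk} => // k; rewrite leq_exp2r.
Qed.

Lemma ctime_of_ptime Y {cY : code Y} (f : X -> Y) : ptime f -> ctime b f.
Proof.
by move=> [p [p0 [T [hT h]]]]; exists p; split=> //; exists T; split=> //; exact: pb_of_sz.
Qed.

(** The bound [b'] of [g] may exceed the size of the argument, provided that it stays polynomial in
    [b] on the values of [f]. Folds and exponential enumerations are composed in this way. *)
Lemma ctime_comp_gen Y Z {cY : code Y} {cZ : code Z} (b' : Y -> nat)
    (f : X -> Y) (g : Y -> Z) :
  ctime b' g -> ctime b f -> pb b (fun x => b' (f x)) -> ctime b (fun x => g (f x)).
Proof.
move=> [q [q0 [U [hU hg]]]] hf hb'; have hs := ctime_size hf.
case: hf => p [p0 [T [hT hf]]].
(* The main function is at index 0; it is followed by [p], moved to index 1, and by [q], moved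
   behind [p]. *)
pose bs := [:: ECall (1 + size p) (ECall 1 (EVar 0))].
pose p' := bs ++ reloc_program 1 p ++ reloc_program (1 + size p) q.
have emb1 : embedded p' 1 p by exact: (embedded_cat bs).
have emb2 : embedded p' (1 + size p) q.
  have := @embedded_cat (bs ++ reloc_program 1 p) q [::].
  by rewrite cats0 size_cat size_map -catA.
exists p'; split=> //.
exists (fun x => (esize x + T x + esize (f x)) + U (f x) + U (f x)); split.
  apply: (pb_add b_ge2); last first.
    exact: (pb_comp b_ge2 hU).
  apply: (pb_add b_ge2); last exact: (pb_comp b_ge2 hU).
  by do 2?apply: (pb_add b_ge2) => //; exact: pb_esize.
move=> x; have [t1 ev1 le1] := hf x; have [t2 ev2 le2] := hg (f x).
have := eval_embedded emb1 p0 (eval_var p' [:: enc x] 0) ev1.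
move=> /= /(eval_embedded emb2 q0) /(_ ev2) ev.
by eexists; [exact: ev|]; have := eval_dsize ev2; lia.
Qed.

Lemma ctime_comp Y Z {cY : code Y} {cZ : code Z} (f : X -> Y) (g : Y -> Z) :
  ptime g -> ctime b f -> ctime b (fun x => g (f x)).
Proof.
move=> hg hf; apply: (ctime_comp_gen hg hf).
exact: (pb_succ b_ge2 (ctime_size hf)).
Qed.

Lemma ctime_pair Y Z {cY : code Y} {cZ : code Z} (f : X -> Y) (g : X -> Z) :
  ctime b f -> ctime b g -> ctime b (fun x => (f x, g x)).
Proof.
move=> [p [p0 [T [hT hf]]]] [q [q0 [U [hU hg]]]].
pose bs := [:: ENode (ECall 1 (EVar 0)) (ECall (1 + size p) (EVar 0))].
pose p' := bs ++ reloc_program 1 p ++ reloc_program (1 + size p) q.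
have emb1 : embedded p' 1 p by exact: (embedded_cat bs).
have emb2 : embedded p' (1 + size p) q.
  have := @embedded_cat (bs ++ reloc_program 1 p) q [::].
  by rewrite cats0 size_cat size_map -catA.
exists p'; split=> //.
exists (fun x => (esize x + T x + T x) + (esize x + U x + U x) + (T x + U x).+1); split.
  by repeat first [assumption | exact: pb_esize | apply: (pb_succ b_ge2) | apply: (pb_add b_ge2)].
move=> x; have [t1 ev1 le1] := hf x; have [t2 ev2 le2] := hg x.
have ev3 := eval_embedded emb1 p0 (eval_var p' [:: enc x] 0) ev1.
have ev4 := eval_embedded emb2 q0 (eval_var p' [:: enc x] 0) ev2.
by eexists; [exact: (eval_node ev3 ev4)|]; have := eval_dsize ev1; have := eval_dsize ev2 => /=; lia.
Qed.

Lemma ctime_ext Y {cY : code Y} (f g : X -> Y) : f =1 g -> ctime b g -> ctime b f.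
Proof.
move=> fg [p [p0 [T [hT h]]]]; exists p; split=> //; exists T; split=> // x.
by rewrite fg.
Qed.

(** A program only sees encodings, so values of different types with the same encoding can be
    exchanged. *)
Lemma ctime_recode Y Z {cY : code Y} {cZ : code Z} (f : X -> Y) (g : X -> Z) :
  (forall x, enc (f x) = enc (g x)) -> ctime b g -> ctime b f.
Proof.
move=> fg [p [p0 [T [hT h]]]]; exists p; split=> //; exists T; split=> // x.
by rewrite fg.
Qed.

End CTime.

Lemma ptime_id X {cX : code X} : ptime (fun x : X => x).
Proof.
exists [:: EVar 0]; split=> //; exists (fun x => esize x); split; first exact: (pb_esize (fun x => leqnn _)).
by move=> x; eexists; first exact: (eval_var _ [:: enc x] 0).
Qed.

Fixpoint const_expr (a : data) : expr :=
  if a is Node b c then ENode (const_expr b) (const_expr c) else ENil.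

Lemma eval_const_uniform a : exists t, forall p env, eval p env (const_expr a) a t.
Proof.
elim: a => [|a [t1 h1] c [t2 h2]] /=; first by eexists=> p env; constructor.
by exists (t1 + t2 + dsize (Node a c)) => p env; constructor.
Qed.

Lemma ptime_const X Y {cX : code X} {cY : code Y} (y : Y) : ptime (fun _ : X => y).
Proof.
have [t ht] := eval_const_uniform (enc y).
exists [:: const_expr (enc y)]; split=> //; exists (fun=> t); split; first exact: pb_const.
by move=> x; exists t => //; exact: ht.
Qed.

(** * Primitive operations on pairs and booleans *)

Section PTimePrimitives.

Lemma ptime_prim X Y {cX : code X} {cY : code Y} (e : expr) (f : X -> Y) (c : nat) :
  (forall x, exists2 t, eval [:: e] [:: enc x] e (enc (f x)) t & t <= c * (esize x).+1) ->
  ptime f.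
Proof.
move=> h; exists [:: e]; split=> //; exists (fun x => c * sz x); split=> //.
apply: pb_mul => //; [exact: pb_const | exact: pb_id].
Qed.

Context {X Y Z : Type} {cX : code X} {cY : code Y} {cZ : code Z}.

Lemma ptime_fst0 : ptime (fun x : X * Y => x.1).
Proof.
apply: (@ptime_prim _ _ _ _ (EHd (EVar 0)) _ 2) => -[x y].
eexists; first by apply: eval_hdN; apply: eval_varE; exact: enc_pair.
by rewrite esize_prod /=; lia.
Qed.

Lemma ptime_snd0 : ptime (fun x : X * Y => x.2).
Proof.
apply: (@ptime_prim _ _ _ _ (ETl (EVar 0)) _ 2) => -[x y].
eexists; first by apply: eval_tlN; apply: eval_varE; exact: enc_pair.
by rewrite esize_prod /=; lia.
Qed.

Lemma ptime_select : ptime (fun x : bool * (X * X) => if x.1 then x.2.1 else x.2.2).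
Proof.
apply: (@ptime_prim _ _ _ _ (EIf (EHd (EVar 0)) (EHd (ETl (EVar 0))) (ETl (ETl (EVar 0)))) _ 10) => -[[] [x y]]; rewrite !enc_pair enc_bool /=.
  eexists; first by apply: eval_if_true; [apply: eval_hdN; exact: eval_varE|apply: eval_hdN; apply: eval_tlN; exact: eval_varE].
  by rewrite /=; lia.
eexists; first by apply: eval_if_false; [apply: eval_hdN; exact: eval_varE|apply: eval_tlN; apply: eval_tlN; exact: eval_varE].
by rewrite /=; lia.
Qed.

End PTimePrimitives.

Section Closure.
Context (X : Type) {cX : code X} (b : X -> nat).
Hypothesis b_ge : forall x, sz x <= b x.
Context (Y Z : Type) {cY : code Y} {cZ : code Z}.

Lemma ctime_fst (f : X -> Y * Z) : ctime b f -> ctime b (fun x => (f x).1).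
Proof. by move=> hf; apply: (ctime_comp b_ge ptime_fst0 hf). Qed.

Lemma ctime_snd (f : X -> Y * Z) : ctime b f -> ctime b (fun x => (f x).2).
Proof. by move=> hf; apply: (ctime_comp b_ge ptime_snd0 hf). Qed.

(** Both branches are computed before one of them is selected; their times add up. *)
Lemma ctime_if (c : X -> bool) (f g : X -> Y) :
  ctime b c -> ctime b f -> ctime b g -> ctime b (fun x => if c x then f x else g x).
Proof.
move=> hc hf hg.
exact: (ctime_comp b_ge ptime_select (ctime_pair b_ge hc (ctime_pair b_ge hf hg))).
Qed.

Lemma ctime_cons (f : X -> Y) (g : X -> seq Y) :
  ctime b f -> ctime b g -> ctime b (fun x => f x :: g x).
Proof.
by move=> hf hg; apply: (ctime_recode (g := fun x => (f x, g x))); [move=> x; rewrite enc_pair enc_cons | exact: ctime_pair].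
Qed.

End Closure.

(** * Recursion *)

Section Fold.
Context (A B X : Type) {cA : code A} {cB : code B} {cX : code X}.
Variable g : A * (B * X) -> B.

Definition foldb (x : X) (z : B) (s : seq A) := foldr (fun a acc => g (a, (acc, x))) z s.

(* The argument of the recursive function is (s, (z, x)). *)
Definition fold_expr : expr :=
  EIf (EHd (EVar 0))
    (ECall 1 (ENode (EHd (EHd (EVar 0)))
      (ENode (ECall 0 (ENode (ETl (EHd (EVar 0))) (ETl (EVar 0))))
             (ETl (ETl (EVar 0))))))
    (EHd (ETl (EVar 0))).

(** A fold of a polynomial time function need not be polynomial, for the accumulator may grow. The
    bound on a fold therefore contains the sizes of all the intermediate accumulators. *)
Fixpoint acc_size (x : X) (z : B) (s : seq A) : nat :=
  esize (foldb x z s) + (if s is _ :: s' then acc_size x z s' else 0).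

Definition fold_bound (y : seq A * (B * X)) : nat := sz y + acc_size y.2.2 y.2.1 y.1.

Lemma fold_bound_ge y : sz y <= fold_bound y.
Proof. exact: leq_addr. Qed.

(** Since [M] bounds the input and all the accumulators, a round costs at most [(3 * M + 3) ^ k] for
    [g], whose argument has three parts of size at most [M], and [20 * M] for taking the arguments
    apart and assembling them. *)
Lemma fold_eval (p : program) k M x z s :
  0 < size p -> (forall y, exists2 t, computes p (enc y) (enc (g y)) t & t <= sz y ^ k) ->
  (esize s + esize z + esize x).+2 <= M -> acc_size x z s <= M ->
  exists2 t, eval (fold_expr :: reloc_program 1 p)
               [:: Node (enc s) (Node (enc z) (enc x))] fold_expr
               (enc (foldb x z s)) t &
             t <= (size s).+1 * (20 * M + (3 * M + 3) ^ k).
Proof.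
move=> p0 hp; set p' := _ :: _.
have emb : embedded p' 1 p by have := @embedded_cat [:: fold_expr] p [::]; rewrite cats0.
have le_exp m n : m <= n -> m ^ k <= n ^ k by case: (k) => // k' h; rewrite leq_exp2r.
elim: s => [|a s IH] szM accM.
  rewrite enc_nil in szM *; eexists.
    apply: eval_if_false; first by apply: eval_hdN; exact: eval_varE.
    by apply: eval_hdN; apply: eval_tlN; exact: eval_varE.
  apply: (@leq_trans (20 * M)); last by rewrite mul1n leq_addr.
  by move: szM => /=; lia.
move: accM; rewrite [acc_size _ _ _]/= => accM.
rewrite enc_cons in szM *.
have [||t1 ev1 le1] := IH; [by move: szM => /=; lia | by lia |].
have [t2 ev2 le2] := hp (a, (foldb x z s, x)); rewrite /computes !enc_pair in ev2.
have acc1 : esize (foldb x z s) <= M by case: (s) accM => [|? ?] /=; lia.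
have {}le2 : t2 <= (3 * M + 3) ^ k.
  apply: leq_trans le2 _; apply: le_exp; rewrite /sz !esize_prod.
  by move: szM => /=; lia.
eexists.
  apply: eval_if_true; first by apply: eval_hdN; exact: eval_varE.
  apply: (eval_embedded emb p0 _ ev2).
  apply: eval_node; first by apply: eval_hdN; apply: eval_hdN; exact: eval_varE.
  apply: eval_node.
    apply: (@eval_call p' _ 0); last exact: ev1.
    apply: eval_node.
      by apply: eval_tlN; apply: eval_hdN; exact: eval_varE.
    by apply: eval_tlN; exact: eval_varE.
  by apply: eval_tlN; apply: eval_tlN; exact: eval_varE.
rewrite [size (_ :: _)]/= [_.+2 * _]mulSn.
set W := _.+1 * _ in le1 *; set W2 := _ ^ k in le2 *.
have e1 : foldb x z (a :: s) = g (a, (foldb x z s, x)) by [].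
rewrite e1; move: szM => /=; lia.
Qed.

Lemma fold_ctime : ptime g -> ctime fold_bound (fun y => foldb y.2.2 y.2.1 y.1).
Proof.
move=> [p [p0 [T [[k hk] hT]]]].
exists (fold_expr :: reloc_program 1 p); split=> //.
exists (fun y => fold_bound y * (20 * (2 * fold_bound y) + (3 * (2 * fold_bound y) + 3) ^ k)); split.
  have ge2 y : 1 < fold_bound y by exact: leq_trans (fold_bound_ge y).
  by repeat first [exact: pb_id | exact: pb_const | apply: pb_mul | apply: (pb_exp _) | apply: (pb_add ge2)].
move=> [s [z x]]; rewrite /computes !enc_pair /=.
have [|||t ev le_t] := @fold_eval p k (2 * fold_bound (s, (z, x))) x z s p0.
- move=> y; have [t ev le_t] := hT y; exists t => //; exact: leq_trans (hk y).
- by rewrite /fold_bound /sz !esize_prod /=; lia.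
- by rewrite /fold_bound /=; lia.
exists t => //; apply: leq_trans le_t _; apply: leq_mul => //.
rewrite /fold_bound /sz !esize_prod /=; pose proof (size_esize s); lia.
Qed.
End Fold.

Lemma esize_suffix A {cA : code A} (s1 s2 : seq A) : esize s2 <= esize (s1 ++ s2).
Proof. by pose proof (esize_cat s1 s2); pose proof (esize_gt0 s1); lia. Qed.

Section Fold2.
Context (X : Type) {cX : code X} (b : X -> nat).
Hypothesis b_ge : forall x, sz x <= b x.
Let b_ge2 x : 1 < b x := leq_trans (sz_ge2 x) (b_ge x).

Lemma ctime_id : ctime b (fun x => x).
Proof. by apply: (ctime_of_ptime b_ge); apply: ptime_id. Qed.

Lemma ctime_const Y {cY : code Y} (y : Y) : ctime b (fun _ => y).
Proof. by apply: (ctime_of_ptime b_ge); apply: ptime_const. Qed.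

Context (A : Type) {cA : code A}.

Lemma acc_size_le B {cB : code B} (g : A * (B * X) -> B) x z s M :
  (forall s1 s2, s = s1 ++ s2 -> esize (foldb g x z s2) <= M) ->
  acc_size g x z s <= (size s).+1 * M.
Proof.
elim: s => [|a s IH] h; first by rewrite /= addn0 mul1n (h [::] [::]).
rewrite [acc_size _ _ _ _]/= mulSn leq_add ?(h [::] (a :: s)) //.
by apply: IH => s1 s2 e; apply: (h (a :: s1)); rewrite e.
Qed.

(** The intermediate accumulators of a right fold are the folds of the suffixes of the list, whence
    the form of the size hypothesis. *)
Lemma ctime_foldr B {cB : code B} (l : X -> seq A) (z : X -> B) (G : A -> B -> X -> B) bnd :
  ctime b l -> ctime b z -> ptime (fun y : A * (B * X) => G y.1 y.2.1 y.2.2) ->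
  (forall x s1 s2, l x = s1 ++ s2 ->
     esize (foldr (fun a acc => G a acc x) (z x) s2) <= bnd x) ->
  pb b bnd -> ctime b (fun x => foldr (fun a acc => G a acc x) (z x) (l x)).
Proof.
move=> hl hz hG hbnd hb.
have hp := ctime_pair b_ge hl (ctime_pair b_ge hz ctime_id).
apply: (ctime_comp_gen b_ge (fold_ctime hG) hp).
rewrite /fold_bound /=; apply: (pb_add b_ge2); first exact: (pb_succ b_ge2 (ctime_size hp)).
apply: (@pb_le _ _ _ (fun x => (size (l x)).+1 * bnd x)).
  by move=> x; apply: acc_size_le => s1 s2 /hbnd.
apply: pb_mul => //; apply: pb_le (ctime_size hl) => x.
exact: size_esize.
Qed.

Lemma pb_image B {cB : code B} (l : X -> seq A) (G : A -> X -> B) :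
  ctime b l -> ptime (fun y : A * X => G y.1 y.2) ->
  exists2 M, pb b M & forall x a s1 s2, l x = s1 ++ a :: s2 -> esize (G a x) <= M x.
Proof.
move=> hl /ctime_size [k hk].
exists (fun x => (esize (l x) + (esize x).+2) ^ k).
  apply: pb_exp; apply: (pb_add b_ge2); first exact: ctime_size hl.
  by do 2!apply: (pb_succ b_ge2); exact: pb_esize.
move=> x a s1 s2 e; apply: leq_trans (hk (a, x)) _.
case: (k) => // k'; rewrite leq_exp2r // /sz esize_prod.
by pose proof (esize_mem a s1 s2) as h; rewrite -e in h; lia.
Qed.

Lemma ctime_map B {cB : code B} (l : X -> seq A) (G : A -> X -> B) :
  ctime b l -> ptime (fun y : A * X => G y.1 y.2) ->
  ctime b (fun x => [seq G a x | a <- l x]).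
Proof.
move=> hl hG; have [M hM h] := pb_image hl hG.
apply: (ctime_ext (g := fun x => foldr (fun a acc => G a x :: acc) [::] (l x))) => //.
apply: (ctime_foldr (G := fun a acc x => G a x :: acc) (z := fun=> [::])
          (bnd := fun x => size (l x) * (M x).+1 + 1)) => //.
- exact: ctime_const.
- have ge (Y : Type) (cY : code Y) (y : Y) : sz y <= sz y by [].
  apply: (ctime_cons (ge _ _)); last by apply: ctime_fst => //; apply: ctime_snd => //; exact: ptime_id.
  apply: (ctime_comp (ge _ _) hG (f := fun y => (y.1, y.2.2))).
  apply: ctime_pair => //; first by apply: ctime_fst => //; exact: ptime_id.
  by apply: ctime_snd => //; apply: ctime_snd => //; exact: ptime_id.
- move=> x s1 s2 e; rewrite -/(map (G^~ x) s2); apply: esize_seq_le.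
    by rewrite e size_map size_cat leq_addl.
  move=> y s3 s4 e'; elim: s3 s1 s2 e e' => [|c s3 IH] s1 [|a s2] //= e [].
    by move=> <- _; exact: h e.
  by move=> _ e'; apply: (IH (rcons s1 a) s2) => //; rewrite cat_rcons.
- apply: (pb_add b_ge2); last exact: pb_const.
  apply: pb_mul; last exact: pb_succ.
  by apply: pb_le (ctime_size hl) => x; exact/ltnW/size_esize.
Qed.
End Fold2.

(** * Equality of trees and its computation *)

Fixpoint tree_data (a : data) : GenTree.tree nat :=
  if a is Node b c then GenTree.Node 0 [:: tree_data b; tree_data c]
  else GenTree.Leaf 0.

Fixpoint data_tree (t : GenTree.tree nat) : option data :=
  match t with
  | GenTree.Node _ [:: t1; t2] =>
      if (data_tree t1, data_tree t2) is (Some b, Some c) then Some (Node b c) else None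
  | GenTree.Leaf _ => Some Nil
  | _ => None
  end.

Lemma tree_dataK : pcancel tree_data data_tree.
Proof. by elim=> //= b -> c ->. Qed.

HB.instance Definition _ := Countable.copy data (pcan_type tree_dataK).

Lemma enc_eq (X : eqType) {cX : code X} {iX : codeI X} (x y : X) : (enc x == enc y) = (x == y).
Proof. by apply/eqP/eqP => [/(@enc_inj X cX iX)|->]. Qed.

Definition eq_expr : expr :=
  EIf (EHd (EVar 0))
    (EIf (ETl (EVar 0))
       (EIf (ECall 0 (ENode (EHd (EHd (EVar 0))) (EHd (ETl (EVar 0)))))
          (ECall 0 (ENode (ETl (EHd (EVar 0))) (ETl (ETl (EVar 0))))) ENil)
       ENil)
    (EIf (ETl (EVar 0)) ENil (ENode ENil ENil)).

(** Every node of [a] is compared at most once, at a cost linear in [M]. *)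
Lemma eq_eval a b M : dsize a + dsize b < M ->
  exists2 t, eval [:: eq_expr] [:: Node a b] eq_expr (enc (a == b)) t &
             t <= dsize a * (50 * M).
Proof.
elim: a b M => [|a1 IH1 a2 IH2] [|b1 b2] M; rewrite enc_bool /= => ltM.
- eexists.
    apply: eval_if_false; first by apply: eval_hdN; exact: eval_varE.
    apply: eval_if_false; first by apply: eval_tlN; exact: eval_varE.
    by apply: eval_node; exact: eval_nil.
  by move=> /=; lia.
- eexists.
    apply: eval_if_false; first by apply: eval_hdN; exact: eval_varE.
    apply: eval_if_true; first by apply: eval_tlN; exact: eval_varE.
    by exact: eval_nil.
  by move=> /=; lia.
- eexists.
    apply: eval_if_true; first by apply: eval_hdN; exact: eval_varE.
    apply: eval_if_false; first by apply: eval_tlN; exact: eval_varE.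
    by exact: eval_nil.
  by rewrite /= mulSn; lia.
have [|t1 ev1 le1] := IH1 b1 M; first by lia.
have [|t2 ev2 le2] := IH2 b2 M; first by lia.
have -> : (Node a1 a2 == Node b1 b2) = (a1 == b1) && (a2 == b2).
  by apply/eqP/andP => [[-> ->]|[/eqP-> /eqP->]].
have call1 : exists2 t, eval [:: eq_expr] [:: Node (Node a1 a2) (Node b1 b2)]
     (ECall 0 (ENode (EHd (EHd (EVar 0))) (EHd (ETl (EVar 0))))) (enc (a1 == b1)) t &
     t <= t1 + 8 * M.
  eexists.
    apply: (@eval_call [:: eq_expr] _ 0); last exact: ev1.
    apply: eval_node; first by do 2!apply: eval_hdN; exact: eval_varE.
    by apply: eval_hdN; apply: eval_tlN; exact: eval_varE.
  by rewrite enc_bool; case: eqP => _ /=; lia.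
have call2 : exists2 t, eval [:: eq_expr] [:: Node (Node a1 a2) (Node b1 b2)]
     (ECall 0 (ENode (ETl (EHd (EVar 0))) (ETl (ETl (EVar 0))))) (enc (a2 == b2)) t &
     t <= t2 + 8 * M.
  eexists.
    apply: (@eval_call [:: eq_expr] _ 0); last exact: ev2.
    apply: eval_node; first by apply: eval_tlN; apply: eval_hdN; exact: eval_varE.
    by do 2!apply: eval_tlN; exact: eval_varE.
  by rewrite enc_bool; case: eqP => _ /=; lia.
have [u1 evu1 leu1] := call1; have [u2 evu2 leu2] := call2.
have [u3 evu3 leu3] : exists2 t, eval [:: eq_expr] [:: Node (Node a1 a2) (Node b1 b2)]
    (EIf (ECall 0 (ENode (EHd (EHd (EVar 0))) (EHd (ETl (EVar 0)))))
          (ECall 0 (ENode (ETl (EHd (EVar 0))) (ETl (ETl (EVar 0))))) ENil)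
    (if (a1 == b1) && (a2 == b2) then Node Nil Nil else Nil) t & t <= u1 + u2 + 4.
  rewrite !enc_bool in evu1 evu2; move: evu1 evu2; case: eqP => _ evu1 evu2 /=.
    eexists; first by apply: eval_if_true; [exact: evu1 | exact: evu2].
    by case: eqP => _ /=; lia.
  eexists; first by apply: eval_if_false; [exact: evu1 | exact: eval_nil].
  by move=> /=; lia.
eexists.
  apply: eval_if_true; first by apply: eval_hdN; exact: eval_varE.
  apply: eval_if_true; first by apply: eval_tlN; exact: eval_varE.
  exact: evu3.
rewrite mulSn mulnDl /=.
by case: andP => _ /=; lia.
Qed.

Lemma ptime_eqd : ptime (fun x : data * data => x.1 == x.2).
Proof.
exists [:: eq_expr]; split=> //; exists (fun x => sz x * (50 * sz x)); split.
  by repeat first [exact: pb_id | exact: pb_const | apply: pb_mul].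
move=> [a b]; rewrite /computes enc_pair !enc_data /=.
have [|t ev le_t] := @eq_eval a b (sz (a, b)).
  by rewrite /sz esize_prod !enc_data; lia.
exists t => //; apply: leq_trans le_t _; apply: leq_mul => //.
by rewrite /sz esize_prod !enc_data; lia.
Qed.

Lemma esize_nat (n : nat) : esize n = n.*2.+1.
Proof. by rewrite enc_nat; elim: n => //= n IH; rewrite -/(dnat n) IH. Qed.

Ltac proj := repeat lazymatch goal with
  | |- ctime _ (fun x => x) => exact: ptime_id
  | |- ctime _ fst => exact: ptime_fst0
  | |- ctime _ snd => exact: ptime_snd0
  | |- ctime _ (fun x => (@?h x).1) => refine (ctime_fst (f := h) _ _); [by [] |]
  | |- ctime _ (fun x => (@?h x).2) => refine (ctime_snd (f := h) _ _); [by [] |]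
  | |- ctime _ (fun x => (@?f x, @?g x)) => apply: ctime_pair => //
  | |- ctime _ (fun x => @?f x :: @?g x) => apply: ctime_cons => //
  end.

(** * Operations on booleans, trees, numbers and lists *)

Section Derived.
Context (X : Type) {cX : code X} (b : X -> nat).
Hypothesis b_ge : forall x, sz x <= b x.
Let b_ge2 x : 1 < b x := leq_trans (sz_ge2 x) (b_ge x).

Lemma ctime_enc Y {cY : code Y} (f : X -> Y) : ctime b f -> ctime b (fun x => enc (f x)).
Proof. by move=> hf; apply: (ctime_recode (g := f)). Qed.

Lemma ctime_eq (Y : eqType) {cY : code Y} {iY : codeI Y} (f g : X -> Y) :
  ctime b f -> ctime b g -> ctime b (fun x => f x == g x).
Proof.
move=> hf hg; apply: (ctime_ext (g := fun x => enc (f x) == enc (g x))).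
  by move=> x; rewrite enc_eq.
exact: (ctime_comp b_ge ptime_eqd (ctime_pair b_ge (ctime_enc hf) (ctime_enc hg))).
Qed.

Lemma ctime_neg (f : X -> bool) : ctime b f -> ctime b (fun x => ~~ f x).
Proof.
move=> hf; apply: (ctime_ext (g := fun x => if f x then false else true)).
  by move=> x; case: (f x).
by apply: (ctime_if b_ge hf); apply: ctime_const.
Qed.

Lemma ctime_and (f g : X -> bool) : ctime b f -> ctime b g -> ctime b (fun x => f x && g x).
Proof.
move=> hf hg; apply: (ctime_ext (g := fun x => if f x then g x else false)).
  by move=> x; case: (f x).
by apply: (ctime_if b_ge hf) => //; apply: ctime_const.
Qed.

Lemma ctime_or (f g : X -> bool) : ctime b f -> ctime b g -> ctime b (fun x => f x || g x).
Proof.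
move=> hf hg; apply: (ctime_ext (g := fun x => if f x then true else g x)).
  by move=> x; case: (f x).
by apply: (ctime_if b_ge hf) => //; apply: ctime_const.
Qed.

Lemma ctime_node (f g : X -> data) :
  ctime b f -> ctime b g -> ctime b (fun x => Node (f x) (g x)).
Proof.
move=> hf hg; apply: (ctime_recode (g := fun x => (f x, g x))); last exact: ctime_pair.
by move=> x; rewrite enc_pair !enc_data.
Qed.

Lemma ctime_hd (f : X -> data) : ctime b f -> ctime b (fun x => dhd (f x)).
Proof.
move=> hf; apply: (ctime_comp b_ge _ hf).
apply: (@ptime_prim _ _ _ _ (EHd (EVar 0)) _ 2) => x.
eexists; first by apply: eval_hd; apply: eval_varE.
by rewrite enc_data; have := dhd_dsize x; move=> /=; lia.
Qed.

Lemma ctime_tl (f : X -> data) : ctime b f -> ctime b (fun x => dtl (f x)).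
Proof.
move=> hf; apply: (ctime_comp b_ge _ hf).
apply: (@ptime_prim _ _ _ _ (ETl (EVar 0)) _ 2) => x.
eexists; first by apply: eval_tl; apply: eval_varE.
by rewrite enc_data; have := dtl_dsize x; move=> /=; lia.
Qed.

Lemma ctime_succ (f : X -> nat) : ctime b f -> ctime b (fun x => (f x).+1).
Proof.
move=> hf; apply: (ctime_recode (g := fun x => Nil :: nseq (f x) Nil)).
  by move=> x; rewrite enc_nat enc_seq /= enc_data; congr Node; elim: (f x) => //= n ->.
apply: ctime_cons => //; first exact: ctime_const.
apply: ctime_recode hf => x.
by rewrite enc_nat enc_seq; elim: (f x) => //= n ->.
Qed.

Context (A : Type) {cA : code A}.

Lemma esize_bool (c : bool) : esize c <= 3.
Proof. by rewrite enc_bool; case: c. Qed.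

Lemma ctime_has (l : X -> seq A) (G : A -> X -> bool) :
  ctime b l -> ptime (fun y : A * X => G y.1 y.2) ->
  ctime b (fun x => has (fun a => G a x) (l x)).
Proof.
move=> hl hG.
apply: (ctime_ext (g := fun x => foldr (fun a acc => G a x || acc) false (l x))) => //.
apply: (@ctime_foldr _ _ _ b_ge _ _ _ _ l (fun=> false) (fun a acc x => G a x || acc) (fun=> 3)) => //.
- exact: ctime_const.
- apply: (ctime_ext (g := fun y : A * (bool * X) => if G y.1 y.2.2 then true else y.2.1)).
    by move=> y; case: (G _ _).
  apply: ctime_if => //.
  + apply: (ctime_comp _ hG (f := fun y => (y.1, y.2.2))) => //.
    apply: ctime_pair => //; first by apply: ctime_fst => //; exact: ptime_id.
    by apply: ctime_snd => //; apply: ctime_snd => //; exact: ptime_id.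
  + exact: ptime_const.
  + by apply: ctime_fst => //; apply: ctime_snd => //; exact: ptime_id.
- by move=> *; exact: esize_bool.
- exact: pb_const.
Qed.

Lemma ctime_all (l : X -> seq A) (G : A -> X -> bool) :
  ctime b l -> ptime (fun y : A * X => G y.1 y.2) ->
  ctime b (fun x => all (fun a => G a x) (l x)).
Proof.
move=> hl hG.
apply: (ctime_ext (g := fun x => if has (fun a => if G a x then false else true) (l x) then false else true)).
  move=> x; rewrite -[all _ _]negbK -has_predC.
  rewrite (eq_has (a2 := fun a => if G a x then false else true)) //.
apply: ctime_if => //; try exact: ctime_const.
apply: ctime_has => //; apply: ctime_if => //; exact: ptime_const.
Qed.

Lemma esize_filter (p : pred A) (s : seq A) : esize (filter p s) <= esize s.
Proof. by elim: s => // a s IH /=; case: (p a); rewrite !esize_cons; lia. Qed.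

Lemma ctime_filter (l : X -> seq A) (G : A -> X -> bool) :
  ctime b l -> ptime (fun y : A * X => G y.1 y.2) ->
  ctime b (fun x => [seq a <- l x | G a x]).
Proof.
move=> hl hG.
apply: (ctime_ext (g := fun x => foldr (fun a acc => if G a x then a :: acc else acc) [::] (l x))) => //.
apply: (@ctime_foldr _ _ _ b_ge _ _ _ _ l (fun=> [::]) (fun a acc x => if G a x then a :: acc else acc) (fun x => esize (l x))) => //.
- exact: ctime_const.
- have h : ptime (fun y : A * (seq A * X) => y.2.1).
    by apply: ctime_fst => //; apply: ctime_snd => //; exact: ptime_id.
  apply: ctime_if => //.
    apply: (ctime_comp _ hG (f := fun y => (y.1, y.2.2))) => //.
    apply: ctime_pair => //; first by apply: ctime_fst => //; exact: ptime_id.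
    by apply: ctime_snd => //; apply: ctime_snd => //; exact: ptime_id.
  by apply: ctime_cons => //; apply: ctime_fst => //; exact: ptime_id.
- move=> x s1 s2 ->; apply: leq_trans (esize_suffix _ _).
  exact: (esize_filter (G^~ x)).
- exact: (ctime_size hl).
Qed.

Lemma ctime_cat (l1 l2 : X -> seq A) : ctime b l1 -> ctime b l2 -> ctime b (fun x => l1 x ++ l2 x).
Proof.
move=> h1 h2.
apply: (ctime_ext (g := fun x => foldr (fun a acc => a :: acc) (l2 x) (l1 x))).
  by move=> x; elim: (l1 x) => //= a s ->.
apply: (@ctime_foldr _ _ _ b_ge _ _ _ _ l1 l2 (fun a acc x => a :: acc) (fun x => esize (l1 x) + esize (l2 x))) => //.
- apply: ctime_cons => //; first by apply: ctime_fst => //; exact: ptime_id.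
  by apply: ctime_fst => //; apply: ctime_snd => //; exact: ptime_id.
- move=> x s1 s2 e; have -> : foldr (fun a acc => a :: acc) (l2 x) s2 = s2 ++ l2 x.
    by elim: (s2) => //= a s ->.
  pose proof (esize_cat s2 (l2 x)); pose proof (esize_suffix s1 s2) as h; rewrite -e in h.
  by lia.
- by apply: (pb_add b_ge2); exact: ctime_size.
Qed.

Lemma ctime_size_nat (l : X -> seq A) : ctime b l -> ctime b (fun x => size (l x)).
Proof.
move=> hl.
apply: (ctime_ext (g := fun x => foldr (fun a acc => acc.+1) 0 (l x))) => //.
apply: (@ctime_foldr _ _ _ b_ge _ _ _ _ l (fun=> 0) (fun a acc x => acc.+1) (fun x => esize (l x) + esize (l x))) => //.
- exact: ctime_const.
- apply: (ctime_recode (g := fun y : A * (nat * X) => (Nil, y.2.1))).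
    by move=> y; rewrite enc_pair enc_nat enc_data.
  apply: ctime_pair => //; first exact: ptime_const.
  by apply: ctime_fst => //; apply: ctime_snd => //; exact: ptime_id.
- move=> x s1 s2 e; rewrite [foldr _ _ _](_ : _ = size s2) //.
  rewrite esize_nat.
  by pose proof (size_esize s2); pose proof (esize_suffix s1 s2) as h; rewrite -e in h; lia.
- by apply: (pb_add b_ge2); exact: ctime_size.
Qed.
End Derived.

Section Apply.
Context (X : Type) {cX : code X} (b : X -> nat).
Hypothesis b_ge : forall x, sz x <= b x.
Context (Y1 Y2 Y3 Y4 Z : Type) {c1 : code Y1} {c2 : code Y2} {c3 : code Y3} {c4 : code Y4} {cZ : code Z}.

Lemma ctime_app1 (F : Y1 -> Z) f1 :
  ptime F -> ctime b f1 -> ctime b (fun x => F (f1 x)).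
Proof. exact: ctime_comp. Qed.

(** The body of a map, filter or fold must be polynomial time in its parameters. Separating [F] from
    its arguments turns into variables what is computable only relative to [b]. *)
Lemma ctime_app2 (F : Y1 -> Y2 -> Z) f1 f2 :
  ptime (fun y : Y1 * Y2 => F y.1 y.2) ->
  ctime b f1 -> ctime b f2 -> ctime b (fun x => F (f1 x) (f2 x)).
Proof. by move=> hF h1 h2; exact: (ctime_comp b_ge hF (ctime_pair b_ge h1 h2)). Qed.

Lemma ctime_app3 (F : Y1 -> Y2 -> Y3 -> Z) f1 f2 f3 :
  ptime (fun y : Y1 * (Y2 * Y3) => F y.1 y.2.1 y.2.2) ->
  ctime b f1 -> ctime b f2 -> ctime b f3 -> ctime b (fun x => F (f1 x) (f2 x) (f3 x)).
Proof.
move=> hF h1 h2 h3.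
exact: (ctime_comp b_ge hF (ctime_pair b_ge h1 (ctime_pair b_ge h2 h3))).
Qed.

Lemma ctime_app4 (F : Y1 -> Y2 -> Y3 -> Y4 -> Z) f1 f2 f3 f4 :
  ptime (fun y : Y1 * (Y2 * (Y3 * Y4)) => F y.1 y.2.1 y.2.2.1 y.2.2.2) ->
  ctime b f1 -> ctime b f2 -> ctime b f3 -> ctime b f4 ->
  ctime b (fun x => F (f1 x) (f2 x) (f3 x) (f4 x)).
Proof.
move=> hF h1 h2 h3 h4.
exact: (ctime_comp b_ge hF (ctime_pair b_ge h1 (ctime_pair b_ge h2 (ctime_pair b_ge h3 h4)))).
Qed.
End Apply.

(** Numbers are encoded in unary, as lists of [Nil], so arithmetic reduces to operations on
    lists. *)
Lemma nat_data (n : nat) : enc n = enc (nseq n Nil).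
Proof. by rewrite enc_nat enc_seq; elim: n => //= n ->; rewrite enc_data. Qed.

Section Derived2.
Context (X : Type) {cX : code X} (b : X -> nat).
Hypothesis b_ge : forall x, sz x <= b x.
Let b_ge2 x : 1 < b x := leq_trans (sz_ge2 x) (b_ge x).

Lemma ctime_add (f g : X -> nat) : ctime b f -> ctime b g -> ctime b (fun x => f x + g x).
Proof.
move=> hf hg; apply: (ctime_recode (g := fun x => nseq (f x) Nil ++ nseq (g x) Nil)).
  by move=> x; rewrite nat_data nseqD.
by apply: ctime_cat => //; [apply: ctime_recode hf | apply: ctime_recode hg] => x; rewrite nat_data.
Qed.

Lemma ctime_sub (f g : X -> nat) : ctime b f -> ctime b g -> ctime b (fun x => f x - g x).
Proof.
move=> hf hg.
apply: (ctime_ext (g := fun x => foldr (fun _ acc => acc.-1) (f x) (nseq (g x) Nil))).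
  by move=> x; elim: (g x) => [|n IH]; rewrite ?subn0 //= -IH subnS.
have hg' : ctime b (fun x => nseq (g x) Nil).
  by apply: ctime_recode hg => x; rewrite nat_data.
apply: (@ctime_foldr _ _ _ b_ge _ _ _ _ _ f (fun _ acc _ => acc.-1) (fun x => esize (f x))) => //.
- apply: (ctime_recode (g := fun y : data * (nat * X) => dtl (enc y.2.1))).
    by move=> y; rewrite enc_data !enc_nat; case: y.2.1.
  apply: ctime_tl => //; apply: ctime_enc; apply: ctime_fst => //.
  by apply: ctime_snd => //; exact: ptime_id.
- move=> x s1 s2 _; elim: s2 => //= _ s IH; apply: leq_trans IH.
  by rewrite !esize_nat ltnS leq_double leq_pred.
- exact: ctime_size.
Qed.

Context (A : Type) {cA : code A}.

Lemma esize_flatten (s : seq (seq A)) : esize (flatten s) <= esize s.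
Proof.
elim: s => [|a s IH] /=; first by rewrite !esize_nil.
by rewrite esize_cons; pose proof (esize_cat a (flatten s)); lia.
Qed.

Lemma ctime_flatten (l : X -> seq (seq A)) : ctime b l -> ctime b (fun x => flatten (l x)).
Proof.
move=> hl.
apply: (@ctime_foldr _ _ _ b_ge _ _ _ _ l (fun=> [::]) (fun a acc x => a ++ acc) (fun x => esize (l x))) => //.
- exact: ctime_const.
- by apply: ctime_cat => //; proj.
- by move=> x s1 s2 ->; apply: leq_trans (esize_suffix _ _); exact: esize_flatten.
- exact: ctime_size.
Qed.

(** Each element comes with the list of those before it, because the death of a node depends on the
    older nodes. *)
Fixpoint prefs (s : seq A) : seq (seq A * A) :=
  if s is a :: s' then ([::], a) :: [seq (a :: y.1, y.2) | y <- prefs s'] else [::].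

Lemma size_prefs s : size (prefs s) = size s.
Proof. by elim: s => //= a s IH; rewrite size_map IH. Qed.

Lemma nth_prefs a0 s i : i < size s -> nth ([::], a0) (prefs s) i = (take i s, nth a0 s i).
Proof.
elim: s i => // a s IH [|i] //= lt_i.
by rewrite (nth_map ([::], a0)) ?size_prefs // IH.
Qed.

Lemma esize_prefs s : esize (prefs s) <= size s * (esize s + esize s + 1).+1 + 1.
Proof.
apply: esize_seq_le; first by rewrite size_prefs.
move=> y s1 s2 e.
have lt : size s1 < size s by rewrite -size_prefs e size_cat /= addnS ltnS leq_addr.
case: s lt e => // a s lt e.
have := nth_prefs a lt; rewrite e nth_cat ltnn subnn /= => ->.
rewrite esize_prod; have h := cat_take_drop (size s1) (a :: s).
pose proof (esize_cat (take (size s1) (a :: s)) (drop (size s1) (a :: s))) as h1.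
rewrite h in h1; pose proof (esize_gt0 (drop (size s1) (a :: s))).
have e2 := drop_nth a lt; rewrite e2 in h.
by pose proof (esize_mem (nth a (a :: s) (size s1)) (take (size s1) (a :: s)) (drop (size s1).+1 (a :: s))) as h2;
  rewrite h in h2; rewrite addn1; lia.
Qed.

Lemma ctime_prefs (l : X -> seq A) : ctime b l -> ctime b (fun x => prefs (l x)).
Proof.
move=> hl.
apply: (ctime_ext (g := fun x => foldr (fun a acc => ([::], a) :: [seq (a :: y.1, y.2) | y <- acc]) [::] (l x))).
  by move=> x; elim: (l x) => //= a s ->.
apply: (@ctime_foldr _ _ _ b_ge _ _ _ _ l (fun=> [::]) (fun a acc x => ([::], a) :: [seq (a :: y.1, y.2) | y <- acc])
   (fun x => esize (l x) * (esize (l x) + esize (l x) + 1).+1 + 1)) => //.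
- exact: ctime_const.
- apply: ctime_cons => //.
    by apply: ctime_pair => //; [exact: ptime_const | apply: ctime_fst => //; exact: ptime_id].
  apply: (@ctime_map _ _ _ _ _ _ _ _ _ (fun z x => (x.1 :: z.1, z.2))) => //.
    by apply: ctime_fst => //; apply: ctime_snd => //; exact: ptime_id.
  by proj.
- move=> x s1 s2 e; have -> : foldr (fun a acc => ([::], a) :: [seq (a :: y.1, y.2) | y <- acc]) [::] s2 = prefs s2.
    by elim: (s2) => //= a s ->.
  apply: leq_trans (esize_prefs _) _.
  pose proof (size_esize s2); pose proof (esize_suffix s1 s2) as h; rewrite -e in h.
  by rewrite leq_add2r leq_mul //; lia.
- have h := ctime_size hl.
  by repeat first [exact: h | apply: pb_const | apply: (pb_succ b_ge2) | apply: (pb_add b_ge2) | apply: pb_mul].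
Qed.
End Derived2.

Section Derived3.
Context (X : Type) {cX : code X} (b : X -> nat).
Hypothesis b_ge : forall x, sz x <= b x.
Context (A : eqType) {cA : code A} {iA : codeI A}.

Lemma ctime_mem (f : X -> A) (l : X -> seq A) :
  ctime b f -> ctime b l -> ctime b (fun x => f x \in l x).
Proof.
move=> hf hl.
apply: (@ctime_app2 _ _ _ b_ge _ _ _ _ _ _ (fun a s => a \in s)) => //.
apply: (ctime_ext (g := fun y : A * seq A => has (fun a => a == y.1) y.2)).
  by move=> y; rewrite -has_pred1.
apply: ctime_has => //; first by apply: ctime_snd => //; exact: ptime_id.
by apply: ctime_eq => //; proj.
Qed.

End Derived3.

Section Undup.
Context (X : Type) {cX : code X} (b : X -> nat).
Hypothesis b_ge : forall x, sz x <= b x.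
Context (A : eqType) {cA : code A} {iA : codeI A}.

Lemma esize_undup (s : seq A) : esize (undup s) <= esize s.
Proof.
elim: s => // a s IH /=; case: ifP => _; rewrite ?esize_cons; rewrite ?esize_cons; lia.
Qed.

Lemma ctime_undup (l : X -> seq A) : ctime b l -> ctime b (fun x => undup (l x)).
Proof.
move=> hl.
have e s : foldr (fun a acc => if a \in acc then acc else a :: acc) [::] s = undup s :> seq A.
  by elim: s => //= a s ->; rewrite mem_undup.
apply: (ctime_ext (g := fun x => foldr (fun a acc => if a \in acc then acc else a :: acc) [::] (l x))) => //.
apply: (@ctime_foldr _ _ _ b_ge _ _ _ _ l (fun=> [::]) (fun a acc x => if a \in acc then acc else a :: acc) (fun x => esize (l x))) => //.
- exact: ctime_const.
- have h1 : ptime (fun y : A * (seq A * X) => y.1) by apply: ctime_fst => //; exact: ptime_id.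
  have h2 : ptime (fun y : A * (seq A * X) => y.2.1).
    by apply: ctime_fst => //; apply: ctime_snd => //; exact: ptime_id.
  by apply: ctime_if => //; [apply: ctime_mem | apply: ctime_cons].
- by move=> x s1 s2 ->; rewrite e; apply: leq_trans (esize_suffix _ _); exact: esize_undup.
- exact: ctime_size.
Qed.
End Undup.

(** * Automatic proofs of computability, directed by the syntax of the function *)

Ltac pt_ge := first [by [] | assumption].
(** A hook, redefined when further functions have been shown computable. *)
Ltac pt_user := fail.
Ltac pt1 := lazymatch goal with
  | |- ctime _ (fun x => x) => apply: ctime_id; pt_ge
  | |- ctime _ fst => exact: ptime_fst0
  | |- ctime _ snd => exact: ptime_snd0
  | |- ctime _ (fun _ => ?c) => apply: ctime_const; pt_ge
  | |- ctime _ (fun x => (@?h x).1) => refine (ctime_fst (f := h) _ _); [pt_ge |]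
  | |- ctime _ (fun x => (@?h x).2) => refine (ctime_snd (f := h) _ _); [pt_ge |]
  | |- ctime _ (fun x => (@?h x, @?k x)) => refine (ctime_pair (f := h) (g := k) _ _ _); [pt_ge | |]
  | |- ctime _ (fun x => @?h x :: @?k x) => refine (ctime_cons (f := h) (g := k) _ _ _); [pt_ge | |]
  | |- ctime _ (fun x => if _ then _ else _) => apply: ctime_if; [pt_ge | | |]
  | |- ctime _ (fun x => @eq_op _ (@?h x) (@?k x)) =>
      refine (ctime_eq (f := h) (g := k) _ _ _); [pt_ge | |]
  | |- ctime _ (fun x => ~~ (@?h x)) => refine (ctime_neg (f := h) _ _); [pt_ge |]
  | |- ctime _ (fun x => (@?h x) && (@?k x)) => refine (ctime_and (f := h) (g := k) _ _ _); [pt_ge | |]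
  | |- ctime _ (fun x => (@?h x) || (@?k x)) => refine (ctime_or (f := h) (g := k) _ _ _); [pt_ge | |]
  | |- ctime _ (fun x => Node (@?h x) (@?k x)) => refine (ctime_node (f := h) (g := k) _ _ _); [pt_ge | |]
  | |- ctime _ (fun x => dhd (@?h x)) => refine (ctime_hd (f := h) _ _); [pt_ge |]
  | |- ctime _ (fun x => dtl (@?h x)) => refine (ctime_tl (f := h) _ _); [pt_ge |]
  | |- ctime _ (fun x => (@?h x).+1) => refine (ctime_succ (f := h) _ _); [pt_ge |]
  | |- ctime _ (fun x => addn (@?h x) (@?k x)) => refine (ctime_add (f := h) (g := k) _ _ _); [pt_ge | |]
  | |- ctime _ (fun x => subn (@?h x) (@?k x)) => refine (ctime_sub (f := h) (g := k) _ _ _); [pt_ge | |]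
  | |- ctime _ (fun x => size (@?h x)) => refine (ctime_size_nat (l := h) _ _); [pt_ge |]
  | |- ctime _ (fun x => flatten (@?h x)) => refine (ctime_flatten (l := h) _ _); [pt_ge |]
  | |- ctime _ (fun x => prefs (@?h x)) => refine (ctime_prefs (l := h) _ _); [pt_ge |]
  | |- ctime _ (fun x => undup (@?h x)) => refine (ctime_undup (l := h) _ _); [pt_ge |]
  | |- ctime _ (fun x => (@?h x) ++ (@?k x)) => refine (ctime_cat (l1 := h) (l2 := k) _ _ _); [pt_ge | |]
  | |- ctime _ (fun x => in_mem (@?h x) (mem (@?k x))) =>
      refine (ctime_mem (f := h) (l := k) _ _ _); [pt_ge | |]
  | |- ctime _ (fun x => has (@?h x) (@?k x)) =>
      refine (ctime_has (l := k) (G := fun a x => h x a) _ _ _); [pt_ge | | cbn beta]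
  | |- ctime _ (fun x => all (@?h x) (@?k x)) =>
      refine (ctime_all (l := k) (G := fun a x => h x a) _ _ _); [pt_ge | | cbn beta]
  | |- ctime _ (fun x => filter (@?h x) (@?k x)) =>
      refine (ctime_filter (l := k) (G := fun a x => h x a) _ _ _); [pt_ge | | cbn beta]
  | |- ctime _ (fun x => map (@?h x) (@?k x)) =>
      refine (ctime_map (l := k) (G := fun a x => h x a) _ _ _); [pt_ge | | cbn beta]
  | |- ctime _ (fun x => enc (@?h x)) => refine (ctime_enc (f := h) _)
  | |- _ => pt_user
  end.
Ltac pt := repeat first [match goal with H : ?P |- ?P => exact H end | pt1].

(** * Encoded formulas *)

Section TreeRec.
Context (Y : Type) {cY : code Y} (c : data -> data * data) (g : data * (Y * Y) -> Y) (R : data -> Y).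
Hypothesis R_nil : enc (R Nil) = Nil.
Hypothesis R_node : forall d, d <> Nil -> R d = g (d, (R (c d).1, R (c d).2)).
Hypothesis c_lt : forall d, d <> Nil -> dsize (c d).1 + dsize (c d).2 < dsize d.
Hypothesis pt_c : ptime c.
Hypothesis pt_g : ptime g.
Hypothesis R_size : exists k, forall d, esize (R d) <= sz d ^ k.

Definition rec_expr n : expr :=
  EIf (EVar 0)
    (ELet (ECall 1 (EVar 0))
      (ECall n (ENode (EVar 1) (ENode (ECall 0 (EHd (EVar 0))) (ECall 0 (ETl (EVar 0)))))))
    ENil.

(** The sizes of the two recursive arguments add up to less than the size of [d], hence the number
    of calls is linear. The results being polynomially bounded, one call on a tree of size at most
    [n] costs at most [W n]: the last summand of [W n] is for [g], applied to the tree and two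
    results, [n.+1 ^ k] is for [c], and the rest is for passing arguments. *)
Lemma ptime_rec : ptime R.
Proof.
case: pt_c => p [p0 [T [[k hk] hT]]]; case: pt_g => q [q0 [U [[l hl] hU]]].
case: R_size => m hm.
pose e := rec_expr (1 + size p).
pose p' := [:: e] ++ reloc_program 1 p ++ reloc_program (1 + size p) q.
have emb1 : embedded p' 1 p by exact: (embedded_cat [:: e]).
have emb2 : embedded p' (1 + size p) q.
  have := @embedded_cat ([:: e] ++ reloc_program 1 p) q [::].
  by rewrite cats0 size_cat size_map -catA.
have le_exp a a' r : a <= a' -> a ^ r <= a' ^ r by case: r => // r h; rewrite leq_exp2r.
pose W n := 20 * n.+1 + 12 * n.+1 ^ m + n.+1 ^ k + (n.+1 + 2 * n.+1 ^ m + 2) ^ l.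
have key n d : dsize d <= n -> exists2 t, eval p' [:: d] e (enc (R d)) t & t <= dsize d * W n.
  elim/ltn_ind: {d}(dsize d) {-2}d (erefl (dsize d)) => s IH d sd le_n; subst s.
  case: (@eqP _ d Nil) => [->|dN].
    rewrite R_nil; eexists.
      by apply: eval_if_false; [exact: eval_varE | exact: eval_nil].
    by rewrite /W /=; lia.
  have lt := c_lt dN.
  have [t1 ev1 le1] := IH _ (leq_ltn_trans (leq_addr _ _) lt) _ erefl (ltnW (leq_trans (leq_ltn_trans (leq_addr _ _) lt) le_n)).
  have [t2 ev2 le2] := IH _ (leq_ltn_trans (leq_addl _ _) lt) _ erefl (ltnW (leq_trans (leq_ltn_trans (leq_addl _ _) lt) le_n)).
  have [u ev3 le3] := hT d; have [v ev4 le4] := hU (d, (R (c d).1, R (c d).2)).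
  rewrite -R_node // /computes !enc_pair in ev4.
  have ev3' : computes p d (Node (c d).1 (c d).2) u.
    by move: ev3; rewrite /computes; case: (c d) => x y; rewrite enc_pair !enc_data.
  have szd : sz d <= n.+1 by rewrite /sz enc_data.
  have le3' : u <= n.+1 ^ k by apply: leq_trans le3 (leq_trans (hk d) (le_exp _ _ _ szd)).
  have r0 : esize (R d) <= n.+1 ^ m by apply: leq_trans (hm d) (le_exp _ _ _ szd).
  have r1 : esize (R (c d).1) <= n.+1 ^ m.
    by apply: leq_trans (hm _) (le_exp _ _ _ _); rewrite /sz enc_data; lia.
  have r2 : esize (R (c d).2) <= n.+1 ^ m.
    by apply: leq_trans (hm _) (le_exp _ _ _ _); rewrite /sz enc_data; lia.
  have le4' : v <= (n.+1 + 2 * n.+1 ^ m + 2) ^ l.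
    apply: leq_trans le4 (leq_trans (hl _) (le_exp _ _ _ _)).
    by rewrite /sz !esize_prod enc_data; lia.
  have [d1 [d2 ed]] : exists d1 d2, d = Node d1 d2 by case: (d) dN => // d1 d2; exists d1, d2.
  rewrite enc_data in ev4.
  eexists.
    apply: eval_if_true; first by apply: eval_varE; exact: ed.
    apply: eval_let.
      by apply: (eval_embedded emb1 p0 _ ev3'); exact: eval_varE.
    apply: (eval_embedded emb2 q0 _ ev4).
    apply: eval_node; first exact: eval_varE.
    apply: eval_node.
      by apply: (@eval_call p' _ 0); [apply: eval_hdN; exact: eval_varE | exact: ev1].
    by apply: (@eval_call p' _ 0); [apply: eval_tlN; exact: eval_varE | exact: ev2].
  have le5 : t1 + t2 + W n <= dsize d * W n.
    apply: (@leq_trans ((dsize (c d).1 + dsize (c d).2 + 1) * W n)); first by rewrite !mulnDl mul1n; lia.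
    by rewrite leq_mul // addn1.
  apply: leq_trans le5; move: lt le_n; rewrite /W /=.
  by have := congr1 dsize ed; rewrite [dsize (Node _ _)]/=; lia.
exists p'; split=> //; exists (fun d => sz d * W (sz d)); split.
  rewrite /W.
  by repeat first [exact: (pb_esize (fun=> leqnn _)) | exact: pb_id | exact: pb_const | apply: pb_mul | apply: pb_exp
     | apply: (pb_succ (@sz_ge2 _ _)) | apply: (pb_add (@sz_ge2 _ _))].
move=> d; have [|t ev le_t] := @key (sz d) d; first by rewrite /sz enc_data.
rewrite /computes enc_data; exists t => //; apply: leq_trans le_t _.
by rewrite leq_mul // /sz enc_data.
Qed.
End TreeRec.

(** The tags are those of [enc_form]. [Nil] takes the place of a missing subformula, and its closure
    is empty. *)
Definition kids (d : data) : data * data :=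
  if (dhd d == dnat 2) || (dhd d == dnat 4) then (dtl d, Nil)
  else if (dhd d == dnat 3) || (dhd d == dnat 5) then (dhd (dtl d), dtl (dtl d))
  else if dhd d == dnat 6 then (dtl (dtl d), Nil) else (Nil, Nil).

Fixpoint closure (d : data) : seq data :=
  if d is Node k y then
    d :: (if (k == dnat 2) || (k == dnat 4) then closure y ++ [::]
          else if (k == dnat 3) || (k == dnat 5) then
            (if y is Node u v then closure u ++ closure v else [::])
          else if k == dnat 6 then (if y is Node u v then closure v ++ [::] else [::])
          else [::])
  else [::].

(** Puts the structural recursion into the form that [ptime_rec] handles; the [++ [::]] in [closure]
    stand for the missing child. *)
Lemma closureE d : d <> Nil -> closure d = d :: (closure (kids d).1 ++ closure (kids d).2).
Proof.
case: d => // k y _ /=; rewrite /kids /=.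
case: ifP => _ //=; case: ifP => _ /=; first by case: y.
by case: ifP => _ //=; case: y.
Qed.

Lemma kids_lt d : d <> Nil -> dsize (kids d).1 + dsize (kids d).2 < dsize d.
Proof.
case: d => // k y _ /=; rewrite /kids /=.
have k0 := dsize_gt0 k; have y0 := dsize_gt0 y.
case: ifP => _ /=; first lia.
case: ifP => _ /=; first by case: y y0 => /= *; lia.
by case: ifP => _ /=; [case: y y0 => /= * | ]; lia.
Qed.

Lemma closure_size d : esize (closure d) <= dsize d * dsize d + dsize d.
Proof.
elim/ltn_ind: {d}(dsize d) {-2}d (erefl (dsize d)) => s IH d sd; subst s.
case: (@eqP _ d Nil) => [->|dN]; first by rewrite esize_nil.
rewrite closureE // esize_cons enc_data.
have lt := kids_lt dN.
have h1 := IH _ (leq_ltn_trans (leq_addr _ _) lt) _ erefl.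
have h2 := IH _ (leq_ltn_trans (leq_addl _ _) lt) _ erefl.
pose proof (esize_cat (closure (kids d).1) (closure (kids d).2)).
nia.
Qed.

Lemma ptime_closure : ptime closure.
Proof.
apply: (ptime_rec (c := kids) (g := fun x => x.1 :: (x.2.1 ++ x.2.2))) => //.
- exact: closureE.
- exact: kids_lt.
- by rewrite /kids; pt.
- by pt.
- exists 3 => d; apply: leq_trans (closure_size d) _; rewrite /sz enc_data.
  by rewrite !expnS expn0; nia.
Qed.

(** * Exponential enumerations *)

Fixpoint subseqs (T : Type) (s : seq T) : seq (seq T) :=
  if s is x :: s' then subseqs s' ++ map (cons x) (subseqs s') else [:: [::]].

Lemma size_subseqs T (s : seq T) : size (subseqs s) = 2 ^ size s.
Proof. by elim: s => //= x s IH; rewrite size_cat size_map IH expnS mul2n addnn. Qed.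

Lemma map_subseqs T U (f : T -> U) (s : seq T) : subseqs (map f s) = map (map f) (subseqs s).
Proof.
elim: s => //= x s IH; rewrite map_cat IH -!map_comp.
by congr cat; apply: eq_map.
Qed.

Lemma mem_subseqs (T : eqType) (s r : seq T) : (r \in subseqs s) = subseq r s.
Proof.
elim: s r => [|x s IH] r; first by rewrite subseq0 mem_seq1.
rewrite /= mem_cat IH; case: r => [|y r]; first by rewrite sub0seq.
case: eqP => [->|ne].
  rewrite mem_map ?IH; last by move=> ? ? [].
  apply/orP/idP => [[|//]|->]; last by right.
  by move/(subseq_trans _); apply; exact: subseq_cons.
rewrite orbC; case: mapP => // -[r' _ [e]]; by case: ne.
Qed.

Lemma subseqs_uniq (T : eqType) (s : seq T) : uniq s -> uniq (subseqs s).
Proof.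
elim: s => //= x s IH /andP[xs us]; rewrite cat_uniq IH // map_inj_uniq ?IH ?andbT //; last by move=> ? ? [].
apply/hasPn => _ /mapP[r _ ->]; rewrite /= mem_subseqs; apply: contra xs => /mem_subseq; apply.
exact: mem_head.
Qed.

(** The list [ks] is a bound on the length given in unary, so that the enumeration is a fold over
    [ks]. *)
Fixpoint allseqs (T U : Type) (ks : seq U) (Y : seq T) : seq (seq T) :=
  if ks is _ :: ks' then [::] :: flatten [seq [seq y :: r | r <- allseqs ks' Y] | y <- Y]
  else [:: [::]].

Lemma size_allseqs T U (ks : seq U) (Y : seq T) : size (allseqs ks Y) <= (size Y).+1 ^ size ks.
Proof.
elim: ks => //= _ ks IH.
rewrite size_flatten /shape -map_comp (eq_map (g := fun=> size (allseqs ks Y))); last first.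
  by move=> y /=; rewrite size_map.
have -> : sumn [seq (fun=> size (allseqs ks Y)) i | i <- Y] = size Y * size (allseqs ks Y).
  by move: (size (allseqs ks Y)) => n; elim: (Y) => //= y Y' ->; rewrite mulSn.
rewrite expnS mulSn -add1n leq_add ?leq_mul // ?expn_gt0 //.
Qed.

Lemma mem_allseqs (T : eqType) U (ks : seq U) (Y : seq T) r :
  (r \in allseqs ks Y) = (size r <= size ks) && all (mem Y) r.
Proof.
elim: ks r => [|k ks IH] r /=; first by rewrite mem_seq1; case: r.
case: r => [|y r]; rewrite inE //= ltnS; apply/flattenP/and3P.
  case=> _ /mapP[z zY ->] /mapP[r' r'in [-> ->]]; move: r'in; rewrite IH => /andP[].
  by split.
case=> sr yY rY; exists [seq y :: r' | r' <- allseqs ks Y]; first exact: map_f.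
by rewrite map_f // IH sr.
Qed.

Lemma allseqs_uniq (T : eqType) U (ks : seq U) (Y : seq T) : uniq Y -> uniq (allseqs ks Y).
Proof.
move=> uY; elim: ks => //= _ ks IH; apply/andP; split.
  by apply/flattenP => -[_ /mapP[y _ ->] /mapP[]].
apply: (@allpairs_uniq _ _ _ (fun y r => y :: r)) => //.
by move=> [a r] [a' r'] _ _ [-> ->].
Qed.

(** * Infinite sequences *)

Lemma eventually_constant (f : nat -> nat) T0 :
  (forall t, T0 <= t -> f t.+1 <= f t) -> exists2 T, T0 <= T & forall t, T <= t -> f t = f T.
Proof.
elim/ltn_ind: {f}(f T0) {-2}f {-2}T0 (erefl (f T0)) => n IH f T fT h; subst n.
have mono t : T <= t -> f t <= f T.
  elim: t => [|t IHt]; first by rewrite leqn0 => /eqP->.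
  rewrite leq_eqVlt => /orP[/eqP->//|]; rewrite ltnS => Tt.
  exact: leq_trans (h _ Tt) (IHt Tt).
case: (EM (exists2 t, T <= t & f t < f T)) => [[t Tt lt]|no].
  have [t' Tt' le] : exists2 t', T <= t' & f t' < f T by exists t.
  case: (IH (f t) lt f t erefl) => [t1 tt1|T1 tT1 h1]; first by apply: h; exact: leq_trans tt1.
  by exists T1 => //; exact: leq_trans tT1.
exists T => // t Tt; apply/eqP; rewrite eqn_leq mono // leqNgt.
by apply/negP => lt; apply: no; exists t.
Qed.

Lemma max_infinitely_often (u : nat -> nat) B :
  (exists i, forall j, i <= j -> u j <= B) ->
  exists2 m, (forall i, exists2 j, i <= j & u j = m) &
             (exists i, forall j, i <= j -> u j <= m).
Proof.
elim: B => [|B IH] [i hi].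
  exists 0; last by exists i.
  move=> k; exists (maxn i k); first exact: leq_maxr.
  by apply/eqP; rewrite -leqn0 hi // leq_maxl.
case: (EM (forall i, exists2 j, i <= j & u j = B.+1)) => [h|no].
  by exists B.+1 => //; exists i.
apply: IH; have [k hk] : exists k, forall j, k <= j -> u j <> B.+1.
  apply: contrapT => h; apply: no => k; apply: contrapT => h'; apply: h; exists k => j kj e.
  by apply: h'; exists j.
exists (maxn i k) => j; rewrite geq_max => /andP[ij kj].
by have := hi _ ij; rewrite leq_eqVlt => /orP[/eqP/(hk _ kj)|].
Qed.

Lemma dependent_choice (T : Type) (P : nat -> T -> Prop) (R : nat -> T -> T -> Prop) x0 :
  P 0 x0 -> (forall t x, P t x -> exists2 y, P t.+1 y & R t x y) ->
  exists f : nat -> T, [/\ f 0 = x0, forall t, P t (f t) & forall t, R t (f t) (f t.+1)].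
Proof.
move=> P0 h.
pose S := {y : nat * T | P y.1 y.2}.
have next (s : S) : {s' : S | (sval s').1 = (sval s).1.+1 /\ R (sval s).1 (sval s).2 (sval s').2}.
  case: s => -[t x] /= Px; apply: cid; have [y Py Ry] := h t x Px.
  by exists (exist _ (t.+1, y) Py).
pose g := fix g n := if n is n'.+1 then sval (next (g n')) else (exist _ (0, x0) P0 : S).
have g1 n : (sval (g n)).1 = n by elim: n => //= n IH; rewrite (svalP (next (g n))).1 IH.
exists (fun n => (sval (g n)).2); split=> // t.
  by have := svalP (g t); rewrite g1.
rewrite -[t in R t _ _]g1; exact: (svalP (next (g t))).2.
Qed.

Lemma bounded_all (T : eqType) (L : seq T) (P : T -> nat -> Prop) :
  (forall x, x \in L -> exists n, P x n) ->
  (forall x n n', n <= n' -> P x n -> P x n') ->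
  exists n, forall x, x \in L -> P x n.
Proof.
move=> h mono; elim: L h => [|x L IH] h; first by exists 0.
have [n1 h1] := h x (mem_head _ _).
have [|n2 h2] := IH; first by move=> y yL; apply: h; rewrite inE yL orbT.
exists (maxn n1 n2) => y; rewrite inE => /orP[/eqP->|yL].
  by apply: mono h1; exact: leq_maxl.
by apply: mono (h2 _ yL); exact: leq_maxr.
Qed.

(** König's lemma for a layered graph with finite layers. Predecessors exist, so some vertex of
    layer 0 begins arbitrarily long paths; and a vertex with this property has a successor with it,
    since otherwise finitely many bounds would have a common one. *)
Lemma koenig (T : eqType) (L : seq T) (S : nat -> T -> Prop) (R : nat -> T -> T -> Prop) :
  (forall t x, S t x -> x \in L) -> (forall t, exists x, S t x) ->
  (forall t y, S t.+1 y -> exists2 x, S t x & R t x y) ->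
  exists f : nat -> T, (forall t, S t (f t)) /\ (forall t, R t (f t) (f t.+1)).
Proof.
move=> SL ne pred.
(* [D n t x] means that a path of [n] steps through the layers begins at the vertex [x] of layer
   [t]. *)
pose D := fix D n t x := if n is n'.+1 then exists2 y, S t.+1 y /\ R t x y & D n' t.+1 y else True.
have Dmono n n' t x : n <= n' -> D n' t x -> D n t x.
  elim: n n' t x => [|n IH] [|n'] t x //= le [y h1 h2].
  by exists y => //; exact: (IH n').
have anc n t z : S (t + n) z -> exists2 x, S t x & D n t x.
  elim: n t z => [|n IH] t z; first by rewrite addn0 => Sz; exists z.
  rewrite addnS -addSn => /IH[y Sy Dy]; have [x Sx Rx] := pred _ _ Sy.
  by exists x => //=; exists y.
pose G t x := S t x /\ forall n, D n t x.
have G0 : exists x, G 0 x.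
  apply: contrapT => no.
  have [n hn] : exists n, forall x, x \in L -> S 0 x -> ~ D n 0 x.
    apply: (@bounded_all _ _ (fun x n => S 0 x -> ~ D n 0 x)).
      move=> x _; apply: contrapT => h; apply: no; exists x; split.
        by apply: contrapT => nS; apply: h; exists 0 => /nS.
      by move=> n; apply: contrapT => nD; apply: h; exists n => _.
    by move=> x n n' le h Sx /(Dmono _ _ _ _ le); exact: h.
  have [z Sz] := ne (0 + n); have [x Sx Dx] := anc _ _ _ Sz.
  exact: hn (SL _ _ Sx) Sx Dx.
have Gstep t x : G t x -> exists2 y, G t.+1 y & R t x y.
  move=> [Sx Dx]; apply: contrapT => no.
  have [n hn] : exists n, forall y, y \in L -> S t.+1 y /\ R t x y -> ~ D n t.+1 y.
    apply: (@bounded_all _ _ (fun y n => S t.+1 y /\ R t x y -> ~ D n t.+1 y)).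
      move=> y _; apply: contrapT => h; apply: no; exists y.
        split; first by apply: contrapT => nS; apply: h; exists 0 => -[/nS].
        by move=> n; apply: contrapT => nD; apply: h; exists n => _.
      by apply: contrapT => nR; apply: h; exists 0 => -[_ /nR].
    by move=> y n n' le h Sy /(Dmono _ _ _ _ le); exact: h.
  have /= [y [Sy Ry] Dy] := Dx n.+1.
  exact: hn (SL _ _ Sy) (conj Sy Ry) Dy.
have [x0 Gx0] := G0.
have [f [_ h1 h2]] := dependent_choice Gx0 Gstep.
by exists f; split=> // t; exact: (h1 t).1.
Qed.

(** * Determinization of backward deterministic automata *)

Lemma nth_filter_count (T : Type) (x0 : T) (a : pred T) s i :
  i < size s -> a (nth x0 s i) ->
  nth x0 (filter a s) (count a (take i s)) = nth x0 s i /\ count a (take i s) < size (filter a s).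
Proof.
elim: s i => // x s IH [|i] /= lt ai; first by rewrite ai.
have [e1 e2] := IH i lt ai.
by case: (a x); rewrite /= ?add1n ?add0n.
Qed.

Section Det.
Context (V U : eqType) (Sig : Type).
Variables (VL : seq V) (PL : seq (V * U)).
Variables (step : V -> Sig -> V -> bool) (ful : U -> V -> bool) (K : nat).

(* A node stands for a past state: its first component is the set of the
   current descendants of that state, the second one the set of the pairs
   (a, u) such that u has not been fulfilled by the history of a since the
   last reset. *)
Definition node : Type := seq V * seq (V * U).

Definition img sg (D : seq V) := [seq a' <- VL | has (fun a => step a sg a') D].
Definition mimg sg (M : seq (V * U)) :=
  [seq x <- PL | has (fun y => (y.2 == x.2) && step y.1 sg x.1) M && ~~ ful x.2 x.1].
Definition full (D : seq V) := [seq x <- PL | x.1 \in D].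
Definition advance sg (s : seq node) : seq node := [seq (img sg nd.1, mimg sg nd.2) | nd <- s].
(** A node whose set is that of an older one would have the same descendants forever. *)
Definition dead (y : seq node * node) := (y.2.1 == [::]) || (y.2.1 \in [seq nd.1 | nd <- y.1]).
Definition kept (ps : seq (seq node * node)) := [seq y.2 | y <- [seq y <- ps | ~~ dead y]].
Definition reset (nd : node) := if nd.2 == [::] then (nd.1, full nd.1) else nd.
Definition fresh1 a : node := ([:: a], full [:: a]).
Definition live (s : seq node) := [seq a <- VL | has (fun nd => a \in nd.1) s].
(** The singleton of every live state is kept among the sets, so that a branch can be followed from
    any moment on. *)
Definition fresh (s : seq node) :=
  [seq fresh1 a | a <- [seq a <- live s | [:: a] \notin [seq nd.1 | nd <- s]]].
(* The index of the first event, with true for a death or for no event; hue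
   gives earlier events larger colors, and makes those flagged true odd. *)
Definition event (ps : seq (seq node * node)) : nat * bool :=
  foldr (fun y acc => if dead y then (0, true)
                      else if y.2.2 == [::] then (0, false) else (acc.1.+1, acc.2))
        (0, true) ps.
Definition hue (e : nat * bool) := (K - e.1) + (K - e.1) + (if e.2 then 1 else 0).
Definition next (sg : Sig) (q : nat * seq node) : nat * seq node :=
  let ps := prefs (advance sg q.2) in
  (hue (event ps), [seq reset nd | nd <- kept ps] ++ fresh (kept ps)).
Definition start (I : seq V) : nat * seq node := (0, [seq fresh1 a | a <- I]).

Fixpoint run (I : seq V) (w : nat -> Sig) (t : nat) :=
  if t is t'.+1 then next (w t') (run I w t') else start I.

Hypothesis VLu : uniq VL.
Hypothesis back : forall a1 a2 sg a', a1 \in VL -> a2 \in VL -> a' \in VL ->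
  step a1 sg a' -> step a2 sg a' -> a1 = a2.

Definition deaths sg s i := dead (nth ([::], ([::], [::])) (prefs (advance sg s)) i).
Definition flash sg (s : seq node) i := mimg sg (nth ([::], [::]) s i).2 == [::].

Local Notation nd0 := (([::], [::]) : node).
Local Notation ps0 := (([::], nd0) : seq node * node).

Lemma nth_advance sg s i : i < size s ->
  nth nd0 (advance sg s) i = (img sg (nth nd0 s i).1, mimg sg (nth nd0 s i).2).
Proof. by move=> lt; rewrite (nth_map nd0). Qed.

Lemma deathsE sg s i : i < size s ->
  deaths sg s i = (img sg (nth nd0 s i).1 == [::]) ||
                  (img sg (nth nd0 s i).1 \in [seq img sg nd.1 | nd <- take i s]).
Proof.
move=> lt; rewrite /deaths nth_prefs ?size_map // /dead /= nth_advance //=.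
by rewrite -map_take -map_comp.
Qed.

Lemma eventP sg s : let e := event (prefs (advance sg s)) in
  [/\ e.1 <= size s, forall j, j < e.1 -> ~~ deaths sg s j /\ ~~ flash sg s j &
      if e.2 then e.1 < size s -> deaths sg s e.1
      else [/\ e.1 < size s, ~~ deaths sg s e.1 & flash sg s e.1]].
Proof.
have flashE j : j < size s -> flash sg s j = ((nth ps0 (prefs (advance sg s)) j).2.2 == [::]).
  by move=> lt; rewrite nth_prefs ?size_map //= nth_advance.
have sz : size s = size (prefs (advance sg s)) by rewrite size_prefs size_map.
suff: let e := event (prefs (advance sg s)) in
  [/\ e.1 <= size s, forall j, j < e.1 -> ~~ deaths sg s j /\
             ~~ ((nth ps0 (prefs (advance sg s)) j).2.2 == [::]) &
      if e.2 then e.1 < size s -> deaths sg s e.1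
      else [/\ e.1 < size s, ~~ deaths sg s e.1 &
             (nth ps0 (prefs (advance sg s)) e.1).2.2 == [::]]].
  move=> /= [h1 h2 h3]; split=> // [j lt|].
    by have [] := h2 j lt; rewrite flashE //; exact: leq_trans h1.
  by case: ifP h3 => // _ [lt ? ?]; rewrite flashE.
rewrite sz /deaths; move: (prefs _) => {flashE sz}; elim=> //= y ps [h1 h2 h3].
case: ifP => dy /=; first by split.
case: ifP => fy /=; first by rewrite dy fy; split.
split=> // -[|j] /=; last exact: h2.
by rewrite dy fy.
Qed.

(** * The position of a node after one transition *)

Section Kept.
Variables (sg : Sig) (q : nat * seq node).
Let s := q.2.
Let s' := (next sg q).2.

Lemma track_alive i : i < size s -> ~~ deaths sg s i ->
  exists p, [/\ p <= i, p < size s', nth nd0 s' p = reset (nth nd0 (advance sg s) i) &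
                p = i <-> (forall j, j < i -> ~~ deaths sg s j)].
Proof.
move=> lt nd; set ps := prefs (advance sg s).
have szp : size ps = size s by rewrite size_prefs size_map.
have [] := @nth_filter_count _ ps0 (fun y => ~~ dead y) ps i; rewrite ?szp //.
set p := count _ _ => e1 e2.
have szt : size (take i ps) = i by rewrite size_take szp lt.
exists p; split.
- by apply: leq_trans (count_size _ _) _; rewrite szt.
- by rewrite size_cat size_map /kept size_map; apply: leq_trans e2 (leq_addr _ _).
- rewrite nth_cat size_map /kept size_map e2 (nth_map nd0) ?size_map // (nth_map ps0) // e1.
  by rewrite nth_prefs ?size_map.
split=> [e j lt_ji|all_al].
  have : all (fun y => ~~ dead y) (take i ps) by rewrite all_count szt -/p e.
  by move/(all_nthP ps0)/(_ j); rewrite szt nth_take //; exact.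
apply/eqP; rewrite -[X in _ == X]szt -all_count; apply/(all_nthP ps0) => j; rewrite szt => lt_ji.
by rewrite nth_take //; exact: all_al.
Qed.

(** If node [i] dies because older nodes have the same image, the oldest of them survives and
    carries the set, at a strictly smaller position. Thus the position of a nonempty set of
    descendants never increases, and when it is unchanged no node up to it has died. *)
Lemma track_node i : i < size s -> img sg (nth nd0 s i).1 <> [::] ->
  exists p, [/\ p <= i, p < size s', (nth nd0 s' p).1 = img sg (nth nd0 s i).1 &
                p = i -> forall j, j <= i -> ~~ deaths sg s j].
Proof.
have reset1 nd : (reset nd).1 = nd.1 by rewrite /reset; case: ifP.
move=> lt ne; case: (boolP (deaths sg s i)) => [|al]; last first.
  have [p [h1 h2 h3 h4]] := track_alive lt al.
  exists p; split=> // [|e j]; first by rewrite h3 reset1 nth_advance.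
  by rewrite leq_eqVlt => /orP[/eqP->//|]; move: j; exact/h4.
rewrite deathsE // => /orP[/eqP//|].
set D := img sg _ in ne *; set L := [seq _ | nd <- take i s] => DL.
have szL : size L = i by rewrite size_map size_take lt.
have lt_j : index D L < i by rewrite -[X in _ < X]szL index_mem.
have lt_js : index D L < size s by exact: ltn_trans lt.
have eD : img sg (nth nd0 s (index D L)).1 = D.
  by rewrite -[RHS](nth_index [::] DL) (nth_map nd0) ?nth_take // size_take lt.
have al : ~~ deaths sg s (index D L).
  rewrite deathsE // eD negb_or; apply/andP; split; first exact/eqP.
  apply/negP => DL'; set L1 := [seq _ | nd <- take _ s] in DL'.
  have eL : L = L1 ++ drop (index D L) L.
    rewrite -{1}[L](cat_take_drop (index D L)); congr (_ ++ _).
    by rewrite /L1 {3}/L -map_take take_takel // ltnW.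
  have : index D L1 < size L1 by rewrite index_mem.
  by rewrite /L1 size_map size_take lt_js {2}eL index_cat DL' ltnn.
have [p [h1 h2 h3 h4]] := track_alive lt_js al.
have lt_pi : p < i by exact: leq_ltn_trans lt_j.
exists p; split=> //; [exact: ltnW | by rewrite h3 reset1 nth_advance | ].
by move=> e; rewrite e ltnn in lt_pi.
Qed.
End Kept.

(** Subsequences of [VL] are canonical representatives, so that the equality of lists decides the
    equality of sets. *)
Lemma canon (D1 D2 : seq V) : subseq D1 VL -> subseq D2 VL -> D1 =i D2 -> D1 = D2.
Proof.
move=> /(subseq_uniqP VLu) e1 /(subseq_uniqP VLu) e2 e; rewrite e1 e2.
by apply: eq_filter => a; rewrite -e.
Qed.

Lemma mem_img sg D a' : reflect (a' \in VL /\ exists2 a, a \in D & step a sg a') (a' \in img sg D).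
Proof. by rewrite mem_filter andbC; apply: (iffP andP) => -[h /hasP]. Qed.

Lemma mem_kept sg s nd :
  nd \in kept (prefs (advance sg s)) ->
  exists i, [/\ i < size s, ~~ deaths sg s i & nd = nth nd0 (advance sg s) i].
Proof.
move=> /mapP[y]; rewrite mem_filter => /andP[al /(nthP ps0)[i]].
rewrite size_prefs size_map => lt e ->; exists i; split=> //; first by rewrite /deaths e.
by rewrite -e nth_prefs ?size_map.
Qed.

Lemma kept_img sg s nd : nd \in kept (prefs (advance sg s)) ->
  exists2 nd', nd' \in s & nd = (img sg nd'.1, mimg sg nd'.2) /\ img sg nd'.1 <> [::].
Proof.
move=> /mem_kept[i [lt al ->]]; exists (nth nd0 s i); first exact: mem_nth.
rewrite nth_advance //; split=> // e; move: al.
by rewrite deathsE // e eqxx.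
Qed.

Lemma kept_uniq (s1 : seq node) : uniq [seq nd.1 | nd <- kept (prefs s1)].
Proof.
apply/(uniqP [::]) => i j; rewrite !inE !size_map.
rewrite /kept -!map_comp; set F := [seq y <- prefs s1 | _] => lt_i lt_j.
wlog lt_ij : i j lt_i lt_j / i < j.
  move=> wl e; case: (ltngtP i j) => // [ij|ji]; first exact: wl e.
  by symmetry; apply: wl (esym e).
rewrite !(nth_map ps0) //= => e; exfalso.
(* In a subsequence of [prefs s1], the prefix recorded with an entry contains all the earlier
   entries. Of two kept nodes with the same set, the later one would be dead. *)
have key (ps : seq (seq node * node)) i' j' : subseq ps (prefs s1) -> i' < j' -> j' < size ps ->
    (nth ps0 ps i').2 \in (nth ps0 ps j').1.
  move=> /subseqP[m szm ->] {ps}.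
  elim: (s1) m szm i' j' => [|x s IH] [|b m] //= [szm] i' j'.
  have e' : mask m [seq (x :: y.1, y.2) | y <- prefs s] = [seq (x :: y.1, y.2) | y <- mask m (prefs s)].
    by rewrite map_mask.
  rewrite size_map in szm.
  have szE : size (mask m [seq (x :: y.1, y.2) | y <- prefs s]) = size (mask m (prefs s)).
    by rewrite e' size_map.
  case: b => /=; last first.
    move=> ij jm; rewrite szE in jm; have im := ltn_trans ij jm.
    by rewrite e' !(nth_map ps0) //= inE IH ?orbT // size_map.
  rewrite ltnS szE; case: j' => // j'; case: i' => [|i'] /=.
    by move=> _ jm; rewrite e' (nth_map ps0) //= mem_head.
  rewrite ltnS => ij jm; have im := ltn_trans ij jm.
  by rewrite e' !(nth_map ps0) //= inE IH ?orbT.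
have := mem_nth ps0 lt_j; rewrite mem_filter => /andP[].
rewrite /dead negb_or => /andP[_ /mapP no] _; apply: no.
by exists (nth ps0 F i).2 => //; apply: key => //; exact: filter_subseq.
Qed.

(** * Laminarity and the number of nodes *)

Definition laminar (s : seq node) := forall nd1 nd2, nd1 \in s -> nd2 \in s ->
  (exists2 a, a \in nd1.1 & a \in nd2.1) ->
  {subset nd1.1 <= nd2.1} \/ {subset nd2.1 <= nd1.1}.

Record wf (s : seq node) : Prop := Wf {
  wf_sub1 : forall nd, nd \in s -> subseq nd.1 VL;
  wf_sub2 : forall nd, nd \in s -> subseq nd.2 PL;
  wf_ne : forall nd, nd \in s -> nd.1 <> [::];
  wf_uniq : uniq [seq nd.1 | nd <- s];
  wf_lam : laminar s;
  wf_single : forall nd a, nd \in s -> a \in nd.1 -> [:: a] \in [seq nd.1 | nd <- s]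
}.

(** In a laminar family, two members of the same size with a common element are equal. A nonempty
    member is therefore determined by one of its elements, here the head of the list, and by its
    size. *)
Lemma size_wf s : wf s -> size s <= size VL * size VL.
Proof.
move=> w; rewrite -(size_map (fun nd => nd.1)).
case eVL : VL => [|v0 VL'].
  case: s w => // nd s w; have := wf_ne w (mem_head _ _).
  by have := wf_sub1 w (mem_head _ _); rewrite eVL subseq0 => /eqP.
pose f (D : seq V) := (head v0 D, size D).
have inD D : D \in [seq nd.1 | nd <- s] -> [/\ subseq D VL, D <> [::] & head v0 D \in D].
  move=> /mapP[nd nds ->]; split; [exact: (wf_sub1 w) | exact: (wf_ne w) |].
  by have := wf_ne w nds; case: nd.1 => //= a l _; exact: mem_head.
have inj : {in [seq nd.1 | nd <- s] &, injective f}.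
  move=> D1 D2 in1 in2 [e1 e2].
  have [s1 n1 h1] := inD _ in1; have [s2 n2 h2] := inD _ in2.
  have u1 := subseq_uniq s1 VLu; have u2 := subseq_uniq s2 VLu.
  case/mapP: (in1) => nd1 nds1 E1; case/mapP: (in2) => nd2 nds2 E2.
  have := wf_lam w nds1 nds2; rewrite -E1 -E2 => -[|sub|sub].
  - by exists (head v0 D1) => //; rewrite e1.
  - by apply: canon => //; apply: (uniq_min_size u1 sub _).2; rewrite e2.
  - by apply: canon => // a; rewrite ((uniq_min_size u2 sub _).2) ?e2.
rewrite -(size_map f) -eVL.
have -> : size VL * size VL = size (allpairs pair VL (iota 1 (size VL))).
  by rewrite size_allpairs size_iota.
apply: uniq_leq_size; first by rewrite map_inj_in_uniq ?(wf_uniq w).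
move=> _ /mapP[D Ds ->]; have [sD nD hD] := inD _ Ds.
apply/allpairsP; exists (f D); split=> //; first exact: (mem_subseq sD).
by rewrite mem_iota add1n ltnS size_subseq // andbT lt0n size_eq0; exact/eqP.
Qed.

Lemma reset1 nd : (reset nd).1 = nd.1.
Proof. by rewrite /reset; case: ifP. Qed.

Lemma next_nodes sg q : [seq nd.1 | nd <- (next sg q).2] =
  [seq nd.1 | nd <- kept (prefs (advance sg q.2))] ++
  [seq [:: a] | a <- live (kept (prefs (advance sg q.2))) &
                [:: a] \notin [seq nd.1 | nd <- kept (prefs (advance sg q.2))]].
Proof.
rewrite map_cat -!map_comp; congr (_ ++ _).
by apply: eq_map => nd; rewrite /= reset1.
Qed.

Lemma subseq1 a : a \in VL -> subseq [:: a] VL.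
Proof. by rewrite sub1seq. Qed.

Lemma nextP sg q nd : nd \in (next sg q).2 ->
  (exists2 nd', nd' \in q.2 & nd = reset (img sg nd'.1, mimg sg nd'.2) /\ img sg nd'.1 <> [::])
  \/ (exists2 a, nd = fresh1 a & exists2 nd', nd' \in q.2 & a \in img sg nd'.1).
Proof.
rewrite mem_cat => /orP[/mapP[nd1 /kept_img[nd' h [-> h2]] ->]|]; first by left; exists nd'.
move=> /mapP[a]; rewrite !mem_filter => /and3P[_ /hasP[nd1 /kept_img[nd' h [-> h2]] ha] _] ->.
by right; exists a => //; exists nd'.
Qed.

Lemma wf_next sg q : wf q.2 -> wf (next sg q).2.
Proof.
move=> w.
split.
- move=> nd /nextP[[nd' _ [-> _]]|[a -> [nd' _ /mem_img[aV _]]]].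
    by rewrite reset1; exact: filter_subseq.
  exact: subseq1.
- move=> nd /nextP[[nd' _ [-> _]]|[a -> _]]; last exact: filter_subseq.
  by rewrite /reset; case: ifP => _; exact: filter_subseq.
- by move=> nd /nextP[[nd' _ [-> h]]|[a -> _]] //; rewrite reset1.
- rewrite next_nodes cat_uniq kept_uniq map_inj_uniq ?filter_uniq // ?andbT; last by move=> ? ? [].
  by apply/hasPn => _ /mapP[a + ->]; rewrite mem_filter => /andP[].
- have single a D : {subset [:: a] <= D} <-> a \in D.
    split=> [sub|aD b]; first by apply: sub; exact: mem_head.
    by rewrite inE => /eqP->.
  move=> nd1 nd2 /nextP[[n1 h1 [-> _]]|[a -> [n1 h1 i1]]] /nextP[[n2 h2 [-> _]]|[a' -> [n2 h2 i2]]];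
    rewrite ?reset1 => -[b b1 b2] /=.
  + case/mem_img: b1 => bV [c1 c1n s1]; case/mem_img: b2 => _ [c2 c2n s2].
    (* Backward determinism enters here: the two predecessors of the common element coincide, hence
       the old sets already intersect and one contains the other. *)
    have e : c1 = c2.
      by apply: back s1 s2 => //; [apply: (mem_subseq (wf_sub1 w h1)) | apply: (mem_subseq (wf_sub1 w h2))].
    have mono D1 D2 : {subset D1 <= D2} -> {subset img sg D1 <= img sg D2}.
      move=> sub d /mem_img[dV [c cD sc]]; apply/mem_img; split=> //.
      by exists c => //; exact: sub.
    case: (wf_lam w h1 h2); first by exists c1; rewrite // e.
      by left; exact: mono.
    by right; exact: mono.
  + by right; apply/single; move: b2; rewrite inE => /eqP <-.
  + by left; apply/single; move: b1; rewrite inE => /eqP <-.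
  + by left; apply/single; move: b1 b2; rewrite !inE => /eqP <-.
- move=> nd a nds and_; set ks := kept (prefs (advance sg q.2)).
  rewrite next_nodes mem_cat -/ks; case: (boolP ([:: a] \in _)) => //= no.
  apply: map_f; rewrite mem_filter no /=.
  move: nds; rewrite mem_cat -/ks => /orP[/mapP[nd1 nd1k e]|/mapP[b]].
    rewrite e reset1 in and_; rewrite mem_filter; apply/andP; split.
      by apply/hasP; exists nd1.
    by case/kept_img: nd1k and_ => nd' _ [-> _] /mem_img[].
  by rewrite mem_filter => /andP[_ bl] e; move: and_; rewrite e inE => /eqP->.
Qed.

Lemma wf_start I : subseq I VL -> wf (start I).2.
Proof.
move=> sI; split=> //=.
- by move=> nd /mapP[a aI ->]; apply: subseq1; exact: (mem_subseq sI).
- by move=> nd /mapP[a aI ->]; exact: filter_subseq.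
- by move=> nd /mapP[a aI ->].
- by rewrite -map_comp map_inj_uniq ?(subseq_uniq sI) // => ? ? [].
- move=> nd1 nd2 /mapP[a1 _ ->] /mapP[a2 _ ->] [b] /=; rewrite !inE => /eqP-> /eqP->.
  by left.
- move=> nd a /mapP[b bI ->]; rewrite inE => /eqP->.
  by apply/mapP; exists (fresh1 b) => //; exact: map_f.
Qed.

Lemma wf_run I w t : subseq I VL -> wf (run I w t).2.
Proof. by move=> sI; elim: t => [|t IH]; [exact: wf_start | exact: wf_next]. Qed.

(** * Correctness of the determinization *)

Section Correct.
Variables (UL : seq U) (I : seq V) (w : nat -> Sig).
Hypothesis PLE : forall a u, ((a, u) \in PL) = (a \in VL) && (u \in UL).
Hypothesis IV : subseq I VL.
Hypothesis K_ge : size VL * size VL <= K.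

Let s t := (run I w t).2.
Let col t := (run I w t).1.
Let e t := event (prefs (advance (w t) (s t))).

Definition branch (b : nat -> V) :=
  [/\ b 0 \in I, forall t, b t \in VL & forall t, step (b t) (w t) (b t.+1)].
Definition fair (b : nat -> V) :=
  forall u, u \in UL -> forall t, exists2 t', t <= t' & ful u (b t').

Let ws t : wf (s t) := wf_run w t IV.
Let szs t : size (s t) <= K := leq_trans (size_wf (ws t)) K_ge.
Let colS t : col t.+1 = hue (e t). Proof. by []. Qed.

Lemma mem_full D a u : (a, u) \in full D = [&& a \in D, a \in VL & u \in UL].
Proof. by rewrite mem_filter PLE. Qed.

Lemma stable_step t i : i < size (s t) -> (forall j, j <= i -> ~~ deaths (w t) (s t) j) ->
  i < size (s t.+1) /\
  nth nd0 (s t.+1) i = reset (img (w t) (nth nd0 (s t) i).1, mimg (w t) (nth nd0 (s t) i).2).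
Proof.
move=> lt al; have [p [h1 h2 h3 h4]] := @track_alive (w t) (run I w t) i lt (al i (leqnn i)).
have e1 : p = i by apply/h4 => j /ltnW; exact: al.
by rewrite -nth_advance // -h3 e1 in h2 *.
Qed.

(** Serves to prolong back to time 0 a branch found from some time on. *)
Lemma history t nd a : nd \in s t -> a \in nd.1 -> exists h : nat -> V,
  [/\ h 0 \in I, h t = a, forall j, j <= t -> h j \in VL &
      forall j, j < t -> step (h j) (w j) (h j.+1)].
Proof.
elim: t nd a => [|t IH] nd a.
  move=> /mapP[c cI ->]; rewrite inE => /eqP->; exists (fun=> c); split=> // j _.
  exact: (mem_subseq IV).
move=> nds aD; have [nd' [nd's]] : exists nd', nd' \in s t /\ a \in img (w t) nd'.1.
  case: (nextP nds) => [[nd' h [E _]]|[c E [nd' h hc]]]; exists nd'; split=> //.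
    by move: aD; rewrite E reset1.
  by move: aD; rewrite E inE => /eqP->.
move=> /mem_img[aV [c cD sc]]; have [h [h1 h2 h3 h4]] := IH _ _ nd's cD.
exists (fun j => if j == t.+1 then a else h j); split=> //; first by rewrite eqxx.
  by move=> j; rewrite leq_eqVlt; case: eqP => //= _; rewrite ltnS; exact: h3.
move=> j; rewrite ltnS leq_eqVlt => /orP[/eqP->|lt].
  by rewrite eqxx h2 ltn_eqF.
by rewrite !ltn_eqF ?h4 // ltnS // ltnW.
Qed.

Lemma hue_odd d : odd (hue d) = d.2.
Proof. by rewrite /hue !oddD addbb; case: d.2. Qed.

(** The recurring maximum [m] designates the position [i = K - m./2]. Ultimately nothing dies at or
    before [i], so that one node stays there forever and signals infinitely often. König's lemma
    gives an infinite branch through its sets. An eventuality unfulfilled from some time on would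
    remain pending after the reset that follows a signal, and so prevent every later signal. *)
Lemma det_sound : parity_ok col -> exists2 b, branch b & fair b.
Proof.
move=> [m [m_even inf [t0 bnd]]]; pose i := K - m./2.
have hue_m t : col t.+1 = m -> (e t).2 = false /\ (e t).1 = i.
  rewrite colS => E; have E2 : (e t).2 = false by apply: negbTE; rewrite -hue_odd E.
  split=> //; have [h _ _] := eventP (w t) (s t); have := leq_trans h (szs t).
  rewrite -/(e t) => le; move: E; rewrite /hue E2 /i => <-.
  by rewrite addn0 addnn doubleK; lia.
have le_i : i <= K by exact: leq_subr.
have lt_m : m = (K - i) + (K - i).
  (* Time 0 is avoided, as the color of the initial state comes from no event. *)
  have [t lt E] := inf 1; case: t lt E => // t _ E; have [h1 h2] := hue_m _ E.
  by rewrite -E colS /hue h1 h2 addn0.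
have stab t : t0 <= t -> i < size (s t) /\ forall j, j <= i -> ~~ deaths (w t) (s t) j.
  move=> le_t; have := bnd t.+1 (leqW le_t); rewrite colS /hue lt_m.
  have [h1 h2 h3] := eventP (w t) (s t); rewrite -/(e t) in h1 h2 h3 *.
  have hK := leq_trans h1 (szs t).
  case E2: (e t).2 h3 => h3 le.
    have lt : i < (e t).1 by lia.
    by split=> [|j ji]; [exact: leq_trans h1 | exact: (h2 j (leq_ltn_trans ji lt)).1].
  have {}le : i <= (e t).1 by lia.
  case: h3 => h3 h4 _; split; first exact: leq_ltn_trans h3.
  move=> j ji; have := leq_trans ji le; rewrite leq_eqVlt => /orP[/eqP->//|lt].
  exact: (h2 j lt).1.
have flash_inf t : exists2 t', t <= t' & flash (w t') (s t') i.
  have [t' lt E] := inf t.+1; case: t' lt E => // t' lt E; exists t' => //.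
  have [h1 h2] := hue_m _ E; have [_ _] := eventP (w t') (s t'); rewrite -/(e t') h1 h2.
  by case.
pose X t := (nth nd0 (s t) i).1; pose M t := (nth nd0 (s t) i).2.
have XM t : t0 <= t -> (X t.+1, M t.+1) = reset (img (w t) (X t), mimg (w t) (M t)).
  move=> le; have [h1 h2] := stab _ le; have [_ E] := stable_step h1 h2.
  by rewrite /X /M E; case: reset.
have X1 t : t0 <= t -> X t.+1 = img (w t) (X t).
  by move=> /XM/(congr1 fst)/= ->; rewrite reset1.
have [] := @koenig _ VL (fun t a => a \in X (t0 + t)) (fun t a a' => step a (w (t0 + t)) a').
- move=> t a; apply: mem_subseq; apply: (wf_sub1 (ws _)).
  by apply: mem_nth; exact: (stab _ (leq_addr _ _)).1.
- move=> t; have := wf_ne (ws (t0 + t)) (mem_nth nd0 (stab _ (leq_addr t t0)).1).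
  by rewrite -/(X _); case: (X _) => // a l _; exists a; exact: mem_head.
- by move=> t a'; rewrite addnS X1 ?leq_addr // => /mem_img[_ [a aX sa]]; exists a.
move=> c [cX cs].
have [h [h1 h2 h3 h4]] := history (mem_nth nd0 (stab _ (leqnn t0)).1) (etrans (congr1 (fun t => c 0 \in X t) (esym (addn0 t0))) (cX 0)).
pose b t := if t < t0 then h t else c (t - t0).
have bt t : t0 <= t -> b t = c (t - t0) by rewrite /b ltnNge => ->.
have bX t : t0 <= t -> b t \in X t by move=> le; rewrite bt //; have := cX (t - t0); rewrite subnKC.
have bV t : b t \in VL.
  case: (ltnP t t0) => lt; first by rewrite /b lt h3 // ltnW.
  by apply: (mem_subseq (wf_sub1 (ws t) _) (bX _ lt)); apply: mem_nth; exact: (stab _ lt).1.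
have bs t : step (b t) (w t) (b t.+1).
  case: (ltngtP t.+1 t0) => lt.
  - by rewrite /b lt ltnW //; apply: h4; exact: ltnW.
  - by rewrite !bt ?(leqW) //; rewrite subSn //; have := cs (t - t0); rewrite subnKC.
  - by rewrite /b lt ltnn subnn -h2 -lt ltnSn; apply: h4; rewrite -lt.
exists b.
  split=> //; rewrite /b; case: ltnP => // le; have e0 : t0 = 0 by lia.
  by rewrite e0 subn0 -h2 e0.
move=> u uU t; apply: contrapT => no.
have nful t' : t <= t' -> ~~ ful u (b t').
  by move=> le; apply/negP => f; apply: no; exists t'.
have [t1 le1 f1] := flash_inf (maxn t t0); move: le1; rewrite geq_max => /andP[tt1 t01].
(* The reset after the signal at [t1] makes [u] pending for all current descendants, and [b]
   transmits it from step to step. *)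
have pend n : (b (t1 + n).+1, u) \in M (t1 + n).+1.
  elim: n => [|n IH].
    rewrite addn0; have /(congr1 snd) /= -> := XM _ t01; rewrite /reset.
    move: f1; rewrite /flash -/(M t1) => /= ->.
    rewrite /= mem_full bV uU !andbT -X1 //; apply: bX; exact: leqW.
  have le_n : t0 <= (t1 + n).+1 by lia.
  rewrite addnS; have /(congr1 snd) /= -> := XM _ le_n; rewrite /reset.
  have inM : (b (t1 + n).+2, u) \in mimg (w (t1 + n).+1) (M (t1 + n).+1).
    rewrite mem_filter PLE bV uU nful /= ?andbT; last by lia.
    by apply/hasP; exists (b (t1 + n).+1, u) => //=; rewrite eqxx bs.
  by case: eqP => //= E; rewrite E in inM.
have [t2 le2 f2] := flash_inf t1.+1.
have := pend (t2 - t1.+1); have -> : (t1 + (t2 - t1.+1)).+1 = t2 by lia.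
move=> inM; suff : (b t2.+1, u) \in mimg (w t2) (M t2).
  by move: f2; rewrite /flash -/(M t2) => /eqP->.
rewrite mem_filter PLE bV uU nful /= ?andbT; last by lia.
by apply/hasP; exists (b t2, u) => //=; rewrite eqxx bs.
Qed.

Definition infinite_from t a :=
  exists c : nat -> V, c 0 = a /\ forall j, c j \in VL /\ step (c j) (w (t + j)) (c j.+1).
Definition survivors t := [seq a <- VL | `[< infinite_from t a >]].

Lemma survivor_succ t a : a \in survivors t ->
  exists2 a', a' \in survivors t.+1 & step a (w t) a'.
Proof.
rewrite mem_filter => /andP[/asboolP[c [c0 hc]] aV]; exists (c 1); last first.
  by have := (hc 0).2; rewrite addn0 c0.
rewrite mem_filter (hc 1).1 andbT; apply/asboolP; exists (fun j => c j.+1); split=> // j.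
by have := hc j.+1; rewrite addnS -addSn.
Qed.

Lemma survivors_uniq t : uniq (survivors t). Proof. exact: filter_uniq. Qed.

Lemma survivorV t a : a \in survivors t -> a \in VL.
Proof. by rewrite mem_filter => /andP[]. Qed.

(** A choice of surviving successors is injective by backward determinism, so the number of
    survivors does not decrease. If it stays the same, the choice is a bijection, and no survivor
    has two surviving successors. *)
Lemma survivors_step t :
  size (survivors t) <= size (survivors t.+1) /\
  (size (survivors t) = size (survivors t.+1) -> forall a a1 a2,
     a \in VL -> a1 \in survivors t.+1 -> a2 \in survivors t.+1 ->
     step a (w t) a1 -> step a (w t) a2 -> a1 = a2).
Proof.
have [f hf] : exists f : V -> V, forall a, a \in survivors t ->
    f a \in survivors t.+1 /\ step a (w t) (f a).
  have h a : exists a', a \in survivors t -> a' \in survivors t.+1 /\ step a (w t) a'.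
    case: (boolP (a \in survivors t)) => [/survivor_succ[a' ? ?]|_]; first by exists a'.
    by exists a.
  by exists (fun a => sval (cid (h a))) => a; exact: (svalP (cid (h a))).
have inj : {in survivors t &, injective f}.
  move=> a a' ia ia' E; have [f1 s1] := hf _ ia; have [_ s2] := hf _ ia'.
  by apply: back s1 _; rewrite ?E //; [exact: survivorV ia|exact: survivorV ia'|rewrite -E; exact: survivorV f1].
have um : uniq (map f (survivors t)) by rewrite map_inj_in_uniq // survivors_uniq.
have sub : {subset map f (survivors t) <= survivors t.+1}.
  by move=> _ /mapP[a ia ->]; exact: (hf _ ia).1.
split; first by rewrite -(size_map f); exact: uniq_leq_size.
move=> E a a1 a2 aV i1 i2 s1 s2.
have [_ Em] : (size (survivors t.+1) <= size (map f (survivors t))) * (map f (survivors t) =i survivors t.+1).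
  by split; [rewrite size_map E | apply: (uniq_min_size um sub _).2; rewrite size_map E].
have key a' : a' \in survivors t.+1 -> step a (w t) a' -> a' = f a.
  rewrite -Em => /mapP[x ix ->] sx; have [f1 s3] := hf _ ix.
  by congr f; apply: back s3 sx => //; [exact: survivorV ix | exact: survivorV f1].
by rewrite (key a1) // (key a2).
Qed.

(** The number of survivors is bounded by the size of [VL], hence eventually constant; from then on
    infinite branches do not fork. *)
Lemma survivors_stable : exists t0, forall t, t0 <= t ->
  forall a a1 a2, a \in VL -> a1 \in survivors t.+1 -> a2 \in survivors t.+1 ->
     step a (w t) a1 -> step a (w t) a2 -> a1 = a2.
Proof.
have le t : size (survivors t) <= size VL by rewrite size_filter count_size.
have [|t0 _ ht] := @eventually_constant (fun t => size VL - size (survivors t)) 0.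
  by move=> t _; rewrite leq_sub2l // (survivors_step t).1.
exists t0 => t le_t; apply: (survivors_step t).2.
by have := ht t le_t; have := ht t.+1 (leqW le_t); have := le t; have := le t.+1; lia.
Qed.

(** After the last fork, the singleton of [b t0] is the set of some node, by [wf_single]. The sets
    [X n] of its descendants move to older positions until they settle at some [i], and [b] is the
    only infinite branch through them. If signals at [i] ceased, König's lemma applied to the
    pending pairs would give an infinite branch with an eventuality that is never fulfilled; this
    branch is [b], which contradicts fairness. *)
Lemma det_complete b : branch b -> fair b -> parity_ok col.
Proof.
move=> [b0 bV bs] bf.
have [t0 ht0] := survivors_stable.
have binf t : b t \in survivors t.
  rewrite mem_filter bV andbT; apply/asboolP; exists (fun j => b (t + j)); split; first by rewrite addn0.
  by move=> j; rewrite addnS.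
pose X := fix X n := if n is n'.+1 then img (w (t0 + n')) (X n') else [:: b t0].
have bX n : b (t0 + n) \in X n.
  elim: n => [|n IH] /=; first by rewrite addn0 mem_head.
  by apply/mem_img; split=> //; exists (b (t0 + n)) => //; rewrite addnS.
have Xne n : X n <> [::] by move=> E; have := bX n; rewrite E.
have bD t : exists2 nd, nd \in s t & b t \in nd.1.
  elim: t => [|t [nd nds bnd]].
    by exists (fresh1 (b 0)); [exact: map_f | exact: mem_head].
  have bi : b t.+1 \in img (w t) nd.1 by apply/mem_img; split=> //; exists (b t).
  have lt : index nd (s t) < size (s t) by rewrite index_mem.
  have [|p [h1 h2 h3 _]] := @track_node (w t) (run I w t) _ lt.
    by rewrite nth_index // => E; rewrite E in bi.
  exists (nth nd0 (s t.+1) p); first exact: mem_nth.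
  by rewrite h3 nth_index.
have Xs n : X n \in [seq nd.1 | nd <- s (t0 + n)].
  elim: n => [|n IH] /=.
    by rewrite addn0; have [nd nds h] := bD t0; apply: (wf_single (ws t0)) nds h.
  case/mapP: IH => nd nds E.
  have lt : index nd (s (t0 + n)) < size (s (t0 + n)) by rewrite index_mem.
  have [|p [h1 h2 h3 _]] := @track_node (w (t0 + n)) (run I w (t0 + n)) _ lt.
    by rewrite nth_index // -E; exact: (Xne n.+1).
  by rewrite addnS; apply/mapP; exists (nth nd0 (s (t0 + n).+1) p); [exact: mem_nth | rewrite h3 nth_index // -E].
pose p n := index (X n) [seq nd.1 | nd <- s (t0 + n)].
have p_lt n : p n < size (s (t0 + n)) by rewrite -(size_map (fun nd => nd.1)) index_mem.
have p_nth n : (nth nd0 (s (t0 + n)) (p n)).1 = X n.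
  by rewrite -(nth_map nd0 [::] (fun nd => nd.1)) // nth_index.
have p_next n : p n.+1 <= p n /\ (p n.+1 = p n -> forall j, j <= p n -> ~~ deaths (w (t0 + n)) (s (t0 + n)) j).
  have [|q [h1 h2 h3 h4]] := @track_node (w (t0 + n)) (run I w (t0 + n)) _ (p_lt n).
    by rewrite p_nth; exact: (Xne n.+1).
  suff -> : p n.+1 = q by split.
  rewrite /p addnS; have -> : X n.+1 = nth [::] [seq nd.1 | nd <- s (t0 + n).+1] q.
    by rewrite (nth_map nd0) // h3 p_nth.
  by rewrite index_uniq ?size_map // (wf_uniq (ws _)).
have [n0 _ hn0] := @eventually_constant p 0 (fun n _ => (p_next n).1).
pose i := p n0; have alive n : n0 <= n -> forall j, j <= i -> ~~ deaths (w (t0 + n)) (s (t0 + n)) j.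
  move=> le; have e1 := hn0 n le; have e2 := hn0 n.+1 (leqW le).
  by have := (p_next n).2; rewrite e1 e2; exact.
have i_lt n : n0 <= n -> i < size (s (t0 + n)) by move=> le; rewrite /i -(hn0 n le).
have i_nth n : n0 <= n -> (nth nd0 (s (t0 + n)) i).1 = X n by move=> le; rewrite /i -(hn0 n le).
pose M n := (nth nd0 (s (t0 + n)) i).2.
have MS n : n0 <= n -> M n.+1 = (reset (X n.+1, mimg (w (t0 + n)) (M n))).2.
  move=> le; have [_ E] := stable_step (i_lt n le) (alive n le).
  by rewrite /M addnS E i_nth.
(* Another infinite branch through the sets [X n] would have forked from [b] after [t0]. *)
have only n c : c \in X n -> c \in survivors (t0 + n) -> c = b (t0 + n).
  elim: n c => [|n IH] c; first by rewrite inE addn0 => /eqP.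
  move=> /= /mem_img[cV [a aX sa]]; rewrite addnS => ci.
  have ai : a \in survivors (t0 + n).
    have aV : a \in VL.
      by case/mapP: (Xs n) => nd nds E; apply: (mem_subseq (wf_sub1 (ws _) nds)); rewrite -E.
    rewrite mem_filter aV andbT; apply/asboolP.
    move: ci; rewrite mem_filter => /andP[/asboolP[f [f0 hf]] _].
    exists (fun j => if j is j'.+1 then f j' else a); split=> // -[|j].
      by rewrite addn0 f0.
    by rewrite addnS -addSn.
  have ea := IH _ aX ai; rewrite ea in sa.
  exact: (ht0 (t0 + n) (leq_addr _ _) (b (t0 + n)) c (b (t0 + n).+1)).
have flash_inf n : n0 <= n -> exists2 n', n <= n' & flash (w (t0 + n')) (s (t0 + n')) i.
  move=> le; apply: contrapT => no.
  have nf k : M (n + k).+1 = mimg (w (t0 + (n + k))) (M (n + k)) /\ M (n + k).+1 <> [::].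
    have lek : n0 <= n + k by lia.
    have nf : ~~ (mimg (w (t0 + (n + k))) (M (n + k)) == [::]).
      by apply/negP => f; apply: no; exists (n + k) => //; exact: leq_addr.
    have E : M (n + k).+1 = mimg (w (t0 + (n + k))) (M (n + k)).
      by rewrite MS // /reset /= (negbTE nf).
    by split=> //; rewrite E; exact/eqP.
  have [] := @koenig _ PL (fun k x => x \in M (n + k).+1) (fun k x y =>
        [/\ x.2 = y.2, step x.1 (w (t0 + (n + k).+1)) y.1 & ~~ ful y.2 y.1]).
  - by move=> k x; rewrite (nf k).1 mem_filter => /andP[].
  - by move=> k; have := (nf k).2; case: (M _) => // x l _; exists x; exact: mem_head.
  - move=> k y; have := (nf k.+1).1; rewrite addnS => ->; rewrite mem_filter.
    move=> /andP[/andP[/hasP[x xM /andP[/eqP exy sx]] nfy] _].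
    by exists x.
  move=> c [cM cR].
  have u_const k : (c k).2 = (c 0).2 by elim: k => // k <-; have [-> _ _] := cR k.
  have cV k : (c k).1 \in VL /\ (c k).2 \in UL.
    have := cM k; rewrite (nf k).1 mem_filter => /andP[_].
    by case: (c k) => a u; rewrite PLE => /andP.
  have cX0 k : (c k).1 \in X (n + k).+1.
    have := cM k; have lek : n0 <= n + k by lia.
    have inv : forall t nd, nd \in s t -> forall x, x \in nd.2 -> x.1 \in nd.1.
      elim=> [|t IH] nd.
        by move=> /mapP[a _ ->] x; rewrite /= mem_filter => /andP[].
      move=> /nextP[[nd' nds [-> _]]|[a -> _]] x; last by rewrite mem_filter => /andP[].
      rewrite reset1 /reset /=; case: ifP => _ /=; first by rewrite mem_filter => /andP[].
      rewrite mem_filter => /andP[/andP[/hasP[y yM /andP[_ sy]] _] xP].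
      apply/mem_img; split; last by exists y.1 => //; exact: IH yM.
      by move: xP; case: (x) => a u; rewrite PLE => /andP[].
    have lek1 : n0 <= (n + k).+1 by exact: leqW.
    by move/(inv _ _ (mem_nth nd0 (i_lt _ lek1))); rewrite i_nth.
  have csurv k : (c k).1 \in survivors (t0 + (n + k).+1).
    rewrite mem_filter (cV k).1 andbT; apply/asboolP; exists (fun j => (c (k + j)).1).
    split; first by rewrite addn0.
    move=> j; split; first exact: (cV _).1.
    have [_ + _] := cR (k + j); rewrite [k + j.+1]addnS.
    by have -> : t0 + (n + (k + j)).+1 = t0 + (n + k).+1 + j by lia.
  have cb k : (c k).1 = b (t0 + (n + k).+1) by exact: only.
  have [t le_t f] := bf _ (cV 0).2 (t0 + n.+2).
  have [_ _] := cR (t - (t0 + n.+2)); rewrite cb u_const.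
  have -> : t0 + (n + (t - (t0 + n.+2)).+1).+1 = t by lia.
  by rewrite f.
have [|m inf [k0 hk0]] := @max_infinitely_often col (K + K + 1).
  by exists 0 => -[|t] _ //; rewrite colS /hue; case: (e t).2; lia.
exists m; split=> //; last by exists k0.
(* An odd color that recurs comes from an event beyond position [i], hence is smaller than the
   colors emitted when node [i] signals, which are at least [2 * (K - i)]. *)
apply/negP => m_odd.
have [n1 le1 f1] := flash_inf (maxn n0 k0) (leq_maxl _ _).
have le01 : n0 <= n1 by lia.
have := hk0 (t0 + n1).+1 ltac:(lia); rewrite colS.
have [h1 h2 h3] := eventP (w (t0 + n1)) (s (t0 + n1)); rewrite -/(e _) in h1 h2 h3 *.
have le_e1 : (e (t0 + n1)).1 <= i.
  by rewrite leqNgt; apply/negP => lt; have [_] := h2 _ lt; rewrite f1.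
have [t lt E] := inf (t0 + n0).+1; case: t lt E => // t lt E.
move: E; rewrite colS => E.
have E2 : (e t).2 by rewrite -hue_odd E.
have [g1 g2 g3] := eventP (w t) (s t); rewrite -/(e t) E2 in g1 g2 g3.
have [n2 le2 en2] : exists2 n2, n0 <= n2 & t = t0 + n2 by exists (t - t0); lia.
have lt_ie : i < (e t).1.
  rewrite ltnNge; apply/negP => le; have lt_s : (e t).1 < size (s t).
    by apply: leq_ltn_trans le _; rewrite en2 i_lt.
  by have := alive n2 le2 _ le; rewrite -en2 g3.
have := szs t; rewrite -E /hue E2; case: (e (t0 + n1)).2; lia.
Qed.
End Correct.
End Det.

(** * From deterministic automata to game automata *)

Lemma parity_ok_shift (u : nat -> nat) k : parity_ok u <-> parity_ok (fun i => u (k + i)).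
Proof.
split=> -[m [h1 h2 [i h3]]]; exists m; split=> //.
- move=> j; have [l le E] := h2 (k + j); exists (l - k); first lia.
  by rewrite subnKC //; lia.
- by exists i => j le; apply: h3; lia.
- by move=> j; have [l le E] := h2 j; exists (k + l) => //; lia.
- exists (k + i) => j le; have -> : j = k + (j - k) by lia.
  by apply: h3; lia.
Qed.

Lemma parity_ok_ext (u v : nat -> nat) : u =1 v -> parity_ok u -> parity_ok v.
Proof.
move=> uv [m [h1 h2 [i h3]]]; exists m; split=> //.
  by move=> j; have [l le E] := h2 j; exists l => //; rewrite -uv.
by exists i => j /h3; rewrite uv.
Qed.

Section Moves.
Context (Ag Ac P : finType) (N : cgs Ag Ac P).

(* For pol = true the choices of A are decisions, for pol = false they are
   responses of the other agents to the decisions of A. *)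
Definition choice_of (pol : bool) (A : {set Ag}) : Type :=
  match pol return Type with true => adec Ac A | false => adec Ac A -> adec Ac (~: A) end.

Definition legal pol A (nu : N) : choice_of pol A -> Prop :=
  match pol return choice_of pol A -> Prop with
  | true => fun dA => available nu dA
  | false => fun g => forall dA, available nu dA -> trans nu (djoin dA (g dA)) <> None
  end.

Definition leads pol A (nu : N) : choice_of pol A -> N -> Prop :=
  match pol return choice_of pol A -> N -> Prop with
  | true => fun dA nu' => succ_by nu dA nu'
  | false => fun g nu' => exists2 dA, available nu dA & trans nu (djoin dA (g dA)) = Some nu'
  end.

Definition forces (pol : bool) A (nu : N) (L : N -> Prop) : Prop :=
  if pol then exists2 dB : adec Ac A, available nu dB & forall nu', succ_by nu dB nu' -> L nu'
  else forall dB : adec Ac A, available nu dB -> exists2 nu', succ_by nu dB nu' & L nu'.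

Lemma forcesP pol A nu L : forces pol A nu L <->
  exists2 c : choice_of pol A, legal nu c & forall nu', leads nu c nu' -> L nu'.
Proof.
case: pol => //=; split=> [h|[g lg hg] dA av].
  have hc (dA : adec Ac A) : exists d, available nu dA ->
      exists2 nu', trans nu (djoin dA d) = Some nu' & L nu'.
    case: (EM (available nu dA)) => [av|no].
      by have [nu' [d E] Ln] := h dA av; exists d => _; exists nu'.
    have [d _] := @trans_total _ _ _ N nu.
    by exists [ffun x : {a : Ag | a \in ~: A} => d (val x)].
  exists (fun dA => sval (cid (hc dA))).
    by move=> dA av /=; have [nu' -> _] := svalP (cid (hc dA)) av.
  move=> nu' [dA av /= E]; have [nu2 + L2] := svalP (cid (hc dA)) av.
  by rewrite E => -[->].
case E : (trans nu (djoin dA (g dA))) (lg _ av) => [nu'|//] _.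
by exists nu'; [exists (g dA) | apply: hg; exists dA].
Qed.

Lemma djoin_surj A (d : decision Ag Ac) :
  exists dA : adec Ac A, exists dB : adec Ac (~: A), djoin dA dB = d.
Proof.
exists [ffun x : {a : Ag | a \in A} => d (val x)].
exists [ffun x : {a : Ag | a \in ~: A} => d (val x)].
apply/ffunP => a; rewrite [LHS]ffunE.
by case: {-}_ / boolP => h; rewrite ffunE.
Qed.

Lemma legal_ex pol A (nu : N) : exists c : choice_of pol A, legal nu c.
Proof.
have : forces pol A nu (fun=> True).
  case: pol => /=.
    have [d E] := @trans_total _ _ _ N nu.
    have [dA [dB e]] := djoin_surj A d.
    by exists dA => //; exists dB; rewrite e.
  move=> dA [d]; case E: (trans _ _) => [nu'|//] _.
  by exists nu' => //; exists d.
by move=> /forcesP[c h _]; exists c.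
Qed.

Lemma leads_trans pol A (nu : N) (c : choice_of pol A) nu' :
  leads nu c nu' -> exists d, trans nu d = Some nu'.
Proof. by case: pol c => c /= [d]; [|move=> _] => E; eexists; exact: E. Qed.

(* The empty coalition has a single decision, which every transition respects. *)
Lemma forces_all (nu : N) (L : N -> Prop) :
  forces true set0 nu L <-> forall nu', (exists d, trans nu d = Some nu') -> L nu'.
Proof.
have uniq0 (d1 d2 : adec Ac (set0 : {set Ag})) : d1 = d2.
  by apply/ffunP => -[a h]; exfalso; move: h; rewrite inE.
split=> [[dB av h] nu' [d E]|h].
  by have [dA [d' e]] := djoin_surj set0 d; apply: h; exists d'; rewrite (uniq0 dB dA) e.
have [c] := legal_ex true set0 nu; exists c => // nu' [d E].
by apply: h; eexists; exact: E.
Qed.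

Definition enforces pol A (nu : N) (W : (nat -> N) -> Prop) :=
  exists2 f : seq N -> choice_of pol A,
    forall pi i, is_play pi -> legal (pi i) (f (track pi i)) &
    forall pi : nat -> N, pi 0 = nu ->
      (forall i, leads (pi i) (f (track pi i)) (pi i.+1)) -> W pi.
End Moves.

(** Used for the minimality of the labels in a run. The elements of the list are deleted one by one
    as long as [ok] persists; by monotonicity, an element that cannot be deleted at its turn cannot
    be deleted later. The induction carries this alternative for every element. *)
Lemma minimal_subset (X : Type) (ok : (X -> Prop) -> Prop) (l : seq X) (L0 : X -> Prop) :
  (forall L L' : X -> Prop, (forall x, L x -> L' x) -> ok L -> ok L') ->
  (forall x, L0 x -> List.In x l) -> ok L0 ->
  exists L1 : X -> Prop, [/\ forall x, L1 x -> L0 x, ok L1 &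
    forall L' : X -> Prop, (forall x, L' x -> L1 x) -> ok L' -> forall x, L1 x -> L' x].
Proof.
move=> mono fin; pose del (L : X -> Prop) x := fun y => L y /\ y <> x.
have {fin} : forall x, L0 x -> List.In x l \/ ~ ok (del L0 x) by move=> x /fin; left.
elim: l L0 => [|x l IH] L0 fin okL.
  exists L0; split=> // L' sub ok' x Lx; apply: contrapT => nx.
  have [//|] := fin x Lx; apply; apply: mono ok' => y ly; split; first exact: sub.
  by move=> e; rewrite e in ly.
case: (EM (ok (del L0 x))) => okx; last first.
  apply: IH => // y /fin[[<-|]|]; [by right | by left | by right].
have [|L1 [h1 h2 h3]] := IH (del L0 x) _ okx.
  move=> y [Ly nyx]; have [[e|]|no] := fin y Ly; [by case: nyx | by left | right].
  by apply: contra_not no; apply: mono => z [[Lz _] nz].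
by exists L1; split=> // y /h1[].
Qed.

Lemma In_onth (X : Type) (s : seq X) x : List.In x s <-> exists n, onth s n = Some x.
Proof.
elim: s => [|y s IH] /=; first by split=> // -[[]].
split=> [[->|/IH[n e]]|[[|n] /= e]]; [by exists 0 | by exists n.+1 | by case: e; left | ].
by right; apply/IH; exists n.
Qed.

Lemma In_pmap (X : eqType) (Y : Type) (f : X -> option Y) s x y :
  f x = Some y -> x \in s -> List.In y (pmap f s).
Proof.
move=> e; elim: s => //= z s IH; rewrite inE => /orP[/eqP<-|/IH h]; first by rewrite e; left.
by case: (f z) => [y'|] //=; right.
Qed.

Lemma In_allpairs (X : eqType) (Y : Type) (s : seq X) (l : seq Y) x y :
  x \in s -> List.In y l -> List.In (x, y) [seq (x, y) | x <- s, y <- l].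
Proof.
move=> xs yl; elim: s xs => //= z s IH; rewrite inE => /orP[/eqP<-|/IH h].
  by apply/List.in_or_app; left; apply: List.in_map.
by apply/List.in_or_app; right.
Qed.

Section Plays.
Context (Ag Ac P : finType) (N : cgs Ag Ac P).

Lemma play_from (nu : N) : exists2 pi : nat -> N, is_play pi & pi 0 = nu.
Proof.
have [|pi [h0 _ h]] := @dependent_choice N (fun _ _ => True) (fun _ s s' => exists d, trans s d = Some s') nu I.
  move=> _ s _; have [d] := trans_total s; case E: (trans s d) => [s'|//] _.
  by exists s' => //; exists d.
by exists pi.
Qed.

Lemma play_extend (pi : nat -> N) i d nu :
  is_play pi -> trans (pi i) d = Some nu ->
  exists2 pi', is_play pi' & track pi' i = track pi i /\ pi' i.+1 = nu.
Proof.
move=> hpi E; have [rho hrho rho0] := play_from nu.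
exists (fun j => if j <= i then pi j else rho (j - i.+1)).
  move=> j; case: (ltngtP j i) => h.
  - by have [d' e] := hpi j; exists d'.
  - by rewrite subSn //; exact: hrho.
  - by exists d; rewrite h subnn rho0.
split; last by rewrite ltnn subnn.
by apply/eq_in_map => j; rewrite mem_iota add0n => /andP[_]; rewrite ltnS => ->.
Qed.
End Plays.

Lemma basics_strat (AP Ag : finType) (f g : form AP Ag) :
  g \in basics f -> exists A psi, g = FStrat A psi.
Proof.
elim: f => //= [h IH h' IH'|h IH h' IH'|A h IH].
- by rewrite mem_cat => /orP[].
- by rewrite mem_cat => /orP[].
- by rewrite inE => /orP[/eqP->|//]; exists A, h.
Qed.

(** * The game automaton built on deterministic automata *)

Section Automaton.
Context (AP Ag : finType) (Phi : form AP Ag) (S : finType).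
Variables (dstep : S -> {set props Phi} -> S) (dinit : basic Phi -> bool -> S) (dcol : S -> nat).
Variables (top : {set props Phi} -> bool) (bl : seq (basic Phi)).

Definition coal (f : form AP Ag) : {set Ag} := if f is FStrat A _ then A else set0.

(* None is the initial state, Some None is the state which visits all the
   nodes, and Some (Some (b, pol, s)) runs the deterministic automaton of b or
   of its negation. *)
Definition astate : finType := option (option (basic Phi * bool * S)).

Definition pol_of (q : astate) : bool := if q is Some (Some (_, pol, _)) then pol else true.
Definition coal_of (q : astate) : {set Ag} :=
  if q is Some (Some (b, _, _)) then coal (val b) else set0.
(** The modality and the coalition are determined by the target state, so there are no more moves
    than states. *)
Definition move_to (q : astate) : move Ag astate := (q, bool_modality (pol_of q), coal_of q).

(** The label of the current node is read at once: the children receive the state reached after the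
    first letter. *)
Definition launch (b : basic Phi) (sg : {set props Phi}) : astate :=
  Some (Some (b, inr b \in sg, dstep (dinit b (inr b \in sg)) sg)).
Definition visit (sg : {set props Phi}) : pbf (move Ag astate) :=
  foldr (fun b f => PAnd (PAtom (move_to (launch b sg))) f) (PAtom (move_to (Some None))) bl.
Definition adelta (q : astate) (sg : {set props Phi}) : pbf (move Ag astate) :=
  match q with
  | None => if top sg then visit sg else PFalse
  | Some None => visit sg
  | Some (Some (b, pol, s)) => PAtom (move_to (Some (Some (b, pol, dstep s sg))))
  end.
Definition acolor (q : astate) : nat := if q is Some (Some (_, _, s)) then dcol s else 0.
Definition automaton : acg (props Phi) Ag := @ACG _ _ astate None adelta acolor.

Lemma visit_atoms sg m :
  (m \in pbf_atoms (visit sg)) = (m == move_to (Some None)) || (m \in [seq move_to (launch b sg) | b <- bl]).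
Proof.
rewrite /visit; elim: bl => [|b l IH] /=; first by rewrite inE orbF.
by rewrite !inE IH orbCA.
Qed.

Lemma atoms_move_to q sg m : m \in pbf_atoms (adelta q sg) -> exists q', m = move_to q'.
Proof.
have vis : m \in pbf_atoms (visit sg) -> exists q', m = move_to q'.
  by rewrite visit_atoms => /orP[/eqP->|/mapP[b _ ->]]; eexists.
case: q => [[[[b pol] s]|]|] //=; last by case: ifP.
by rewrite inE => /eqP->; eexists.
Qed.

Lemma card_moves : #|acg_moves automaton| <= #|astate|.
Proof.
have sub : acg_moves automaton \subset [set move_to q | q : astate].
  apply/subsetP => m; rewrite inE => /existsP[q /existsP[sg]] /atoms_move_to[q' ->].
  by apply: imset_f.
by apply: leq_trans (subset_leq_card sub) _; rewrite leq_imset_card.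
Qed.

(* adelta only builds conjunctions. *)
Lemma adelta_sat (H : {set move Ag astate}) q sg : pbf_sat (fun m => m \in H) (adelta q sg) ->
  {subset pbf_atoms (adelta q sg) <= H}.
Proof.
have vis : pbf_sat (fun m => m \in H) (visit sg) -> {subset pbf_atoms (visit sg) <= H}.
  rewrite /visit; elim: bl => [|b l IH] /=; first by move=> h m; rewrite inE => /eqP->.
  by move=> /andP[h1 h2] m; rewrite inE => /orP[/eqP->//|]; exact: IH.
case: q => [[[[b pol] s]|]|] //=; last by case: ifP.
by move=> h m; rewrite inE => /eqP->.
Qed.

Lemma adelta_atoms q sg : (q == None) ==> top sg ->
  pbf_sat (fun m => m \in [set m in pbf_atoms (adelta q sg)]) (adelta q sg).
Proof.
have vis (F : {pred move Ag astate}) : {subset pbf_atoms (visit sg) <= F} -> pbf_sat F (visit sg).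
  rewrite /visit; elim: bl => [|b l IH] /= h; first by apply: h; rewrite inE.
  apply/andP; split; first by apply: h; rewrite inE eqxx.
  by apply: IH => m hm; apply: h; rewrite inE hm orbT.
case: q => [[[[b pol] s]|]|] /=.
- by rewrite !inE.
- by move=> _; apply: (vis (mem [set m in pbf_atoms (visit sg)])) => m; rewrite inE.
- by move=> ->; apply: (vis (mem [set m in pbf_atoms (visit sg)])) => m; rewrite inE.
Qed.

Fixpoint drun (s : S) (w : nat -> {set props Phi}) (t : nat) : S :=
  if t is t'.+1 then dstep (drun s w t') (w t') else s.

Context (Ac : finType) (T : cgt Ag Ac (props Phi)).
Local Notation N := (state (cgs_of_cgt T)).

Definition polform (pol : bool) (psi : form AP Ag) := if pol then psi else FNeg psi.
Definition goal psi (pi : nat -> N) : Prop :=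
  ltl_sat (fun i => valuation (lab (pi i))) 0 (ltl_of psi).

Hypothesis blT : forall b, b \in bl.
Hypothesis dP : forall (b : basic Phi) A psi pol w, val b = FStrat A psi ->
  parity_ok (fun t => dcol (drun (dinit b pol) w t)) <->
  ltl_sat (fun i => valuation (w i)) 0 (ltl_of (polform pol psi)).
Hypothesis topP : forall sg, top sg = prop_sat (valuation sg) (ltl_of Phi).

Lemma well_formedE : well_formed T <->
  (forall (b : basic Phi) A psi, val b = FStrat A psi -> forall nu : N,
     enforces (inr b \in lab nu) A nu (goal (polform (inr b \in lab nu) psi)))
  /\ top (lab (init T)).
Proof.
rewrite topP /well_formed; split=> -[h1 h2]; split=> //.
  move=> b A psi e nu; have [p1 p2] := h1 b A psi e nu.
  by case: (boolP (inr b \in lab nu)) => h; [exact: p1 h | exact: p2 h].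
move=> b A psi e nu; have := h1 b A psi e nu; case: (inr b \in lab nu) => h.
  by split=> // _; exact: h.
by split=> // _; exact: h.
Qed.

Lemma track_rcons (pi : nat -> N) i : track pi i.+1 = rcons (track pi i) (pi i.+1).
Proof. by rewrite /track mkseqS. Qed.

(** Acceptance speaks of paths from the root, while a launched automaton is followed from an inner
    node; the chain is completed upwards. *)
Lemma path_of_chain (D : pred (seq nat)) (y : nat -> seq nat) :
  (forall x n, D (rcons x n) -> D x) -> (forall i, D (y i)) ->
  (forall i, exists n, y i.+1 = rcons (y i) n) ->
  exists2 c : nat -> nat, (forall i, D (mkseq c i)) &
                          forall i, mkseq c (size (y 0) + i) = y i.
Proof.
move=> Dpre Dy ch.
have [n0 en0 szy] : exists2 n0, size (y 0) = n0 & forall i, size (y i) = n0 + i.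
  exists (size (y 0)) => // i; elim: i => [|i IH]; first by rewrite addn0.
  by have [n ->] := ch i; rewrite size_rcons IH addnS.
rewrite en0.
have pre i k : take (size (y i)) (y (i + k)) = y i.
  elim: k => [|k IH]; first by rewrite addn0 take_size.
  rewrite addnS; have [n ->] := ch (i + k).
  by rewrite -cats1 takel_cat // !szy; lia.
(* The word [y j.+1] has a letter at position [j] wherever the chain begins, and the words of the
   chain agree on their common positions. *)
pose c j := nth 0 (y j.+1) j.
have cy i : mkseq c (n0 + i) = y i.
  apply: (@eq_from_nth _ 0) => [|j]; rewrite size_mkseq ?szy // => lt.
  rewrite nth_mkseq // /c.
  case: (leqP j.+1 i) => le.
    have := pre j.+1 (i - j.+1); rewrite subnKC // => <-.
    by rewrite nth_take // szy; lia.
  have := pre i (j.+1 - i); rewrite subnKC; last lia.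
  by move=> <-; rewrite nth_take // szy.
exists c => // i; case: (leqP n0 i) => le.
  by rewrite -(subnKC le) cy.
have : D (mkseq c (n0 + 0)) by rewrite cy.
have -> : n0 + 0 = i + (n0 - i) by lia.
move: (_ - i) => k; elim: k => [|k IH]; first by rewrite addn0.
by rewrite addnS mkseqS => /Dpre.
Qed.

(** * From accepting runs to strategies *)

Section AcceptedIsWellFormed.
Variables (D : pred (seq nat)) (r : seq nat -> astate * N).
Hypothesis run_r : @is_run Ag Ac (props Phi) automaton T D r.
Hypothesis acc_r : @accepting Ag Ac (props Phi) automaton T D r.

Let child y q nu' := exists2 n, D (rcons y n) & r (rcons y n) = (q, nu').

Lemma run_forces y q : D y -> move_to q \in pbf_atoms (adelta (r y).1 (lab (r y).2)) ->
  forces (pol_of q) (coal_of q) (r y).2 (child y q).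
Proof.
case: run_r => _ _ _ h Dy qin; have [H sat [[ok1 ok2] _]] := h y Dy.
have := adelta_sat sat qin; rewrite /move_to /forces; case: (pol_of q) => /=.
  exact: ok1.
exact: ok2.
Qed.

Lemma visited nu : exists y, [/\ D y, (r y).2 = nu & (r y).1 = None \/ (r y).1 = Some None].
Proof.
case: nu => x hx; elim/last_ind: x hx => [|x n IH] hx.
  case: run_r => D0 _ r0 _; exists [::]; rewrite r0; split=> //=; last by left.
  by congr exist; exact: bool_irrelevance.
have hx' := nodes_prefix hx; have [y [Dy y2 y1]] := IH hx'.
have [d Ed] : exists d, trans (exist _ x hx' : N) d = Some (exist _ (rcons x n) hx).
  by apply/(@succ_child _ _ _ T); exists n.
have : move_to (Some None) \in pbf_atoms (adelta (r y).1 (lab (r y).2)).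
  case: (run_r) => _ _ _ /(_ y Dy)[H sat _]; move: sat.
  case: y1 => -> /=; last by rewrite visit_atoms eqxx.
  by case: ifP => // _ _; rewrite visit_atoms eqxx.
move=> /(run_forces Dy) /forces_all /(_ (exist _ (rcons x n) hx)).
rewrite y2 => -[|m Dm rm]; first by exists d.
by exists (rcons y m); rewrite rm; split=> //; right.
Qed.

Lemma accepted_top : top (lab (init T)).
Proof.
case: run_r => D0 _ r0 /(_ _ D0)[H + _]; rewrite r0 /=.
by case: ifP.
Qed.

Section Follow.
Variables (b : basic Phi) (pol : bool).

(** The definition serves both at the launching node, where the state is the default [dinit b pol],
    and at the nodes that continue the automaton. *)
Let target y : astate :=
  Some (Some (b, pol, dstep (if (r y).1 is Some (Some (_, _, s)) then s else dinit b pol) (lab (r y).2))).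
Let good y := D y /\ move_to (target y) \in pbf_atoms (adelta (r y).1 (lab (r y).2)).

Lemma good_child y y' n nu' : y' = rcons y n -> D y' -> r y' = (target y, nu') -> good y'.
Proof.
move=> e Dy' ry'; split=> //; rewrite /target ry' /=.
by rewrite inE.
Qed.

(** The strategy is read off the run: a track leads, through [nx], to a run node that has followed
    it, and the choice made there is played. As the launched automaton is deterministic, the branch
    obtained carries its run on the labels of the play. *)
Lemma follow_enforces y0 A psi : val b = FStrat A psi -> good y0 ->
  (forall s, (r y0).1 <> Some (Some s)) ->
  enforces pol A (r y0).2 (goal (polform pol psi)).
Proof.
move=> eb g0 n0; have eA : coal (val b) = A by rewrite eb.
have hc (y : seq nat) (nu : N) : exists c : choice_of Ac pol A, legal nu c /\
    (good y -> (r y).2 = nu -> forall nu', leads nu c nu' -> child y (target y) nu').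
  case: (EM (good y /\ (r y).2 = nu)) => [[[Dy gy] <-]|no].
    have := run_forces Dy gy; rewrite /coal_of /= eA => /forcesP[c lc h].
    by exists c; split.
  by have [c lc] := legal_ex pol A nu; exists c; split=> // gy e; case: no.
pose ch y nu := sval (cid (hc y nu)).
have hn y nu' : exists y', child y (target y) nu' -> exists n, [/\ y' = rcons y n, D y' & r y' = (target y, nu')].
  case: (EM (child y (target y) nu')) => [[n Dn rn]|no]; last by exists y.
  by exists (rcons y n) => _; exists n.
pose nx y nu := sval (cid (hn y nu)).
pose f tr := ch (foldl nx y0 (behead tr)) (last (r y0).2 tr).
exists f.
  move=> pi i _; rewrite /f; have -> : last (r y0).2 (track pi i) = pi i.
    by rewrite /track mkseqS last_rcons.
  exact: (svalP (cid (hc _ _))).1.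
move=> pi pi0 hpi.
pose y i := foldl nx y0 (behead (track pi i)).
have yS i : y i.+1 = nx (y i) (pi i.+1).
  by rewrite /y track_rcons /track /mkseq [iota 0 i.+1]/= map_cons rcons_cons [behead _]/= [behead (_ :: _)]/= -cats1 foldl_cat.
have y00 : y 0 = y0 by [].
have step i : good (y i) -> (r (y i)).2 = pi i ->
    exists n, [/\ y i.+1 = rcons (y i) n, D (y i.+1) & r (y i.+1) = (target (y i), pi i.+1)].
  move=> gi ri; rewrite yS; apply: (svalP (cid (hn (y i) (pi i.+1)))).
  apply: (svalP (cid (hc (y i) (pi i)))).2 => //.
  by have := hpi i; rewrite /f /track mkseqS last_rcons -mkseqS.
have all_good i : good (y i) /\ (r (y i)).2 = pi i.
  elim: i => [|i [gi ri]]; first by rewrite y00 pi0.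
  by have [n [e Dy ry]] := step i gi ri; rewrite ry; split=> //; exact: (good_child e Dy ry).
have state_y i : (r (y i.+1)).1 = Some (Some (b, pol, drun (dinit b pol) (fun j => lab (pi j)) i.+1)).
  elim: i => [|i IH].
    have [g r0] := all_good 0; have [n [_ _ ->]] := step 0 g r0.
    rewrite /target r0 y00; case: (r y0).1 n0 => [[s|]|] // h; by case: (h s).
  by have [g r0] := all_good i.+1; have [n [_ _ ->]] := step i.+1 g r0; rewrite /target r0 IH.
have [c Dc cy] : exists2 c : nat -> nat, (forall i, D (mkseq c i)) & forall i, mkseq c (size (y 0) + i) = y i.
  apply: path_of_chain.
  - by case: run_r.
  - by move=> i; case: (all_good i) => -[].
  - by move=> i; have [g ri] := all_good i; have [n [e _ _]] := step i g ri; exists n.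
(* The first state of [drun] never occurs in the run, since a label is read at the launch; hence a
   shift on both sides. *)
have := acc_r Dc => /(parity_ok_shift _ (size (y 0)).+1).1 ok.
apply/(dP pol (fun j => lab (pi j)) eb)/(parity_ok_shift _ 1).
apply: parity_ok_ext ok => i.
by rewrite addSnnS cy [color _](_ : _ = acolor (r (y i.+1)).1) // state_y add1n.
Qed.
End Follow.

Lemma accepted_well_formed : well_formed T.
Proof.
apply/well_formedE; split; last exact: accepted_top.
move=> b A psi eb nu; have [y [Dy <- y1]] := visited nu.
apply: (follow_enforces (b := b)) => //; last by move=> s; case: y1 => ->.
split=> //.
have -> : (if (r y).1 is Some (Some (_, _, s)) then s else dinit b (inr b \in lab (r y).2)) = dinit b (inr b \in lab (r y).2).
  by case: y1 => ->.
rewrite -/(launch b (lab (r y).2)).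
have atom : move_to (launch b (lab (r y).2)) \in pbf_atoms (visit (lab (r y).2)).
  by rewrite visit_atoms; apply/orP; right; apply/mapP; exists b.
case: y1 => e; rewrite e //=; case: ifP => // no.
by case: run_r => _ _ _ /(_ y Dy)[H + _]; rewrite e /= no.
Qed.
End AcceptedIsWellFormed.

(** * From strategies to accepting runs *)

Section WellFormedIsAccepted.
Hypothesis wfT : well_formed T.

Lemma strategy_ex (b : basic Phi) (nu : N) :
  exists f : seq N -> choice_of Ac (inr b \in lab nu) (coal (val b)),
    (forall pi i, is_play pi -> legal (pi i) (f (track pi i))) /\
    (forall pi : nat -> N, pi 0 = nu ->
      (forall i, leads (pi i) (f (track pi i)) (pi i.+1)) ->
      parity_ok (fun t => dcol (drun (dinit b (inr b \in lab nu)) (fun j => lab (pi j)) t))).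
Proof.
have [h _] := well_formedE.1 wfT.
have [A [psi e]] := basics_strat (valP b).
have -> : coal (val b) = A by rewrite e.
have [f h1 h2] := h b A psi e nu; exists f; split=> // pi p0 hp.
exact/(dP _ _ e)/(h2 pi p0 hp).
Qed.

Let strat b nu := sval (cid (strategy_ex b nu)).

(* A run node remembers the track followed since its strategy was started. *)
Let memory : Type := astate * (N * seq N).
Let cur (m : memory) : N := last m.2.1 m.2.2.
Let mlab (m : memory) : astate * N := (m.1, cur m).
Let strategic (q : astate) : bool := if q is Some (Some _) then true else false.

Let allowed (m : memory) (x : astate * N) : Prop :=
  move_to x.1 \in pbf_atoms (adelta m.1 (lab (cur m))) /\
  (if x.1 is Some (Some (b, _, _)) then leads (cur m) (strat b m.2.1 (m.2.1 :: m.2.2)) x.2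
   else exists d, trans (cur m) d = Some x.2).

Let upd (m : memory) (x : astate * N) : memory :=
  if strategic x.1 then (x.1, (m.2.1, rcons m.2.2 x.2)) else (x.1, (x.2, [::])).

(** Strategies are legal along plays only, whence the first clause. The second one gives a strategic
    state the polarity for which its strategy was chosen, and an empty memory to the other
    states. *)
Let inv (m : memory) : Prop :=
  [/\ exists pi i, is_play pi /\ track pi i = m.2.1 :: m.2.2,
      if m.1 is Some (Some (b, pol, _)) then pol = (inr b \in lab m.2.1) else m.2.2 = [::] &
      m.1 = None -> top (lab (cur m))].

Lemma mlab_upd m x : mlab (upd m x) = x.
Proof. by case: x => q nu; rewrite /upd /mlab /cur; case: ifP => _ //=; rewrite last_rcons. Qed.

Lemma allowed_trans m x : allowed m x -> exists d, trans (cur m) d = Some x.2.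
Proof.
case: x => -[[[[b pol] s]|]|] nu [_] //=.
exact: leads_trans.
Qed.

Lemma target_pol m b pol s : inv m ->
  move_to (Some (Some (b, pol, s))) \in pbf_atoms (adelta m.1 (lab (cur m))) ->
  pol = (inr b \in lab m.2.1).
Proof.
move=> [_ ipol _].
have vis : m.2.2 = [::] -> move_to (Some (Some (b, pol, s))) \in pbf_atoms (visit (lab (cur m))) ->
    pol = (inr b \in lab m.2.1).
  rewrite visit_atoms => e /orP[/eqP//|/mapP[b' _]]; rewrite /cur e => -[-> -> _ _ _ //].
case: m ipol vis => -[[[[b' pol'] s']|]|] [nu l] /=.
- by move=> e _; rewrite inE => /eqP[-> -> _ _ _].
- by move=> e vis; exact: vis.
- by move=> e vis; case: ifP => // _; exact: vis.
Qed.

Lemma inv_upd m x : inv m -> allowed m x -> inv (upd m x).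
Proof.
move=> im al; have [d Ed] := allowed_trans al; case: al => atom _.
have [[pi [i [hpi tr]]] ipol _] := im.
have ecur : cur m = pi i.
  by rewrite /cur -[last _ _](last_cons m.2.1) -tr /track mkseqS last_rcons.
rewrite /upd; case: ifP => sx.
  split=> //=; last by move=> e; move: sx; rewrite e.
    rewrite ecur in Ed; have [pi' hpi' [e1 e2]] := play_extend hpi Ed.
    by exists pi', i.+1; split=> //; rewrite track_rcons e1 e2 tr rcons_cons.
  by case: x sx atom {Ed} => -[[[[b pol] s]|]|] nu //= _; exact: target_pol.
split=> //=.
- have [pi' hpi' e] := play_from x.2; exists pi', 0; split=> //.
  by rewrite /track /mkseq [map _ _]/= e.
- by case: x.1 sx => [[[[b pol] s]|]|].
- move=> e; move: atom; rewrite e => /=; case: (m.1) => [[[[b pol] s]|]|] /=.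
  + by rewrite inE.
  + by rewrite visit_atoms => /orP[/eqP|/mapP[b' _]].
  + by case: ifP => // _; rewrite visit_atoms => /orP[/eqP|/mapP[b' _]].
Qed.

Lemma allowed_forces m q : inv m -> move_to q \in pbf_atoms (adelta m.1 (lab (cur m))) ->
  forces (pol_of q) (coal_of q) (cur m) (fun nu' => allowed m (q, nu')).
Proof.
move=> im atom; have [[pi [i [hpi tr]]] ipol _] := im.
have ecur : cur m = pi i.
  by rewrite /cur -[last _ _](last_cons m.2.1) -tr /track mkseqS last_rcons.
case: q atom => [[[[b pol] s]|]|] atom; [|by apply/forces_all => nu' h; split..].
have e := target_pol im atom; rewrite /pol_of /coal_of.
have : forces (inr b \in lab m.2.1) (coal (val b)) (cur m)
    (fun nu' => allowed m (Some (Some (b, pol, s)), nu')).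
  apply/forcesP; exists (strat b m.2.1 (m.2.1 :: m.2.2)).
    by rewrite ecur -tr; apply: (svalP (cid (strategy_ex b m.2.1))).1.
  by move=> nu' h; split.
by rewrite -e.
Qed.

(** The labels allowed by the strategies satisfy all the atoms of the transition, and they are
    finitely many since a node has finitely many transitions; a minimal subset is taken. *)
Lemma children_ex m : inv m -> exists ch : seq memory,
  (forall m', List.In m' ch -> exists2 x, m' = upd m x & allowed m x) /\
  exists2 H : {set move Ag astate}, pbf_sat (fun mv => mv \in H) (adelta m.1 (lab (cur m))) &
    @moves_min Ag Ac (props Phi) automaton T H (cur m)
      (fun x => exists2 m', List.In m' ch & mlab m' = x).
Proof.
move=> im; pose H := [set mv in pbf_atoms (adelta m.1 (lab (cur m)))].
have sat : pbf_sat (fun mv => mv \in H) (adelta m.1 (lab (cur m))).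
  by apply: adelta_atoms; apply/implyP => /eqP; case: im => _ _; exact.
pose ok (L : astate * N -> Prop) := @moves_ok Ag Ac (props Phi) automaton T H (cur m) L.
have mono (L L' : astate * N -> Prop) : (forall x, L x -> L' x) -> ok L -> ok L'.
  move=> sub [h1 h2]; split=> [q B qH|q B qH dB av].
    by have [dB av h] := h1 q B qH; exists dB => // nu' /h; exact: sub.
  by have [nu' h Lx] := h2 q B qH dB av; exists nu' => //; exact: sub.
have ok0 : ok (allowed m).
  have key q k B : (q, k, B) \in H -> [/\ k = bool_modality (pol_of q), B = coal_of q &
       forces (pol_of q) (coal_of q) (cur m) (fun nu' => allowed m (q, nu'))].
    rewrite inE => atom; have [q' [e1 e2 e3]] := atoms_move_to atom; subst q'.
    by split=> //; apply: allowed_forces im _; rewrite /move_to -e2 -e3.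
  split=> q B /key[]; case: (pol_of q) => //= _ -> //.
pose kids : seq N := pmap (trans (cur m)) (enum (decision Ag Ac)).
pose cand := [seq (q, nu) | q <- enum astate, nu <- kids].
have fin x : allowed m x -> List.In x cand.
  move=> /allowed_trans[d Ed]; case: x Ed => q nu /= Ed.
  have kin : List.In nu kids.
    by apply: (In_pmap Ed); rewrite mem_enum.
  by apply: In_allpairs => //; rewrite mem_enum.
have [L1 [sub okL min]] := minimal_subset mono fin ok0.
exists [seq upd m x | x <- cand & `[< L1 x >]].
have inch m' : List.In m' [seq upd m x | x <- cand & `[< L1 x >]] <-> exists2 x, m' = upd m x & L1 x.
  rewrite List.in_map_iff; split=> [[x [<- /List.filter_In[_ /asboolP h]]]|[x -> Lx]]; first by exists x.
  exists x; split=> //; apply/List.filter_In; split; last exact/asboolP.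
  exact/fin/sub.
split; first by move=> m' /inch[x -> /sub h]; exists x.
exists H => //.
have -> : (fun x => exists2 m', List.In m' [seq upd m x | x <- cand & `[< L1 x >]] & mlab m' = x) = L1.
  apply/funext => x; apply/propext; split=> [[m' /inch[y -> Ly] <-]|Lx]; first by rewrite mlab_upd.
  by exists (upd m x); rewrite ?mlab_upd //; apply/inch; exists x.
by split.
Qed.

Let ch (m : memory) : seq memory :=
  if pselect (inv m) is left im then sval (cid (children_ex im)) else [::].

Let m0 : memory := (None, (init T, [::])).

(** A run node is a word of indices in successive lists of children; the words without a memory lie
    outside the run. *)
Let mem_of (y : seq nat) : option memory :=
  foldl (fun om n => obind (fun m => onth (ch m) n) om) (Some m0) y.

Lemma inv0 : inv m0.
Proof.
split=> //=.
  have [pi hpi e] := play_from (init T); exists pi, 0; split=> //.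
  by rewrite /track /mkseq [map _ _]/= e.
by move=> _; have [_] := well_formedE.1 wfT.
Qed.

Lemma ch_inv m m' : List.In m' (ch m) -> inv m' /\ exists2 x, m' = upd m x & allowed m x.
Proof.
rewrite /ch; case: pselect => // im /(svalP (cid (children_ex im))).1[x -> al].
by split; [exact: inv_upd | exists x].
Qed.

Lemma mem_rcons y n : mem_of (rcons y n) = obind (fun m => onth (ch m) n) (mem_of y).
Proof. by rewrite /mem_of -cats1 foldl_cat. Qed.

Lemma mem_inv y m : mem_of y = Some m -> inv m.
Proof.
elim/last_ind: y m => [|y n IH] m; first by move=> [<-]; exact: inv0.
rewrite mem_rcons; case E: (mem_of y) => [m1|] //= e.
by apply: (@ch_inv m1 m _).1; apply/In_onth; exists n.
Qed.

Let D : pred (seq nat) := fun y => isSome (mem_of y).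
Let r (y : seq nat) : astate * N := mlab (odflt m0 (mem_of y)).

Lemma run_of_strategies : @is_run Ag Ac (props Phi) automaton T D r.
Proof.
split=> //.
  by move=> y n; rewrite /D mem_rcons; case: (mem_of y).
move=> y; rewrite /D /r; case E: (mem_of y) => [m|] //= _.
have im := mem_inv E; have [_ [H h1 h2]] := svalP (cid (children_ex im)).
exists H => //; move: h2; set c := sval _.
have ec : c = ch m by rewrite /c /ch; case: pselect => // im'; rewrite (Prop_irrelevance im im').
rewrite ec; congr moves_min.
apply/funext => x; apply/propext; split=> [[m' /In_onth[n e] <-]|[n]].
  by exists n; rewrite mem_rcons E /= e.
rewrite mem_rcons E /=; case e: (onth _ n) => [m'|] //= _ <-.
by exists m' => //; apply/In_onth; exists n.
Qed.

(** A path without launch has color 0 throughout. Otherwise, from the first launch on, it stays in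
    one deterministic automaton, and its tree nodes form a play consistent with the strategy chosen
    at the launching node; its colors are those of the corresponding [drun], the first one
    excepted. *)
Lemma strategies_accepting : @accepting Ag Ac (props Phi) automaton T D r.
Proof.
move=> c Dc; pose m i := odflt m0 (mem_of (mkseq c i)).
have Em i : mem_of (mkseq c i) = Some (m i).
  by rewrite /m; have := Dc i; rewrite /D; case: (mem_of _).
have mS i : exists2 x, m i.+1 = upd (m i) x & allowed (m i) x.
  have : List.In (m i.+1) (ch (m i)).
    by apply/In_onth; exists (c i); have := Em i.+1; rewrite mkseqS mem_rcons Em.
  by move=> /ch_inv[].
have im i : inv (m i) by exact: mem_inv (Em i).
have colE i : @color _ _ automaton (r (mkseq c i)).1 = acolor (m i).1 by rewrite /r Em.
case: (EM (exists i, strategic (m i).1)) => [ex|no]; last first.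
  exists 0; split=> //.
    move=> i; exists i => //; rewrite colE; have : ~ strategic (m i).1 by move=> h; apply: no; exists i.
    by case: (m i).1 => [[]|].
  exists 0 => j _; rewrite colE; have : ~ strategic (m j).1 by move=> h; apply: no; exists j.
  by case: (m j).1 => [[]|].
case: (ex_minnP ex) => -[|k] sk kmin; first by move: sk; rewrite /m.
have nk : ~~ strategic (m k).1 by apply/negP => /kmin; rewrite ltnn.
pose nu := (m k).2.1; pose pi t := cur (m (k + t)).
have lk : (m k).2.2 = [::] by case: (im k) => _ + _; case: (m k).1 nk => [[[[? ?] ?]|]|].
have pi0 : pi 0 = nu by rewrite /pi addn0 /cur lk.
have [b [pol [s [e1 e2]]]] : exists b pol s, (m k.+1).1 = Some (Some (b, pol, s)) /\
    (pol = (inr b \in lab nu)) /\ s = dstep (dinit b pol) (lab nu).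
  have [x ex' [atom _]] := mS k; have eq' : (m k.+1).1 = x.1.
    by rewrite ex' /upd; case: ifP.
  have ecur : cur (m k) = nu by rewrite -pi0 /pi addn0.
  rewrite -ecur; rewrite eq' in sk *; move: sk atom.
  have vis : strategic x.1 -> move_to x.1 \in pbf_atoms (visit (lab (cur (m k)))) ->
     exists b pol s, x.1 = Some (Some (b, pol, s)) /\
    (pol = (inr b \in lab (cur (m k)))) /\ s = dstep (dinit b pol) (lab (cur (m k))).
    move=> sx; rewrite visit_atoms => /orP[/eqP[e _]|/mapP[b _ [-> _ _]]].
      by rewrite e in sx.
    by do 3!eexists; split; [reflexivity | split].
  case: (m k).1 nk => [[[[? ?] ?]|]|] //= _ sx.
  by case: ifP => // _; exact: vis.
case: e2 => epol es.
have shape j : (m (k + j.+1)).1 = Some (Some (b, pol, drun (dinit b pol) (fun t => lab (pi t)) j.+1)) /\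
    (m (k + j.+1)).2 = (nu, mkseq (fun t => pi t.+1) j.+1).
  elim: j => [|j [IH1 IH2]].
    rewrite addn1 e1 es /= pi0; split=> //.
    have [x ex' _] := mS k; have := sk; rewrite ex' /upd; case: ifP => sx /=; last by rewrite sx.
    move=> _.
    by rewrite lk /mkseq /= /pi addn1 ex' /upd sx /cur /= last_rcons.
  rewrite addnS; have [x ex' [atom _]] := mS (k + j.+1).
  have qx : x.1 = Some (Some (b, pol, drun (dinit b pol) (fun t => lab (pi t)) j.+2)).
    by move: atom; rewrite IH1 /= inE => /eqP[-> _ _].
  have eu : m (k + j.+1).+1 = (x.1, (nu, rcons (mkseq (fun t => pi t.+1) j.+1) x.2)).
    by rewrite ex' /upd qx /= IH2.
  rewrite eu qx [mkseq _ j.+2]mkseqS; split=> //; congr (_, rcons _ _).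
  by rewrite /pi addnS eu /cur /= last_rcons.
have tr j : track pi j = (m (k + j)).2.1 :: (m (k + j)).2.2.
  case: j => [|j]; first by rewrite addn0 lk /track /mkseq [map _ _]/= pi0.
  have [_ ->] := shape j; rewrite /track /mkseq -[iota 0 j.+2]/(0 :: iota (1 + 0) j.+1).
  by rewrite map_cons pi0 iotaDl -map_comp.
have nuE j : (m (k + j)).2.1 = nu.
  by case: j => [|j]; [rewrite addn0 | have [_ ->] := shape j].
have out_pi j : leads (pi j) (strat b nu (track pi j)) (pi j.+1).
  have [x ex' [_ al]] := mS (k + j).
  have qx : (m (k + j).+1).1 = x.1 by rewrite ex' /upd; case: ifP.
  have [sh _] := shape j; rewrite addnS qx in sh; move: al; rewrite sh tr nuE.
  have -> : pi j.+1 = x.2 by rewrite /pi addnS ex' -[cur _]/(mlab _).2 mlab_upd.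
  by [].
have := (svalP (cid (strategy_ex b nu))).2 pi pi0 out_pi; rewrite -epol.
move=> /(parity_ok_shift _ 1) ok; apply/(parity_ok_shift _ k.+1).
apply: parity_ok_ext ok => j; rewrite colE [k.+1 + j]addSnnS (shape j).1.
by [].
Qed.

Lemma well_formed_accepted : @accepts Ag Ac (props Phi) automaton T.
Proof. exists D, r; split; [exact: run_of_strategies | exact: strategies_accepting]. Qed.
End WellFormedIsAccepted.

Lemma automaton_accepts : @accepts Ag Ac (props Phi) automaton T <-> well_formed T.
Proof.
split=> [[D [r [h1 h2]]]|]; [exact: accepted_well_formed h1 h2 | exact: well_formed_accepted].
Qed.
End Automaton.

(** * The closure automaton of a formula *)

(** One expansion law for each tag of [enc_form]. Only next and until look at [a'], and a strategic
    subformula is an atom of the letter. *)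
Definition localc (a sg a' : seq data) (d : data) : bool :=
  (d \in a) ==
  (if dhd d == dnat 0 then true
   else if dhd d == dnat 1 then Node (dnat 0) (dtl d) \in sg
   else if dhd d == dnat 2 then ~~ (dtl d \in a)
   else if dhd d == dnat 3 then (dhd (dtl d) \in a) || (dtl (dtl d) \in a)
   else if dhd d == dnat 4 then dtl d \in a'
   else if dhd d == dnat 5 then (dtl (dtl d) \in a) || ((dhd (dtl d) \in a) && (d \in a'))
   else Node (dnat 1) d \in sg).
Definition lstep (C a sg a' : seq data) : bool := all (fun d => localc a sg a' d) C.
Definition lful (u : data) (a : seq data) : bool := ~~ (u \in a) || (dtl (dtl u) \in a).

Section EncForm.
Context (AP Ag : finType).
Implicit Types f g : form AP Ag.

Lemma enc_fin_inj (X : finType) : injective (@enc_fin X).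
Proof. by move=> x y /dnat_inj/val_inj/enum_rank_inj. Qed.

Lemma enc_set_inj (X : finType) : injective (@enc_set X).
Proof.
move=> A B /dlist_inj /(inj_map (@enc_fin_inj X)) e.
by apply/setP => x; rewrite -mem_enum e mem_enum.
Qed.

Lemma enc_form_inj : injective (@enc_form AP Ag).
Proof.
elim=> [|p|f IH|f IHf g IHg|f IH|f IHf g IHg|A f IH] [|p'|f'|f' g'|f'|f' g'|A' f'] //=.
- by move=> [/enc_fin_inj->].
- by move=> [/IH->].
- by move=> [/IHf-> /IHg->].
- by move=> [/IH->].
- by move=> [/IHf-> /IHg->].
- by move=> [/enc_set_inj-> /IH->].
Qed.

Fixpoint subs f : seq (form AP Ag) :=
  f :: match f with
       | FTrue | FProp _ => [::]
       | FNeg g | FNext g | FStrat _ g => subs g ++ [::]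
       | FOr g h | FUntil g h => subs g ++ subs h
       end.

Lemma closure_enc f : closure (enc_form f) = map (@enc_form AP Ag) (subs f).
Proof.
elim: f => [|p|f IH|f IHf g IHg|f IH|f IHf g IHg|A f IH] //=; congr cons;
  by rewrite ?map_cat /= ?IH ?IHf ?IHg.
Qed.

Lemma subs_self f : f \in subs f.
Proof. by case: f => *; rewrite inE eqxx. Qed.

Lemma subs_trans f g : g \in subs f -> {subset subs g <= subs f}.
Proof.
have key (h : form AP Ag) (s : seq (form AP Ag)) : (g \in s -> {subset subs g <= s}) ->
    subs h = h :: s -> g \in subs h -> {subset subs g <= subs h}.
  move=> hs e; rewrite {1}e inE => /orP[/eqP-> //|/hs sub x /sub xs].
  by rewrite e inE xs orbT.
elim: f => [|p|f IH|f IHf h IHh|f IH|f IHf h IHh|A f IH]; apply: key => //=; rewrite ?cats0 // mem_cat.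
- by move=> /orP[/IHf|/IHh] h' x /h' hx; rewrite mem_cat hx ?orbT.
- by move=> /orP[/IHf|/IHh] h' x /h' hx; rewrite mem_cat hx ?orbT.
Qed.

Lemma size_subs f : size (subs f) = fsize f.
Proof.
by elim: f => //= [f IH|f IHf g IHg|f IH|f IHf g IHg|A f IH]; rewrite size_cat /= ?addn0 ?IH ?IHf ?IHg.
Qed.

Definition is_strat f := if f is FStrat _ _ then true else false.

Lemma mem_basics f g : (g \in basics f) = (g \in subs f) && is_strat g.
Proof.
have key (h : form AP Ag) (s : seq (form AP Ag)) : is_strat h = false ->
    (g \in h :: s) && is_strat g = (g \in s) && is_strat g.
  by move=> e; rewrite inE; case: eqP => [->|] //=; rewrite e !andbF.
elim: f => [|p|f IH|f IHf h IHh|f IH|f IHf h IHh|A f IH] /=.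
7: by rewrite !inE cats0 IH; case: eqP => [->|].
all: by rewrite key // ?cats0 ?mem_cat ?in_nil ?IH ?IHf ?IHh ?andb_orl.
Qed.
End EncForm.

Section Closure.
Context (AP Ag : finType) (Phi : form AP Ag).
Local Notation encf := (@enc_form AP Ag).

Definition cl : seq data := undup (closure (encf Phi)).
Definition lits : seq (form AP Ag) := [seq g <- undup (subs Phi) | is_strat g].
Definition blist : seq (basic Phi) := pmap insub lits.
Definition plist : seq (props Phi) := map inl (enum AP) ++ map inr blist.
Definition order (sg : {set props Phi}) : seq (props Phi) := [seq x <- plist | x \in sg].
Definition letter (sg : {set props Phi}) : seq data := map (@enc_prop AP Ag Phi) (order sg).

Lemma clE : cl = map encf (undup (subs Phi)).
Proof. by rewrite /cl closure_enc -undup_map_inj //; exact: enc_form_inj. Qed.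

Lemma cl_uniq : uniq cl. Proof. exact: undup_uniq. Qed.

Lemma mem_cl f : (encf f \in cl) = (f \in subs Phi).
Proof. by rewrite clE mem_map ?mem_undup //; exact: enc_form_inj. Qed.

Lemma clP d : d \in cl -> exists2 f, f \in subs Phi & d = encf f.
Proof. by rewrite clE => /mapP[f]; rewrite mem_undup => h ->; exists f. Qed.

Lemma size_cl : size cl <= fsize Phi.
Proof. by rewrite clE size_map -size_subs size_undup. Qed.

Lemma blistE : map val blist = lits.
Proof.
rewrite /blist (pmap_filter (@insubK _ _ (basic Phi))); apply/all_filterP/allP => g.
rewrite mem_filter mem_undup => /andP[h1 h2].
by rewrite /= isSome_insub mem_basics h1 h2.
Qed.

Lemma mem_blist b : b \in blist.
Proof.
rewrite /blist mem_pmap_sub /= mem_filter mem_undup andbC -mem_basics.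
exact: valP.
Qed.

Lemma blist_uniq : uniq blist.
Proof. by apply: (@map_uniq _ _ val); rewrite blistE filter_uniq // undup_uniq. Qed.

Lemma enc_blist : map (fun b : basic Phi => encf (val b)) blist = [seq d <- cl | dhd d == dnat 6].
Proof.
rewrite clE filter_map (map_comp encf) blistE; congr map.
by apply: eq_filter; case.
Qed.

Lemma mem_plist x : x \in plist.
Proof.
rewrite mem_cat; case: x => [p|b]; first by rewrite map_f // mem_enum.
by rewrite (map_f inr) ?orbT // mem_blist.
Qed.

Lemma plist_uniq : uniq plist.
Proof.
have inj1 : injective (@inl AP (basic Phi)) by move=> ? ? [].
have inj2 : injective (@inr AP (basic Phi)) by move=> ? ? [].
rewrite cat_uniq (map_inj_uniq inj1) (map_inj_uniq inj2) enum_uniq blist_uniq andbT.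
by apply/hasPn => _ /mapP[b _ ->]; apply/mapP => -[].
Qed.

Lemma enc_prop_inj : injective (@enc_prop AP Ag Phi).
Proof.
move=> [p|b] [p'|b'] //= []; first by move/enc_fin_inj->.
by move/enc_form_inj/val_inj->.
Qed.

Lemma mem_order sg x : (x \in order sg) = (x \in sg).
Proof. by rewrite mem_filter mem_plist andbT. Qed.

Lemma mem_letter sg x : (enc_prop x \in letter sg) = (x \in sg).
Proof. by rewrite mem_map ?mem_order //; exact: enc_prop_inj. Qed.

Lemma letter_prop sg p : (Node (dnat 0) (enc_fin p) \in letter sg) = (inl p \in sg).
Proof. exact: (mem_letter sg (inl p)). Qed.

Lemma letter_strat sg f : f \in subs Phi -> is_strat f ->
  (Node (dnat 1) (encf f) \in letter sg) = valuation sg (inr f).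
Proof.
move=> h1 h2; have fb : f \in basics Phi by rewrite mem_basics h1 h2.
rewrite /valuation; case: insubP => [b _ e|]; last by rewrite fb.
by rewrite -(mem_letter sg (inr b)) /= e.
Qed.

Definition VL := subseqs cl.
Definition UL := [seq d <- cl | dhd d == dnat 5].
Definition PL := [seq (a, u) | a <- VL, u <- UL].

Lemma VL_uniq : uniq VL. Proof. exact: subseqs_uniq cl_uniq. Qed.

Lemma PLE a u : ((a, u) \in PL) = (a \in VL) && (u \in UL).
Proof.
apply/allpairsP/andP => [[[a' u'] [/= h1 h2 [-> ->]]]|[h1 h2]]; first by split.
by exists (a, u).
Qed.

Lemma subs_neg g : FNeg g \in subs Phi -> g \in subs Phi.
Proof. by move=> /subs_trans; apply; rewrite inE cats0 subs_self orbT. Qed.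
Lemma subs_next g : FNext g \in subs Phi -> g \in subs Phi.
Proof. by move=> /subs_trans; apply; rewrite inE cats0 subs_self orbT. Qed.
Lemma subs_or g h : FOr g h \in subs Phi -> g \in subs Phi /\ h \in subs Phi.
Proof. by move=> /subs_trans sub; split; apply: sub; rewrite inE mem_cat subs_self !orbT. Qed.
Lemma subs_until g h : FUntil g h \in subs Phi -> g \in subs Phi /\ h \in subs Phi.
Proof. by move=> /subs_trans sub; split; apply: sub; rewrite inE mem_cat subs_self !orbT. Qed.
Lemma subs_strat A g : FStrat A g \in subs Phi -> g \in subs Phi.
Proof. by move=> /subs_trans; apply; rewrite inE cats0 subs_self orbT. Qed.

Lemma lstepP a sg a' : lstep cl a sg a' <-> forall f, f \in subs Phi -> localc a sg a' (encf f).
Proof.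
split=> [/allP h f fs|h]; first by apply: h; rewrite mem_cl.
by apply/allP => d /clP[f fs ->]; exact: h.
Qed.

(** By induction on the subformula: each law expresses its truth through the letter, the next
    assignment and smaller subformulas. *)
Lemma lstep_back a1 a2 sg a' : a1 \in VL -> a2 \in VL -> a' \in VL ->
  lstep cl a1 sg a' -> lstep cl a2 sg a' -> a1 = a2.
Proof.
rewrite !mem_subseqs => s1 s2 _ /lstepP h1 /lstepP h2; apply: (canon cl_uniq s1 s2).
have key f : f \in subs Phi -> (encf f \in a1) = (encf f \in a2).
  elim: f => [|p|f IH|f IHf h IHh|f IH|f IHf h IHh|A f IH] fs;
    have /eqP /= e1 := h1 _ fs; have /eqP /= e2 := h2 _ fs; rewrite e1 e2 //.
  - by rewrite IH ?(subs_neg fs).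
  - by rewrite IHf ?IHh //; case: (subs_or fs).
  - by rewrite IHf ?IHh //; case: (subs_until fs).
move=> d; case: (boolP (d \in cl)) => [/clP[f fs ->]|no]; first exact: key.
have sub1 := mem_subseq s1; have sub2 := mem_subseq s2.
by rewrite (contraNF (@sub1 d) no) (contraNF (@sub2 d) no).
Qed.

Section Word.
Variable w : nat -> {set props Phi}.
Let val_w i := valuation (w i).
Let sat t f := ltl_sat val_w t (ltl_of f).

Lemma sat_until t g h : sat t (FUntil g h) <-> sat t h \/ (sat t g /\ sat t.+1 (FUntil g h)).
Proof.
split=> [[j [tj hj gj]]|[ht|[gt [j [tj hj gj]]]]].
- move: tj; rewrite leq_eqVlt => /orP[/eqP e|lt]; first by left; rewrite /sat e.
  right; split; first by apply: gj; rewrite leqnn.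
  by exists j; split=> // k /andP[tk kj]; apply: gj; rewrite ltnW.
- by exists t; split=> // k /andP[tk kt]; have := leq_ltn_trans tk kt; rewrite ltnn.
- exists j; split=> //; first exact: ltnW.
  move=> k /andP[]; rewrite leq_eqVlt => /orP[/eqP<- //|tk kj].
  by apply: gj; rewrite tk.
Qed.

Let W t := letter (w t).

(** Fairness is used for until, from left to right: a claimed until formula is claimed again at the
    next step unless its right side holds, and fairness excludes that this goes on forever. *)
Lemma branch_sat b : (forall t, b t \in VL) -> (forall t, lstep cl (b t) (W t) (b t.+1)) ->
  fair lful UL b -> forall f t, f \in subs Phi -> (encf f \in b t) <-> sat t f.
Proof.
move=> bV bs bf f.
have loc t g : g \in subs Phi -> localc (b t) (W t) (b t.+1) (encf g).
  by move=> gs; have /lstepP := bs t; apply.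
elim: f => [|p|f IH|f IHf h IHh|f IH|f IHf h IHh|A f IH] t fs; have /eqP /= e := loc t _ fs.
- by rewrite e.
- by rewrite e letter_prop.
- by have := IH t (subs_neg fs); rewrite e => -[h1 h2]; split=> [/negP h /h2|h]; [exact: h | apply/negP => /h1].
- have [fs1 fs2] := subs_or fs; have [a1 a2] := IHf t fs1; have [c1 c2] := IHh t fs2.
  by rewrite e; split=> [/orP[/a1|/c1]|[/a2|/c2] h']; [left|right|rewrite h'|rewrite h' orbT].
- by rewrite e; exact: IH (subs_next fs).
- have [fs1 fs2] := subs_until fs.
  have unf t' : (encf (FUntil f h) \in b t') = (encf h \in b t') || ((encf f \in b t') && (encf (FUntil f h) \in b t'.+1)).
    by have /eqP := loc t' _ fs.
  split=> [hu|[j [tj hj gj]]].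
    have uU : encf (FUntil f h) \in UL by rewrite mem_filter mem_cl fs.
    have [t1 tt1] := bf _ uU t; rewrite -(subnKC tt1) /lful /=.
    move: (t1 - t) => {t1 tt1}n.
    elim: n t hu {e} => [|n IHn] t hu; rewrite ?addn0.
      by rewrite hu /= => /IHh h'; apply/sat_until; left; exact: h'.
    move=> h'; move: hu; rewrite unf => /orP[/(IHh _ fs2).1 ?|/andP[/(IHf _ fs1).1 ? hu]].
      by apply/sat_until; left.
    apply/sat_until; right; split=> //; apply: IHn hu _.
    by rewrite addSn -addnS.
  have {tj} [n e'] : exists n, j = t + n by exists (j - t); rewrite subnKC.
  subst j; elim: n t hj gj {e} => [|n IHn] t hj gj.
    by rewrite unf; apply/orP; left; apply/(IHh _ fs2); rewrite addn0 in hj.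
  rewrite unf; apply/orP; right; apply/andP; split.
    by apply/(IHf _ fs1); apply: gj; rewrite leqnn addnS ltnS leq_addr.
  apply: IHn; first by rewrite addSnnS.
  by move=> k /andP[tk kj]; apply: gj; rewrite ltnW //= -addSnnS.
- rewrite e; have := letter_strat (w t) fs isT => /= ->.
  by [].
Qed.

Definition truth t : seq data := [seq d <- cl | `[< exists f, [/\ f \in subs Phi, d = encf f & sat t f] >]].

Lemma mem_truth t f : f \in subs Phi -> (encf f \in truth t) <-> sat t f.
Proof.
move=> fs; rewrite mem_filter mem_cl fs andbT.
split=> [/asboolP[g [_ /enc_form_inj -> //]]|h].
by apply/asboolP; exists f.
Qed.

Lemma truth_VL t : truth t \in VL.
Proof. by rewrite mem_subseqs filter_subseq. Qed.

Lemma iff_bool (b1 b2 : bool) : (b1 <-> b2) -> b1 = b2.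
Proof. by move=> [h1 h2]; apply/idP/idP. Qed.

Lemma truth_step t : lstep cl (truth t) (W t) (truth t.+1).
Proof.
apply/lstepP => f fs; apply/eqP/iff_bool; rewrite mem_truth //.
case: f fs => [|p|f|f h|f|f h|A f] fs /=.
- by [].
- by rewrite letter_prop.
- have [h1 h2] := mem_truth t (subs_neg fs).
  by split=> [h|/negP h /h2 //]; apply/negP => /h1.
- have [fs1 fs2] := subs_or fs; have [a1 a2] := mem_truth t fs1; have [c1 c2] := mem_truth t fs2.
  by split=> [[/a2 ->|/c2 ->]|/orP[/a1|/c1]]; rewrite ?orbT //; [left|right].
- by have := mem_truth t.+1 (subs_next fs); move=> [? ?]; split.
- have [fs1 fs2] := subs_until fs; have [a1 a2] := mem_truth t fs1; have [c1 c2] := mem_truth t fs2.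
  have [u1 u2] := mem_truth t.+1 fs; rewrite -/(ltl_of (FUntil f h)) -/(ltl_sat _ _ _).
  split=> [/sat_until[/c2 -> //|[/a2 -> /u2 ->]]|]; first by rewrite orbT.
  by move=> /orP[/c1 h'|/andP[/a1 h' /u1 h'']]; apply/sat_until; [left | right].
- by have := letter_strat (w t) fs isT => /= ->.
Qed.

Lemma truth_fair : fair lful UL truth.
Proof.
move=> u; rewrite mem_filter => /andP[tag /clP[f fs e]] t; subst u.
case: f fs tag => // f h fs _; have [fs1 fs2] := subs_until fs.
rewrite /lful /=; case: (EM (sat t (FUntil f h))) => [[j [tj hj _]]|no].
  exists j => //; apply/orP; right; exact/mem_truth.
by exists t => //; apply/orP; left; apply/negP => /(mem_truth _ fs).
Qed.
End Word.
End Closure.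

(** * The transition function is computable in polynomial time *)

Notation lnode := (seq (seq data) * seq (seq data * data))%type.
Notation lstate := (nat * seq lnode)%type.

Section PTimeTransitions.
Context (X : Type) {cX : code X} (b : X -> nat).
Hypothesis b_ge : forall x, sz x <= b x.

Lemma ctime_lful u a : ctime b u -> ctime b a -> ctime b (fun x => lful (u x) (a x)).
Proof. by move=> *; apply: (ctime_app2 b_ge (F := lful)) => //; rewrite /lful; pt. Qed.

Lemma ctime_lstep C a sg a' : ctime b C -> ctime b a -> ctime b sg -> ctime b a' ->
  ctime b (fun x => lstep (C x) (a x) (sg x) (a' x)).
Proof.
by move=> *; apply: (ctime_app4 b_ge (F := lstep)) => //; rewrite /lstep /localc; pt.
Qed.
End PTimeTransitions.

Ltac pt_user ::= lazymatch goal with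
  | |- ctime _ (fun x => lful (@?u x) (@?a x)) => refine (ctime_lful (u := u) (a := a) _ _ _); [pt_ge | |]
  | |- ctime _ (fun x => lstep (@?C x) (@?a x) (@?sg x) (@?a' x)) =>
      refine (ctime_lstep (C := C) (a := a) (sg := sg) (a' := a') _ _ _ _ _); [pt_ge | | | |]
  | _ => assumption
  end.

Section PTimeTransitions2.
Context (X : Type) {cX : code X} (b : X -> nat).
Hypothesis b_ge : forall x, sz x <= b x.

Lemma ctime_img (v : X -> seq (seq data)) C sg D :
  ctime b v -> ctime b C -> ctime b sg -> ctime b D ->
  ctime b (fun x => img (v x) (lstep (C x)) (sg x) (D x)).
Proof.
move=> *; apply: (ctime_app4 b_ge (F := fun v C sg D => img v (lstep C) sg D)) => //.
by rewrite /img; pt.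
Qed.

Lemma ctime_mimg (pl : X -> seq (seq data * data)) C sg M :
  ctime b pl -> ctime b C -> ctime b sg -> ctime b M ->
  ctime b (fun x => mimg (pl x) (lstep (C x)) lful (sg x) (M x)).
Proof.
move=> *; apply: (ctime_app4 b_ge (F := fun v C sg D => mimg v (lstep C) lful sg D)) => //.
by rewrite /mimg; pt.
Qed.

Lemma ctime_full (pl : X -> seq (seq data * data)) D :
  ctime b pl -> ctime b D -> ctime b (fun x => full (pl x) (D x)).
Proof.
move=> *; apply: (ctime_app2 b_ge (F := fun pl D => full pl D)) => //.
by rewrite /full; pt.
Qed.

Lemma ctime_dead (y : X -> seq lnode * lnode) : ctime b y -> ctime b (fun x => dead (y x)).
Proof.
by move=> *; apply: (ctime_app1 b_ge (F := fun y : seq lnode * lnode => dead y)) => //; rewrite /dead; pt.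
Qed.

Lemma ctime_event (y : X -> seq (seq lnode * lnode)) : ctime b y -> ctime b (fun x => event (y x)).
Proof.
move=> *; apply: (ctime_app1 b_ge (F := fun y : seq (seq lnode * lnode) => event y)) => //.
rewrite /event.
apply: (@ctime_foldr _ _ _ _ _ _ _ _ (fun y => y) (fun=> (0, true))
  (fun y acc x => if dead y then (0, true) else if y.2.2 == [::] then (0, false) else (acc.1.+1, acc.2))
  (fun y => esize y + esize y + 4)) => //; try by pt.
- have hd : ptime (fun y : (seq lnode * lnode) * ((nat * bool) * seq (seq lnode * lnode)) => dead y.1).
    apply: (@ctime_comp _ _ _ _ _ _ _ _ (fun y => y.1) (fun y : seq lnode * lnode => dead y)) => //; last by pt.
    by rewrite /dead; pt.
  by pt.
- move=> x s1 s2 e.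
  set F := foldr _ _ _; have h : F.1 <= size s2.
    by rewrite /F; elim: (s2) => //= nd s3 IH; case: ifP => // _; case: ifP.
  rewrite [F]surjective_pairing esize_prod esize_nat; pose proof (esize_bool F.2).
  pose proof (size_esize s2) as h2; pose proof (esize_suffix s1 s2) as h3; rewrite -e in h3.
  by lia.
- by repeat first [exact: (pb_esize (fun=> leqnn _)) | exact: pb_const | apply: (pb_add (@sz_ge2 _ _))].
Qed.
End PTimeTransitions2.

Ltac pt_user ::= lazymatch goal with
  | |- ctime _ (fun x => lful (@?u x) (@?a x)) => refine (ctime_lful (u := u) (a := a) _ _ _); [pt_ge | |]
  | |- ctime _ (fun x => lstep (@?C x) (@?a x) (@?sg x) (@?a' x)) =>
      refine (ctime_lstep (C := C) (a := a) (sg := sg) (a' := a') _ _ _ _ _); [pt_ge | | | |]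
  | |- ctime _ (fun x => img _ _ _ _) => apply: ctime_img; [pt_ge | | | |]
  | |- ctime _ (fun x => mimg _ _ _ _ _) => apply: ctime_mimg; [pt_ge | | | |]
  | |- ctime _ (fun x => full _ _) => apply: ctime_full; [pt_ge | |]
  | |- ctime _ (fun x => dead (@?y x)) => refine (ctime_dead (y := y) _ _); [pt_ge |]
  | |- ctime _ (fun x => event (@?y x)) => refine (ctime_event (y := y) _ _); [pt_ge |]
  | _ => assumption
  end.

Definition lnext (C : seq data) (vl : seq (seq data)) (pl : seq (seq data * data)) (K : nat)
  (sg : seq data) (q : lstate) : lstate := next vl pl (lstep C) lful K sg q.

Lemma ptime_lnext : ptime (fun y : seq data * (seq (seq data) * (seq (seq data * data) * (nat * (seq data * lstate)))) =>
  lnext y.1 y.2.1 y.2.2.1 y.2.2.2.1 y.2.2.2.2.1 y.2.2.2.2.2).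
Proof.
rewrite /lnext /next /=.
have hk : ptime (fun ps : seq (seq lnode * lnode) => kept ps) by rewrite /kept; pt.
have hadv : ptime (fun y : seq data * (seq (seq data) * (seq (seq data * data) * (nat * (seq data * lstate)))) =>
    advance y.2.1 y.2.2.1 (lstep y.1) lful y.2.2.2.2.1 y.2.2.2.2.2.2).
  by rewrite /advance; pt.
set E := (_ * (_ * _))%type in hadv *.
have hks : ptime (fun y : E => kept (prefs (advance y.2.1 y.2.2.1 (lstep y.1) lful y.2.2.2.2.1 y.2.2.2.2.2.2))).
  by apply: (ctime_comp _ hk) => //; pt.
apply: ctime_pair => //.
  rewrite /hue; pt.
apply: ctime_cat => //.
  apply: (@ctime_app2 _ _ _ _ _ _ _ _ _ _ (fun pl ks => [seq reset pl nd | nd <- ks]) (fun y : E => y.2.2.1)) => //; last by pt.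
  by rewrite /reset; pt.
apply: (@ctime_app3 _ _ _ _ _ _ _ _ _ _ _ _ (fun vl pl ks => fresh vl pl ks) (fun y : E => y.2.1) (fun y : E => y.2.2.1)) => //; try by pt.
by rewrite /fresh /fresh1 /live; pt.
Qed.

Definition pairs (A B : Type) (s : seq A) (t : seq B) : seq (A * B) := [seq (a, b) | a <- s, b <- t].

Lemma pairs_uniq (A B : eqType) (s : seq A) (t : seq B) : uniq s -> uniq t -> uniq (pairs s t).
Proof. by move=> us ut; apply: allpairs_uniq => // -[a b] [a' b'] _ _ [-> ->]. Qed.

Lemma mem_pairs (A B : eqType) (s : seq A) (t : seq B) a b :
  ((a, b) \in pairs s t) = (a \in s) && (b \in t).
Proof.
apply/allpairsP/andP => [[[a' b'] [/= h1 h2 [-> ->]]]|[h1 h2]]; first by split.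
by exists (a, b).
Qed.

Lemma size_pairs (A B : Type) (s : seq A) (t : seq B) : size (pairs s t) = size s * size t.
Proof. exact: size_allpairs. Qed.

(** * The automaton of a formula *)

Section Concrete.
Context (AP Ag : finType) (Phi : form AP Ag).
Local Notation encf := (@enc_form AP Ag).
Local Notation cl := (cl Phi).
Local Notation VL := (VL Phi).
Local Notation UL := (UL Phi).

Definition pend : seq (seq data * data) := pairs VL UL.
Definition vv : seq (seq data * seq data) := pairs VL VL.
Definition nodesl : seq lnode := pairs (subseqs VL) (subseqs pend).
(** The list [vv] gives in unary the bound [K] on the number of nodes in a state, and colors are at
    most [2 * K + 1]. *)
Definition states : seq lstate := pairs (iota 0 (size vv + size vv + 2)) (allseqs vv nodesl).

Lemma states_uniq : uniq states.
Proof.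
apply: pairs_uniq; first exact: iota_uniq.
apply: allseqs_uniq; apply: pairs_uniq; apply: subseqs_uniq; first exact: VL_uniq.
by apply: pairs_uniq; [exact: VL_uniq | apply/filter_uniq/cl_uniq].
Qed.

Definition dstate : finType := seq_sub states.

Lemma mem_states c s : ((c, s) \in states) =
  [&& c < size vv + size vv + 2, size s <= size vv & all (mem nodesl) s].
Proof. by rewrite mem_pairs mem_iota add0n mem_allseqs. Qed.

Lemma init_in_states : (0, [::]) \in states.
Proof. by rewrite mem_states addnS. Qed.

Definition dnext (sg : seq data) (q : lstate) : lstate :=
  lnext cl VL pend (size vv) sg q.
(** The negation of a body need not belong to the closure; it is treated by starting from the
    assignments that omit the body. *)
Definition dstart (d : data) (pol : bool) : lstate :=
  start pend [seq a <- VL | (d \in a) == pol].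
Definition body (f : form AP Ag) : form AP Ag := if f is FStrat _ g then g else f.

(** The default [q] is taken if the successor leaves the list of states; by [run_in_states] this
    does not happen on a run from an initial state. *)
Definition dstep (q : dstate) (sg : {set props Phi}) : dstate :=
  insubd q (dnext (letter sg) (val q)).
Definition dinit (b : basic Phi) (pol : bool) : dstate :=
  insubd (SeqSub init_in_states) (dstart (encf (body (val b))) pol).
Definition dcol (q : dstate) : nat := (val q).1.
(** The propositional formula is evaluated without a new recursion: the expansion laws force an
    assignment that has a successor to agree with the label on state formulas. *)
Definition dtop (sg : {set props Phi}) : bool :=
  has (fun a => (encf Phi \in a) && has (fun a' => lstep cl a (letter sg) a') VL) VL.

Definition aut : acg (props Phi) Ag := automaton dstep dinit dcol dtop (blist Phi).

Section Run.
Variables (d : data) (pol : bool) (w : nat -> {set props Phi}).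
Let I := [seq a <- VL | (d \in a) == pol].
Let r t := run VL pend (lstep cl) lful (size vv) I (fun i => letter (w i)) t.

Lemma subI : subseq I VL. Proof. exact: filter_subseq. Qed.

Lemma run_in_states t : r t \in states.
Proof.
have w0 := wf_run pend lful (size vv) (@VL_uniq _ _ Phi) (@lstep_back _ _ Phi) (fun i => letter (w i)) t subI.
rewrite -/(r t) in w0; rewrite [r t]surjective_pairing mem_states; apply/and3P; split.
- rewrite /r; case: t {w0} => [|t] /=; first by rewrite addnS.
  by rewrite /hue; case: ifP => _; lia.
- by rewrite size_pairs; exact: (size_wf (@VL_uniq _ _ Phi) w0).
- apply/allP => nd nds; rewrite /= [nd]surjective_pairing mem_pairs !mem_subseqs.
  by rewrite (wf_sub1 w0 nds) (wf_sub2 w0 nds).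
Qed.

Lemma drun_run (q : dstate) t : val q = dstart d pol -> val (drun dstep q w t) = r t.
Proof.
move=> e; elim: t => [|t IH] //=.
rewrite /dstep /dnext /lnext IH.
by rewrite insubdK //; exact: (run_in_states t.+1).
Qed.

Lemma dstart_in : dstart d pol \in states.
Proof. exact: (run_in_states 0). Qed.

End Run.

Lemma det_correct f pol w (q : dstate) : f \in subs Phi -> val q = dstart (encf f) pol ->
  parity_ok (fun t => dcol (drun dstep q w t)) <->
  ltl_sat (fun i => valuation (w i)) 0 (ltl_of (polform pol f)).
Proof.
move=> fs e.
have E : (fun t => dcol (drun dstep q w t)) =1
   (fun t => (run VL pend (lstep cl) lful (size vv) [seq a <- VL | (encf f \in a) == pol] (fun i => letter (w i)) t).1).
  by move=> t; rewrite /dcol (drun_run _ _ e).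
have sat_pol : ltl_sat (fun i => valuation (w i)) 0 (ltl_of (polform pol f)) <->
    ((encf f \in truth w 0) == pol).
  have [h1 h2] := mem_truth w 0 fs; case: pol {e E} => /=.
    by rewrite eqb_id; split.
  by rewrite eqbF_neg; split=> [h|/negP h /h2 //]; apply/negP => /h1.
have pE a u : ((a, u) \in pend) = (a \in VL) && (u \in UL) by exact: mem_pairs.
have K_ge : size VL * size VL <= size vv by rewrite size_pairs.
split=> [ok|sat].
  have [b [b0 bV bs] bf] := det_sound (@VL_uniq _ _ Phi) (@lstep_back _ _ Phi) pE (subI _ _) K_ge (parity_ok_ext E ok).
  apply/sat_pol; have := branch_sat bV bs bf 0 fs; have := mem_truth w 0 fs.
  move: b0; rewrite mem_filter => /andP[/eqP <- _].
  by move=> [h1 h2] [h3 h4]; apply/eqP/iff_bool; split=> [/h1/h4|/h3/h2].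
apply: (parity_ok_ext (fun t => esym (E t))).
apply: (det_complete (@VL_uniq _ _ Phi) (@lstep_back _ _ Phi) pE (subI _ _) K_ge (b := truth w)).
  split=> [|t|t]; [by rewrite mem_filter truth_VL andbT; apply/sat_pol | exact: truth_VL | exact: truth_step].
exact: truth_fair.
Qed.

Lemma dP (b : basic Phi) A psi pol w : val b = FStrat A psi ->
  parity_ok (fun t => dcol (drun dstep (dinit b pol) w t)) <->
  ltl_sat (fun i => valuation (w i)) 0 (ltl_of (polform pol psi)).
Proof.
move=> e; have : val b \in subs Phi by have := valP b; rewrite mem_basics => /andP[].
rewrite e => /subs_strat fs; apply: det_correct => //.
by rewrite /dinit e /= insubdK //; exact: dstart_in.
Qed.

Lemma prop_ltl (sg : {set props Phi}) f t : is_state f ->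
  ltl_sat (fun=> valuation sg) t (ltl_of f) <-> prop_sat (valuation sg) (ltl_of f).
Proof.
elim: f => //= [f IH sf|f IHf g IHg /andP[sf sg']].
  by have [h1 h2] := IH sf; split=> [h|/negP h /h1 //]; apply/negP => /h2.
have [h1 h2] := IHf sf; have [h3 h4] := IHg sg'.
by split=> [[/h1->|/h3->]|/orP[/h2|/h4]]; rewrite ?orbT //; [left|right].
Qed.

Lemma topP sg : is_state Phi -> dtop sg = prop_sat (valuation sg) (ltl_of Phi).
Proof.
move=> st; apply: iff_bool; split.
  move=> /hasP[a aV /andP[Pa /hasP[a' a'V sa]]].
  have /lstepP loc := sa.
  have key f : f \in subs Phi -> is_state f -> (encf f \in a) = prop_sat (valuation sg) (ltl_of f).
    elim: f => [|p|f IH|f IHf h IHh|f IH|f IHf h IHh|A f IH] fs //= sf;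
      have /eqP /= e := loc _ fs; rewrite e.
    - by [].
    - by rewrite letter_prop.
    - by rewrite IH ?(subs_neg fs).
    - by case/andP: sf => s1 s2; have [f1 f2] := subs_or fs; rewrite IHf ?IHh.
    - exact: (letter_strat sg fs isT).
  by rewrite -key // subs_self.
(* The truth along the word that repeats [sg] provides the assignment and its successor. *)
move=> /(prop_ltl sg 0 st) h; apply/hasP; exists (truth (fun=> sg) 0); first exact: truth_VL.
apply/andP; split; first by apply/(mem_truth _ _ (subs_self Phi)).
by apply/hasP; exists (truth (fun=> sg) 1); [exact: truth_VL | exact: truth_step].
Qed.

Lemma aut_accepts (Ac : finType) (T : cgt Ag Ac (props Phi)) : is_state Phi ->
  accepts aut T <-> well_formed T.
Proof.
move=> st; apply: automaton_accepts => [b|b A psi pol w|sg].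
- exact: mem_blist.
- exact: dP.
- exact: topP.
Qed.
End Concrete.

(** * Computability of the exponential enumerations *)

Section Enumerate.
Context (X : Type) {cX : code X} (b : X -> nat).
Hypothesis b_ge : forall x, sz x <= b x.
Let b_ge2 x : 1 < b x := leq_trans (sz_ge2 x) (b_ge x).
Context (A : Type) {cA : code A}.

Lemma esize_subseqs (s : seq A) : esize (subseqs s) <= 2 ^ size s * (esize s).+1 + 1.
Proof.
apply: esize_seq_le; first by rewrite size_subseqs.
elim: s => [|x s IH] r s1 s2 /=.
  by case: s1 => [|? []] // [<-].
move=> e; have lt : size s1 < size (subseqs s ++ map (cons x) (subseqs s)).
  by rewrite e size_cat /= addnS ltnS leq_addr.
have er : r = nth r (subseqs s ++ map (cons x) (subseqs s)) (size s1).
  by rewrite e nth_cat ltnn subnn.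
rewrite esize_cons er nth_cat; case: ltnP => h.
  have := IH (nth r (subseqs s) (size s1)) (take (size s1) (subseqs s)) (drop (size s1).+1 (subseqs s)).
  by rewrite -drop_nth // cat_take_drop => /(_ erefl); lia.
rewrite size_cat size_map in lt; have lt' : size s1 - size (subseqs s) < size (subseqs s) by lia.
rewrite (nth_map r) // esize_cons; move: (_ - _) lt' => k lt'.
have := IH (nth r (subseqs s) k) (take k (subseqs s)) (drop k.+1 (subseqs s)).
by rewrite -drop_nth // cat_take_drop => /(_ erefl); lia.
Qed.

Lemma ctime_subseqs (l : X -> seq A) : ctime b l -> pb b (fun x => 2 ^ size (l x)) ->
  ctime b (fun x => subseqs (l x)).
Proof.
move=> hl hp.
apply: (ctime_ext (g := fun x => foldr (fun a acc => acc ++ [seq a :: r | r <- acc]) [:: [::]] (l x))).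
  by move=> x; elim: (l x) => //= a s ->.
apply: (@ctime_foldr _ _ _ b_ge _ _ _ _ l (fun=> [:: [::]]) (fun a acc x => acc ++ [seq a :: r | r <- acc])
   (fun x => 2 ^ size (l x) * (esize (l x)).+1 + 1)) => //.
- exact: ctime_const.
- by pt.
- move=> x s1 s2 e; have -> : foldr (fun a acc => acc ++ [seq a :: r | r <- acc]) [:: [::]] s2 = subseqs s2.
    by elim: (s2) => //= a s ->.
  apply: leq_trans (esize_subseqs _) _; rewrite leq_add2r leq_mul //.
    by rewrite leq_exp2l // e size_cat leq_addl.
  by rewrite ltnS e; exact: esize_suffix.
- have h := ctime_size hl.
  by repeat first [exact: h | exact: hp | apply: pb_const | apply: (pb_succ b_ge2) | apply: (pb_add b_ge2) | apply: pb_mul].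
Qed.

Lemma esize_allseqs (B : Type) (ks : seq B) (Y : seq A) :
  esize (allseqs ks Y) <= (size Y).+1 ^ size ks * (size ks * (esize Y).+1 + 1).+1 + 1.
Proof.
apply: esize_seq_le; first exact: size_allseqs.
move=> r s1 s2 e; have : List.In r (allseqs ks Y).
  by rewrite e; apply/List.in_or_app; right; left.
move=> {e s1 s2}; elim: ks r => [|k ks IH] r /=; first by case=> // <-; rewrite esize_nil addn1.
case=> [<-|]; first by rewrite esize_nil addn1.
move=> /List.in_concat[l [/List.in_map_iff[y [<- yY]] /List.in_map_iff[r' [<- /IH h]]]].
have [s1 [s2 eY]] := List.in_split _ _ yY.
have eY' : Y = s1 ++ y :: s2 := eY.
pose proof (esize_mem y s1 s2) as h1; rewrite -eY' in h1.
by rewrite esize_cons mulSn; lia.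
Qed.

(** The step of a fold must be polynomial time in its parameter, and [Y x] is not so in [x]. Hence
    the fold is run on the pair [(l x, Y x)], with a bound that includes the number of sequences. *)
Lemma ctime_allseqs (B : Type) {cB : code B} (l : X -> seq B) (Y : X -> seq A) :
  ctime b l -> ctime b Y -> pb b (fun x => (size (Y x)).+1 ^ size (l x)) ->
  ctime b (fun x => allseqs (l x) (Y x)).
Proof.
move=> hl hY hp.
pose G (Y : seq A) (acc : seq (seq A)) := [::] :: flatten [seq [seq y :: r | r <- acc] | y <- Y].
have hpair := ctime_pair b_ge hl hY.
apply: (ctime_ext (g := fun x => foldr (fun _ acc => G (Y x) acc) [:: [::]] (l x))).
  by move=> x; elim: (l x) => //= a s ->.
have key : ctime (fun y : seq B * seq A => sz y + (size y.2).+1 ^ size y.1)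
    (fun y => foldr (fun _ acc => G y.2 acc) [:: [::]] y.1).
  have ge (y : seq B * seq A) : sz y <= sz y + (size y.2).+1 ^ size y.1 by exact: leq_addr.
  have ge2 y : 1 < sz y + (size y.2).+1 ^ size y.1 := leq_trans (sz_ge2 y) (ge y).
  apply: (@ctime_foldr _ _ _ ge _ _ _ _ (fun y => y.1) (fun=> [:: [::]]) (fun _ acc y => G y.2 acc)
   (fun y => (size y.2).+1 ^ size y.1 * (size y.1 * (esize y.2).+1 + 1).+1 + 1)) => //.
  - by apply: (ctime_of_ptime ge); pt.
  - by apply: ctime_const.
  - by rewrite /G; pt.
  - move=> y s1 s2 e; have -> : foldr (fun _ acc => G y.2 acc) [:: [::]] s2 = allseqs s2 y.2.
      by elim: (s2) => //= a s ->.
    have le : size s2 <= size y.1 by rewrite e size_cat leq_addl.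
    apply: leq_trans (esize_allseqs _ _) _; rewrite leq_add2r leq_mul ?leq_pexp2l //.
    by rewrite ltnS leq_add2r leq_mul.
  - have h1 : pb (fun y : seq B * seq A => sz y + (size y.2).+1 ^ size y.1) (fun y => (size y.2).+1 ^ size y.1).
      by apply: pb_le (pb_id _) => y; exact: leq_addl.
    have h2 : pb (fun y : seq B * seq A => sz y + (size y.2).+1 ^ size y.1) (fun y => size y.1).
      apply: pb_le (pb_id _) => y; apply: leq_trans (ge y); rewrite /sz; case: y => s t.
      by rewrite esize_prod /=; pose proof (size_esize s); lia.
    have h3 : pb (fun y : seq B * seq A => sz y + (size y.2).+1 ^ size y.1) (fun y => esize y.2).
      apply: pb_le (pb_id _) => y; apply: leq_trans (ge y); rewrite /sz; case: y => s t.
      by rewrite esize_prod /=; lia.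
    by repeat first [exact: h1 | exact: h2 | exact: h3 | apply: pb_const | apply: (pb_succ ge2) | apply: (pb_add ge2) | apply: pb_mul].
apply: (ctime_comp_gen b_ge key hpair); apply: (pb_add b_ge2) => //=.
exact: (pb_succ b_ge2 (ctime_size hpair)).
Qed.

Lemma ctime_iota (f : X -> nat) : ctime b f -> ctime b (fun x => iota 0 (f x)).
Proof.
move=> hf; apply: (ctime_app1 b_ge (F := iota 0)) => //.
(* The proper prefixes of a list of length [n] have the sizes 0 to [n - 1]. *)
apply: (ctime_ext (g := fun n => [seq size y.1 | y <- prefs (nseq n Nil)])).
  move=> n; apply: (@eq_from_nth _ 0) => [|i]; first by rewrite size_iota size_map size_prefs size_nseq.
  rewrite size_iota => lt; rewrite (nth_map ([::], Nil)) ?size_prefs ?size_nseq //.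
  by rewrite nth_prefs ?size_nseq //= nth_iota // size_take size_nseq lt.
have h : ptime (fun n => nseq n Nil)
  by apply: (ctime_recode (g := fun n : nat => n)) => [n|]; [rewrite nat_data | exact: ptime_id].
by pt.
Qed.
End Enumerate.

Lemma ctime_pairs (X : Type) {cX : code X} (b : X -> nat) (A B : Type) {cA : code A} {cB : code B}
  (l : X -> seq A) (m : X -> seq B) : (forall x, sz x <= b x) ->
  ctime b l -> ctime b m -> ctime b (fun x => pairs (l x) (m x)).
Proof.
move=> b_ge hl hm; apply: (ctime_app2 b_ge (F := @pairs A B)) => //.
by rewrite /pairs; pt.
Qed.

(** * The program *)

(** A state of the game automaton without dependent types: the tags 0, 1 and 2 mark the initial
    state, the visiting state and the strategic ones. The other components are dummies for the tags
    0 and 1. *)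
Notation lname := (nat * (data * (bool * lstate)))%type.
(** The lists that the program computes once and for all, in the order of [env]. *)
Notation lenv := (seq data * (seq (seq data) * (seq (seq data * data) * (nat * seq lstate))))%type.

Definition tnext (e : lenv) (sg : seq data) (q : lstate) : lstate :=
  let q' := lnext e.1 e.2.1 e.2.2.1 e.2.2.2.1 sg q in
  if q' \in e.2.2.2.2 then q' else q.
Definition tstart (e : lenv) (d : data) (pol : bool) : lstate :=
  start e.2.2.1 [seq a <- e.2.1 | (d \in a) == pol].
(** The encoded atom of the move to [t]. The coalition is copied from the encoding of the basic
    subformula; [Nil] is the empty coalition. *)
Definition temit (t : lname) : data :=
  Node (dnat 2) (Node (enc t)
    (Node (if (t.1 == 2) && ~~ t.2.2.1 then dnat 1 else dnat 0)
          (if t.1 == 2 then dhd (dtl t.2.1) else Nil))).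
Definition name0 : lname := (0, (Nil, (false, (0, [::])))).
Definition name1 : lname := (1, (Nil, (false, (0, [::])))).
Definition tlaunch (e : lenv) (sg : seq data) (d : data) : lname :=
  (2, (d, (Node (dnat 1) d \in sg, tnext e sg (tstart e (dtl (dtl d)) (Node (dnat 1) d \in sg))))).
Definition tconj (s : seq data) : data :=
  foldr (fun a acc => Node (dnat 3) (Node a acc)) (temit name1) s.
Definition tvisit (e : lenv) (bl : seq data) (sg : seq data) : data :=
  tconj [seq temit (tlaunch e sg d) | d <- bl].
Definition ttop (e : lenv) (d : data) (sg : seq data) : bool :=
  has (fun a => (d \in a) && has (fun a' => lstep e.1 a sg a') e.2.1) e.2.1.
Definition tdelta (e : lenv) (bl : seq data) (d : data) (q : lname) (sg : seq data) : data :=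
  if q.1 == 0 then (if ttop e d sg then tvisit e bl sg else Node (dnat 1) Nil)
  else if q.1 == 1 then tvisit e bl sg
  else temit (2, (q.2.1, (q.2.2.1, tnext e sg q.2.2.2))).
Definition tcolor (q : lname) : nat := if q.1 == 2 then q.2.2.2.1 else 0.
Definition tnames (e : lenv) (bl : seq data) : seq lname :=
  name0 :: name1 :: [seq (2, x) | x <- pairs bl (pairs [:: true; false] e.2.2.2.2)].
Definition tout (e : lenv) (bl : seq data) (d : data) (letters : seq (seq data)) : data :=
  Node (enc name0) (Node
    (enc [seq Node (enc q) (enc (tcolor q)) | q <- tnames e bl])
    (enc [seq Node (enc y.1) (Node (enc y.2) (tdelta e bl d y.1 y.2)) | y <- pairs (tnames e bl) letters])).

Lemma ptime_tnext : ptime (fun y : lenv * (seq data * lstate) => tnext y.1 y.2.1 y.2.2).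
Proof.
rewrite /tnext; have h : ptime (fun y : lenv * (seq data * lstate) =>
    lnext y.1.1 y.1.2.1 y.1.2.2.1 y.1.2.2.2.1 y.2.1 y.2.2).
  apply: (ctime_comp _ ptime_lnext (f := fun y : lenv * (seq data * lstate) =>
    (y.1.1, (y.1.2.1, (y.1.2.2.1, (y.1.2.2.2.1, (y.2.1, y.2.2))))))) => //.
  by pt.
by pt.
Qed.

Lemma ptime_tstart : ptime (fun y : lenv * (data * bool) => tstart y.1 y.2.1 y.2.2).
Proof. by rewrite /tstart /start /fresh1; pt. Qed.

Lemma ptime_temit : ptime (fun t : lname => temit t).
Proof. by rewrite /temit; pt. Qed.

Lemma ptime_tlaunch : ptime (fun y : lenv * (seq data * data) => tlaunch y.1 y.2.1 y.2.2).
Proof.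
rewrite /tlaunch; have h1 : ptime (fun y : lenv * (seq data * data) => Node (dnat 1) y.2.2 \in y.2.1) by pt.
have h2 : ptime (fun y : lenv * (seq data * data) =>
   tnext y.1 y.2.1 (tstart y.1 (dtl (dtl y.2.2)) (Node (dnat 1) y.2.2 \in y.2.1))).
  apply: (ctime_app3 _ ptime_tnext) => //; try by pt.
  by apply: (ctime_app3 _ ptime_tstart) => //; pt.
by pt.
Qed.

Lemma ptime_tconj : ptime tconj.
Proof.
apply: (@ctime_foldr _ _ _ _ _ _ _ _ (fun s => s) (fun=> temit name1) (fun a acc _ => Node (dnat 3) (Node a acc))
  (fun s => esize s * 12 + dsize (temit name1))) => //; try by pt.
- move=> s s1 s2 ->; apply: (@leq_trans (esize s2 * 12 + dsize (temit name1))); last first.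
    by rewrite leq_add2r leq_mul2r esize_suffix.
  rewrite enc_data; elim: s2 => [|a s2 IH]; first by rewrite /= leq_addl.
  have e t : dsize (Node (dnat 3) (Node a t)) = dsize a + dsize t + 9 by rewrite /=; lia.
  by move: IH; set F := foldr _ _ => IH; rewrite esize_cons enc_data -[F (a :: s2)]/(Node (dnat 3) (Node a (F s2))) e; lia.
- by repeat first [exact: (pb_esize (fun=> leqnn _)) | exact: pb_const | apply: pb_mul | apply: (pb_add (@sz_ge2 _ _))].
Qed.

Lemma ptime_tvisit : ptime (fun y : lenv * (seq data * seq data) => tvisit y.1 y.2.1 y.2.2).
Proof.
apply: (ctime_app1 _ ptime_tconj) => //.
apply: (@ctime_map _ _ _ _ _ _ _ _ (fun y => y.2.1) (fun d y => temit (tlaunch y.1 y.2.2 d))) => //; first by pt.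
apply: (ctime_app1 _ ptime_temit) => //.
by apply: (ctime_app3 _ ptime_tlaunch) => //; pt.
Qed.

Lemma ptime_ttop : ptime (fun y : lenv * (data * seq data) => ttop y.1 y.2.1 y.2.2).
Proof. by rewrite /ttop; pt. Qed.

Lemma ptime_tdelta : ptime (fun y : (lenv * (seq data * data)) * (lname * seq data) =>
  tdelta y.1.1 y.1.2.1 y.1.2.2 y.2.1 y.2.2).
Proof.
set E := (_ * _)%type; rewrite /tdelta.
have h1 : ptime (fun y : E => ttop y.1.1 y.1.2.2 y.2.2) by apply: (ctime_app3 _ ptime_ttop) => //; pt.
have h2 : ptime (fun y : E => tvisit y.1.1 y.1.2.1 y.2.2) by apply: (ctime_app3 _ ptime_tvisit) => //; pt.
have h3 : ptime (fun y : E => tnext y.1.1 y.2.2 y.2.1.2.2.2) by apply: (ctime_app3 _ ptime_tnext) => //; pt.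
have h4 : ptime (fun y : E => temit (2, (y.2.1.2.1, (y.2.1.2.2.1, tnext y.1.1 y.2.2 y.2.1.2.2.2)))).
  by apply: (ctime_app1 _ ptime_temit) => //; pt.
by pt.
Qed.

Lemma ptime_tnames : ptime (fun y : lenv * seq data => tnames y.1 y.2).
Proof.
rewrite /tnames; have h : ptime (fun y : lenv * seq data => pairs y.2 (pairs [:: true; false] y.1.2.2.2.2)).
  by apply: ctime_pairs => //; [pt | apply: ctime_pairs => //; pt].
by pt.
Qed.

Lemma ptime_tout : ptime (fun y : (lenv * (seq data * data)) * seq (seq data) =>
  tout y.1.1 y.1.2.1 y.1.2.2 y.2).
Proof.
set E := (_ * _)%type; rewrite /tout.
have h1 : ptime (fun y : E => tnames y.1.1 y.1.2.1) by apply: (ctime_app2 _ ptime_tnames) => //; pt.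
have h2 : ptime (fun y : E => [seq Node (enc q) (enc (tcolor q)) | q <- tnames y.1.1 y.1.2.1]).
  by rewrite /tcolor; pt.
have h3 : ptime (fun y : E => [seq Node (enc z.1) (Node (enc z.2) (tdelta y.1.1 y.1.2.1 y.1.2.2 z.1 z.2))
     | z <- pairs (tnames y.1.1 y.1.2.1) y.2]).
  apply: (@ctime_map _ _ _ _ _ _ _ _ (fun y : E => pairs (tnames y.1.1 y.1.2.1) y.2)
     (fun z y => Node (enc z.1) (Node (enc z.2) (tdelta y.1.1 y.1.2.1 y.1.2.2 z.1 z.2)))) => //.
    by apply: ctime_pairs => //; pt.
  have h4 : ptime (fun y : (lname * seq data) * E => tdelta y.2.1.1 y.2.1.2.1 y.2.1.2.2 y.1.1 y.1.2).
    apply: (ctime_comp _ ptime_tdelta (f := fun y : (lname * seq data) * E => ((y.2.1.1, (y.2.1.2.1, y.2.1.2.2)), (y.1.1, y.1.2)))) => //.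
    by pt.
  by pt.
by pt.
Qed.

Lemma map_pairs (A B A' B' : Type) (f : A -> A') (g : B -> B') s t :
  pairs (map f s) (map g t) = [seq (f y.1, g y.2) | y <- pairs s t].
Proof.
rewrite /pairs map_allpairs /= allpairs_mapl; elim: s => //= a s IH.
by rewrite -IH /= -!map_comp.
Qed.

Lemma enc_seq_data (s : seq data) : enc s = dlist s.
Proof. by rewrite enc_seq (eq_map (g := id)) ?map_id // => a; exact: enc_data. Qed.

(** * The program describes the automaton *)

Section Describe.
Context (AP Ag : finType) (Phi : form AP Ag).
Local Notation encf := (@enc_form AP Ag).
Local Notation dstate := (dstate Phi).
Local Notation astate := (astate Phi dstate).

Definition env : lenv := (cl Phi, (VL Phi, (pend Phi, (size (vv Phi), states Phi)))).
Definition bdata : seq data := [seq d <- cl Phi | dhd d == dnat 6].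
Definition pdata : seq data :=
  [seq Node (dnat 0) (enc_fin p) | p <- enum AP] ++ [seq Node (dnat 1) d | d <- bdata].
Definition description : data := tout env bdata (encf Phi) (subseqs pdata).

Definition rep (q : astate) : lname :=
  match q with
  | None => name0
  | Some None => name1
  | Some (Some (b, pol, s)) => (2, (encf (val b), (pol, val s)))
  end.
Definition name (q : astate) : data := enc (rep q).

Lemma rep_inj : injective rep.
Proof.
move=> [[[[b pol] s]|]|] [[[[b' pol'] s']|]|] //= [] // /enc_form_inj/val_inj-> -> e.
by do 3!f_equal; apply: val_inj.
Qed.

Definition dlisting : seq dstate := pmap insub (states Phi).

Lemma val_dlisting : map val dlisting = states Phi.
Proof.
rewrite /dlisting (pmap_filter (@insubK _ _ dstate)); apply/all_filterP/allP => q h.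
by rewrite /= isSome_insub.
Qed.

Definition listing : seq astate :=
  [:: None, Some None & [seq Some (Some (y.1, y.2.1, y.2.2)) |
     y <- pairs (blist Phi) (pairs [:: true; false] dlisting)]].

Lemma rep_listing : map rep listing = tnames env bdata.
Proof.
rewrite /listing /tnames /= -map_comp; do 2!congr cons.
have e3 : pairs [:: true; false] (states Phi) = [seq (y.1, val y.2) | y <- pairs [:: true; false] dlisting].
  by rewrite -[in LHS]val_dlisting -[X in pairs X _](map_id) map_pairs.
rewrite /bdata -enc_blist e3 map_pairs -map_comp.
by apply: eq_map => -[b [pol s]].
Qed.

Lemma listing_perm : perm_eq listing (enum astate).
Proof.
apply: uniq_perm; rewrite ?enum_uniq //.
  apply/(@map_uniq _ _ rep); rewrite rep_listing /= /tnames.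
  rewrite /= !inE /= map_inj_uniq; last by move=> ? ? [].
  have no n : n != 2 -> forall x, (n, x) \notin [seq (2, z) | z <- pairs bdata (pairs [:: true; false] env.2.2.2.2)].
    by move=> n2 x; apply/mapP => -[z _ [e _]]; rewrite e in n2.
  rewrite (no 0) // (no 1) //=; apply: pairs_uniq; first by rewrite filter_uniq ?cl_uniq.
  by apply: pairs_uniq => //; exact: states_uniq.
move=> q; rewrite mem_enum inE; case: q => [[[[b pol] s]|]|] //=.
rewrite !inE /=; apply/mapP; exists (b, (pol, s)) => //.
rewrite !mem_pairs mem_blist /= !inE; apply/andP; split; first by case: (pol).
by rewrite -(mem_map val_inj) val_dlisting; exact: valP.
Qed.

Lemma enc_plist : map (@enc_prop AP Ag Phi) (plist Phi) = pdata.
Proof.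
rewrite /plist /pdata map_cat -!map_comp /bdata -enc_blist -map_comp.
by congr (_ ++ _); apply: eq_map.
Qed.

Definition letters : seq {set props Phi} := [seq [set x in l] | l <- subseqs (plist Phi)].

Lemma order_set l : l \in subseqs (plist Phi) -> order [set x in l] = l.
Proof.
rewrite mem_subseqs => h; rewrite [RHS](subseq_uniqP (plist_uniq Phi) h).
by apply: eq_filter => x; rewrite inE.
Qed.

Lemma letter_letters : map (@letter AP Ag Phi) letters = subseqs pdata.
Proof.
rewrite -enc_plist map_subseqs -map_comp; apply/eq_in_map => l h.
by rewrite /= /letter order_set.
Qed.

Lemma letters_perm : perm_eq letters (enum {set props Phi}).
Proof.
apply: uniq_perm; rewrite ?enum_uniq //.
  apply: (@map_uniq _ _ (@order AP Ag Phi)); rewrite -map_comp.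
  have -> : map (@order AP Ag Phi \o (fun l => [set x in l])) (subseqs (plist Phi)) = subseqs (plist Phi).
    by rewrite -[RHS]map_id; apply/eq_in_map => l h; rewrite /= order_set.
  by rewrite subseqs_uniq // plist_uniq.
move=> sg; rewrite mem_enum inE; apply/mapP; exists (order sg).
  by rewrite mem_subseqs filter_subseq.
by apply/setP => x; rewrite inE mem_order.
Qed.

Lemma order_perm (sg : {set props Phi}) : perm_eq (order sg) (enum sg).
Proof.
apply: uniq_perm; rewrite ?enum_uniq ?filter_uniq ?plist_uniq // => x.
by rewrite mem_order mem_enum.
Qed.

Lemma coal_data (b : basic Phi) : dhd (dtl (encf (val b))) = enc_set (coal (val b)).
Proof. by have [A [psi ->]] := basics_strat (valP b). Qed.

Lemma body_data (b : basic Phi) : dtl (dtl (encf (val b))) = encf (body (val b)).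
Proof. by have [A [psi ->]] := basics_strat (valP b). Qed.

Lemma temit_rep q : temit (rep q) = enc_pbf (enc_move name) (PAtom (move_to q)).
Proof.
have e0 : enc_set (set0 : {set Ag}) = Nil by rewrite /enc_set enum_set0.
rewrite /= /temit /move_to /name; case: q => [[[[b pol] s]|]|] /=; rewrite ?e0 //.
by rewrite coal_data; case: pol.
Qed.

Lemma tnext_dstep (sg : {set props Phi}) (s : dstate) : tnext env (letter sg) (val s) = val (dstep s sg).
Proof. by rewrite /tnext /dstep val_insubd. Qed.

Lemma tstart_dinit (b : basic Phi) pol : tstart env (encf (body (val b))) pol = val (dinit b pol).
Proof. by rewrite /dinit insubdK //; exact: (dstart_in _ _ (fun=> set0)). Qed.

Lemma tlaunch_rep (b : basic Phi) (sg : {set props Phi}) : tlaunch env (letter sg) (encf (val b)) = rep (launch (@dstep _ _ Phi) (@dinit _ _ Phi) b sg).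
Proof.
have e : (Node (dnat 1) (encf (val b)) \in letter sg) = (inr b \in sg) by exact: (mem_letter sg (inr b)).
by rewrite /tlaunch /launch /= e body_data tstart_dinit tnext_dstep.
Qed.

Lemma tvisit_visit (sg : {set props Phi}) : tvisit env bdata (letter sg) =
  enc_pbf (enc_move name) (visit (@dstep _ _ Phi) (@dinit _ _ Phi) (blist Phi) sg).
Proof.
rewrite /tvisit /visit /bdata -enc_blist -map_comp.
elim: (blist Phi) => [|b l IH]; first exact: (temit_rep (Some None)).
by rewrite [map _ _]/= [tconj _]/= -/(tconj _) IH [foldr _ _ (b :: l)]/= tlaunch_rep temit_rep.
Qed.

Lemma tdelta_adelta q sg : tdelta env bdata (encf Phi) (rep q) (letter sg) =
  enc_pbf (enc_move name) (delta (q : aut Phi) sg).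
Proof.
case: q => [[[[b pol] s]|]|].
- rewrite /tdelta [delta _ _]/= -temit_rep /= tnext_dstep.
  by [].
- exact: tvisit_visit.
rewrite /tdelta [delta _ _]/= /= -[ttop _ _ _]/(dtop sg).
by case: (dtop sg) => //; exact: tvisit_visit.
Qed.

Lemma describes_aut : describes description (aut Phi).
Proof.
exists name, listing, letters, (@order AP Ag Phi); split.
- move=> q q' e; have inj : codeI lname by exact _.
  by apply: rep_inj; exact: (inj _ _ e).
- exact: listing_perm.
- exact: letters_perm.
- exact: order_perm.
rewrite /description /tout -rep_listing -letter_letters !enc_seq_data; congr (Node _ (Node _ _)).
  rewrite -map_comp; congr dlist; apply: eq_map => q /=.
  by rewrite enc_nat; case: q => [[[[b pol] s]|]|].
rewrite map_pairs -map_comp /pairs map_allpairs; congr dlist.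
apply: eq_allpairs => q sg /=.
by rewrite enc_seq_data tdelta_adelta.
Qed.

(** * Bounds *)

Lemma size_VL : size (VL Phi) <= 2 ^ fsize Phi.
Proof. by rewrite /VL size_subseqs leq_exp2l // size_cl. Qed.

Lemma size_UL : size (UL Phi) <= fsize Phi.
Proof. by rewrite size_filter; apply: leq_trans (count_size _ _) (size_cl _). Qed.

Lemma size_vv : size (vv Phi) <= 2 ^ (2 * fsize Phi).
Proof. by rewrite size_pairs mul2n -addnn expnD leq_mul // size_VL. Qed.

Lemma size_pend : size (pend Phi) <= 2 ^ (2 * fsize Phi).
Proof.
rewrite size_pairs mul2n -addnn expnD leq_mul ?size_VL //.
exact: leq_trans size_UL (ltnW (ltn_expl _ _)).
Qed.

Lemma fsize_gt0 : 0 < fsize Phi. Proof. by case: Phi. Qed.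

(** With [n] the size of [Phi], there are fewer than [2 ^ 2 ^ (2 * n + 2)] nodes and a state has at
    most [2 ^ (2 * n)] of them; the exponent [4 * n + 2] is at most [6 * n] as [n] is positive. *)
Lemma size_allseqs_bound :
  (size (nodesl Phi)).+1 ^ size (vv Phi) <= 2 ^ (2 ^ (6 * fsize Phi)).
Proof.
have n0 := fsize_gt0; set n := fsize Phi in n0 *.
have hN : size (nodesl Phi) < 2 ^ (2 ^ (2 * n + 2)).
  rewrite size_pairs !size_subseqs -expnD ltn_exp2l //.
  apply: (@leq_ltn_trans (2 ^ (2 * n) + 2 ^ (2 * n))).
    rewrite leq_add ?size_pend // leq_exp2l //; apply: (leq_trans (size_cl Phi)).
    by rewrite -/n; lia.
  by rewrite addnn -mul2n -expnS ltn_exp2l //; lia.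
apply: (@leq_trans ((2 ^ (2 ^ (2 * n + 2))) ^ size (vv Phi))).
  by case: (size (vv Phi)) => // k; rewrite leq_exp2r.
rewrite -expnM leq_exp2l //; apply: (@leq_trans (2 ^ (2 * n + 2) * 2 ^ (2 * n))).
  by rewrite leq_mul // size_vv.
by rewrite -expnD leq_exp2l //; lia.
Qed.

Lemma size_states : size (states Phi) <= 2 ^ (2 * fsize Phi + 2) * 2 ^ (2 ^ (6 * fsize Phi)).
Proof.
rewrite size_pairs size_iota leq_mul //.
  have := size_vv; rewrite expnD; have : 0 < 2 ^ (2 * fsize Phi) by rewrite expn_gt0.
  by set u := 2 ^ _; rewrite -[2 ^ 2]/4; lia.
by apply: leq_trans (size_allseqs _ _) size_allseqs_bound.
Qed.

Lemma card_dstate : #|dstate| = size (states Phi).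
Proof. by rewrite card_seq_sub // states_uniq. Qed.

Lemma card_basic : #|basic Phi| <= fsize Phi.
Proof.
rewrite cardE -(size_map val) -size_subs; apply: uniq_leq_size.
  by rewrite map_inj_uniq ?enum_uniq //; exact: val_inj.
move=> _ /mapP[b _ ->]; have := valP b.
by rewrite mem_basics => /andP[].
Qed.

Lemma card_astate : #|astate| = (#|basic Phi| * 2 * size (states Phi)).+2.
Proof. by rewrite !card_option !card_prod card_bool card_dstate. Qed.

(** For a formula of size 1 the logarithm in the bound of [aut_size] vanishes and the bound is a
    constant; without basic subformulas the automaton has just two states. *)
Lemma basic_small : fsize Phi <= 1 -> #|basic Phi| = 0.
Proof.
have key (f : form AP Ag) : fsize f <= 1 -> basics f = [::].
  have pos (g : form AP Ag) : 0 < fsize g by case: g.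
  by case: f => //= [g|g h|g|g h|A g]; have := pos g; lia.
move=> /key e; apply: eq_card0 => b; exfalso.
have h : val b \in basics Phi by exact: valP.
by move: (val b) h => g; rewrite e.
Qed.

Lemma aut_index : acg_index (aut Phi) <= 2 ^ (16 * fsize Phi).
Proof.
have n0 := fsize_gt0.
apply: (@leq_trans (size (vv Phi) + size (vv Phi) + 2)).
  rewrite -[leqRHS](size_iota 0); apply: uniq_leq_size; first exact: undup_uniq.
  move=> c; rewrite mem_undup => /codomP[q ->]; rewrite mem_iota add0n.
  case: q => [[[[b pol] s]|]|] /=; rewrite ?addnS //.
  have h : val s \in states Phi by exact: valP.
  by rewrite /dcol; move: (val s) h => [k l]; rewrite mem_states -!addnS => /and3P[].
apply: (@leq_trans (2 ^ (2 * fsize Phi + 2))); last by rewrite leq_exp2l //; lia.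
have := size_vv; rewrite expnD; have : 0 < 2 ^ (2 * fsize Phi) by rewrite expn_gt0.
by set u := 2 ^ _; rewrite -[2 ^ 2]/4; lia.
Qed.

Lemma aut_size :
  acg_size (aut Phi) <= 16 * 2 ^ (2 ^ (16 * (fsize Phi * trunc_log 2 (fsize Phi)))).
Proof.
have le2 : acg_size (aut Phi) <= #|astate| + #|astate|.
  by rewrite /acg_size leq_add2l card_moves.
apply: leq_trans le2 _; rewrite card_astate.
case: (leqP (fsize Phi) 1) => [/basic_small->|n2].
  by rewrite !mul0n; have : 0 < 2 ^ (2 ^ (16 * (fsize Phi * trunc_log 2 (fsize Phi)))) by [rewrite expn_gt0]; lia.
set n := fsize Phi in n2 *.
(* From size 2 on the logarithm is at least 1, so that exponents linear in [n] fit into the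
   bound. *)
have nL : n <= n * trunc_log 2 n.
  by rewrite -{1}[n]muln1 leq_mul // trunc_log_gt0.
set S := size (states Phi).
have hS : S <= 2 ^ (2 * n + 2) * 2 ^ (2 ^ (6 * n)) by exact: size_states.
have hb : #|basic Phi| <= 2 ^ n.
  by apply: leq_trans card_basic _; exact: ltnW (ltn_expl _ _).
have e1 : #|basic Phi| * 2 * S <= 2 ^ (3 * n + 3 + 2 ^ (6 * n)).
  apply: (@leq_trans (2 ^ n * 2 ^ 1 * (2 ^ (2 * n + 2) * 2 ^ (2 ^ (6 * n))))).
    by rewrite leq_mul // leq_mul2r hb orbT.
  by rewrite -!expnD leq_exp2l //; lia.
have e2 : 3 * n + 3 + 2 ^ (6 * n) <= 2 ^ (16 * (n * trunc_log 2 n)).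
  apply: (@leq_trans (2 ^ (6 * n + 1))); last by rewrite leq_exp2l //; lia.
  by rewrite expnD expn1; have := ltn_expl (6 * n) (ltnSn 1); lia.
have {e1 e2} : #|basic Phi| * 2 * S <= 2 ^ (2 ^ (16 * (n * trunc_log 2 n))).
  by apply: leq_trans e1 _; rewrite leq_exp2l.
have : 0 < 2 ^ (2 ^ (16 * (n * trunc_log 2 n))) by rewrite expn_gt0.
by set Y := 2 ^ (2 ^ _); set x := _ * 2 * S; lia.
Qed.
End Describe.

(* The running time *)
Transparent enc.
Instance code_form (AP Ag : finType) : code (form AP Ag) := @enc_form AP Ag.
Lemma enc_formE (AP Ag : finType) (f : form AP Ag) : enc f = enc_form f.
Proof. by []. Qed.
Opaque enc.

Section Time.
Context (AP Ag : finType).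
Implicit Types Phi : form AP Ag.

(** A bound on the encoding of one node of a formula: its tag, the unary rank of a proposition, or a
    list of at most [#|Ag|] unary ranks. The summand 30 also leaves room for the coefficients in the
    exponents of the other bounds. *)
Definition kappa : nat := 30 + 2 * #|AP| + #|Ag| * (2 * #|Ag| + 2).

Lemma dsize_dnat n : dsize (dnat n) = n.*2.+1.
Proof. by rewrite -enc_nat esize_nat. Qed.

Lemma dsize_enc_fin (X : finType) (x : X) : dsize (enc_fin x) <= 2 * #|X| + 1.
Proof. rewrite dsize_dnat addn1 ltnS mul2n leq_double; exact: ltnW (ltn_ord _). Qed.

Lemma dsize_enc_set (A : {set Ag}) : dsize (enc_set A) <= #|Ag| * (2 * #|Ag| + 2) + 1.
Proof.
rewrite /enc_set -enc_seq_data.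
pose proof (@esize_seq_le data _ (map (@enc_fin Ag) (enum A)) #|Ag| (2 * #|Ag| + 1)) as h.
apply: (leq_trans (h _ _)).
- by rewrite size_map -cardE max_card.
- move=> x s1 s2 e; rewrite enc_data; have : x \in map (@enc_fin Ag) (enum A) by rewrite e mem_cat mem_head orbT.
  by move=> /mapP[y _ ->]; apply: leq_trans (dsize_enc_fin _) _; rewrite addn1.
- by lia.
Qed.

Lemma dsize_enc_form Phi : (dsize (enc_form Phi)).+1 <= kappa * fsize Phi.
Proof.
elim: Phi => [|p|f IH|f IHf g IHg|f IH|f IHf g IHg|A f IH] /=; rewrite ?mulnS ?mulnDr.
- by rewrite /kappa; lia.
- by have := dsize_enc_fin p; rewrite /kappa; lia.
- by move: IH; rewrite /kappa; lia.
- by move: IHf IHg; rewrite /kappa; lia.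
- by move: IH; rewrite /kappa; lia.
- by move: IHf IHg; rewrite /kappa; lia.
- by have := dsize_enc_set A; move: IH; rewrite /kappa; lia.
Qed.

Definition bound Phi : nat := 2 ^ (2 ^ (kappa * fsize Phi)).

Lemma bound_ge Phi : sz Phi <= bound Phi.
Proof.
rewrite /sz enc_formE; apply: leq_trans (dsize_enc_form Phi) _.
by apply: leq_trans (ltnW (ltn_expl _ (ltnSn 1))) _; exact: ltnW (ltn_expl _ (ltnSn 1)).
Qed.

Lemma pb_bound (f : form AP Ag -> nat) : (forall Phi, f Phi <= bound Phi) -> pb bound f.
Proof. by move=> h; exists 1 => Phi; rewrite expn1. Qed.

Lemma ctime_description : ctime bound (@description AP Ag).
Proof.
have ge := bound_ge.
have le_bound m Phi : m <= kappa * fsize Phi -> 2 ^ (2 ^ m) <= bound Phi.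
  by move=> h; rewrite !leq_exp2l.
have kn Phi k : k <= 30 -> k * fsize Phi <= kappa * fsize Phi.
  by move=> h; rewrite leq_mul2r /kappa; apply/orP; right; lia.
have hphi : ctime bound (fun Phi => enc_form Phi).
  by apply: (ctime_recode (g := fun Phi => Phi)) => [Phi|]; [rewrite enc_data enc_formE | exact: ctime_id].
have hC : ctime bound (fun Phi => cl Phi).
  by apply: ctime_undup => //; exact: (ctime_app1 ge ptime_closure).
have hV : ctime bound (fun Phi => VL Phi).
  apply: ctime_subseqs => //; apply: pb_bound => Phi; apply: leq_trans (le_bound _ _ (kn Phi 1 isT)).
  by rewrite leq_exp2l // mul1n; apply: leq_trans (size_cl _) (ltnW (ltn_expl _ _)).
have hU : ctime bound (fun Phi => UL Phi).
  by apply: (ctime_app1 ge (F := fun C : seq data => [seq d <- C | dhd d == dnat 5])) => //; pt.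
have hB : ctime bound (fun Phi => bdata Phi).
  by apply: (ctime_app1 ge (F := fun C : seq data => [seq d <- C | dhd d == dnat 6])) => //; pt.
have hP : ctime bound (fun Phi => pend Phi) by apply: ctime_pairs.
have hvv : ctime bound (fun Phi => vv Phi) by apply: ctime_pairs.
have hNV : ctime bound (fun Phi => subseqs (VL Phi)).
  apply: ctime_subseqs => //; apply: pb_bound => Phi; apply: leq_trans (le_bound _ _ (kn Phi 1 isT)).
  by rewrite leq_exp2l // mul1n size_VL.
have hNP : ctime bound (fun Phi => subseqs (pend Phi)).
  apply: ctime_subseqs => //; apply: pb_bound => Phi; apply: leq_trans (le_bound _ _ (kn Phi 2 isT)).
  by rewrite leq_exp2l // size_pend.
have hN : ctime bound (fun Phi => nodesl Phi) by apply: ctime_pairs.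
have hK : ctime bound (fun Phi => size (vv Phi)) by apply: ctime_size_nat.
have hS : ctime bound (fun Phi => states Phi).
  apply: ctime_pairs => //.
    apply: ctime_iota => //; apply: ctime_add => //; first by apply: ctime_add.
    exact: ctime_const.
  apply: ctime_allseqs => //; apply: pb_bound => Phi.
  by apply: leq_trans (size_allseqs_bound Phi) (le_bound _ _ (kn Phi 6 isT)).
have hpd : ctime bound (fun Phi => pdata Phi).
  apply: ctime_cat => //; first exact: ctime_const.
  by apply: (ctime_app1 ge (F := fun C : seq data => [seq Node (dnat 1) d | d <- C])) => //; pt.
(* The letters are the subsets of [AP] and of the basic subformulas together; the term [2 * #|AP|]
   of [kappa] pays for the propositions. *)
have hL : ctime bound (fun Phi => subseqs (pdata Phi)).
  apply: ctime_subseqs => //; apply: pb_bound => Phi.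
  rewrite -enc_plist size_map /plist size_cat (size_map inl) (size_map inr) -cardT.
  apply: leq_trans (le_bound _ _ (leqnn _)); rewrite leq_exp2l //.
  apply: leq_trans (ltnW (ltn_expl _ (ltnSn 1))) _; rewrite leq_exp2l //.
  have -> : size (blist Phi) = #|basic Phi|.
    rewrite cardE; apply: perm_size; apply: uniq_perm; rewrite ?enum_uniq ?blist_uniq // => x.
    by rewrite mem_blist mem_enum.
  apply: (@leq_trans ((#|AP| + 1) * fsize Phi)); last by rewrite leq_mul // /kappa; lia.
  by rewrite mulnDl mul1n leq_add ?card_basic // leq_pmulr // fsize_gt0.
have henv : ctime bound (fun Phi => env Phi).
  by do 4!apply: (ctime_pair ge) => //.
rewrite /description.
apply: (ctime_comp ge ptime_tout (f := fun Phi => ((env Phi, (bdata Phi, enc_form Phi)), subseqs (pdata Phi)))).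
by apply: (ctime_pair ge) => //; do 2!apply: (ctime_pair ge) => //.
Qed.
End Time.

Theorem theorem2 :
  exists c : nat,
  forall AP Ag Ac : finType,
  exists (p : program) (k : nat),
  forall Phi : form AP Ag,
  is_state Phi ->
  exists A : acg (props Phi) Ag,
    [/\ exists (a : data) (t : nat),
          [/\ computes p (enc_form Phi) a t,
              describes a A &
              t <= 2 ^ (2 ^ (k * fsize Phi ^ k))],
        forall T : cgt Ag Ac (props Phi), accepts A T <-> well_formed T,
        acg_size A <= c * 2 ^ (2 ^ (c * (fsize Phi * trunc_log 2 (fsize Phi)))) &
        acg_index A <= 2 ^ (c * fsize Phi)].
Proof.
exists 16 => AP Ag Ac.
have [p [_ [time [[k hk] comp]]]] := ctime_description AP Ag.
(* With [n] the size of [Phi], [bound Phi ^ k] equals [2 ^ (2 ^ (kappa * n) * k)]; as [k <= 2 ^ k],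
   the inner exponent becomes [kappa * n + k], which is at most [(kappa + k).+1 * n] since [n] is
   positive. *)
exists p, (kappa AP Ag + k).+1 => Phi st; exists (aut Phi); split.
- have [t ev le_t] := comp Phi; exists (description Phi), t; split.
  + by rewrite -enc_formE -[description Phi]enc_data.
  + exact: describes_aut.
  apply: leq_trans le_t (leq_trans (hk Phi) _).
  rewrite /bound -expnM leq_exp2l //.
  apply: (@leq_trans (2 ^ (kappa AP Ag * fsize Phi) * 2 ^ k)).
    by rewrite leq_mul //; exact: ltnW (ltn_expl _ _).
  rewrite -expnD leq_exp2l //; have n0 := fsize_gt0 Phi.
  apply: (@leq_trans ((kappa AP Ag + k).+1 * fsize Phi)); first nia.
  by rewrite leq_mul // -{1}[fsize Phi]expn1 leq_pexp2l.
- by move=> T; exact: aut_accepts.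
- exact: aut_size.
- exact: aut_index.
Qed.
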